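(* Let $G$ be a connected colored graph whose set of vertex colors is disjoint from its set of edge colors. The ideal $I_G$ is binomial (generated by binomials) if and only if $G$ is a triangle-regular block graph. Moreover, in this case $I_G$ is generated by the union of the set of linear binomials $$\{\sigma_{i,j}-\sigma_{k,l}\mid i,j,k,l\in V(G),\ \Lambda(i\leftrightarrow j)=\Lambda(k\leftrightarrow l)\}$$ and the set of quadratic binomials $$\{\sigma_{i,j}\sigma_{k,l}-\sigma_{i,k}\sigma_{j,l}\mid i,j,k,l\in V(G),\ E(i\leftrightarrow j)\cup E(k\leftrightarrow l)=E(i\leftrightarrow k)\cup E(j\leftrightarrow l)\},$$ where the unions of edge sets are taken as multisets.
   Context: Graphs are finite, undirected, without loops or multiple edges. A colored graph is a graph $G$ together with a map $\lambda$ assigning a color to each vertex and to each edge. Ideal. $\mathcal{L}_G$ is the linear space of real symmetric $V(G)\times V(G)$ matrices $K=(k_{ij})$ such that: $k_{ij}=0$ whenever $i\ne j$ and $\{i,j\}\notin E(G)$; $k_{ii}=k_{jj}$ whenever $\lambda(i)=\lambda(j)$; $k_{ij}=k_{i'j'}$ whenever $\{i,j\},\{i',j'\}$ are edges with $\lambda(\{i,j\})=\lambda(\{i',j'\})$. $\mathcal{L}_G^{-1}$ is the (Zariski) closure of $\{K^{-1}\mid K\in\mathcal{L}_G\text{ invertible}\}$. $I_G$ is the ideal of polynomials in $\mathbb{R}[\Sigma]=\mathbb{R}[\sigma_{ij}\mid i,j\in V(G)]/(\sigma_{ij}-\sigma_{ji})$ that vanish on $\mathcal{L}_G^{-1}$.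 A binomial is a polynomial of the form $\sigma^\alpha-\sigma^\beta$ for multi-indices $\alpha,\beta$. Block graph. A connected graph is a block graph if it is complete, or else its vertex set admits a partition into three nonempty subsets $A,B,\{c\}$ such that no edge connects a vertex of $A$ to a vertex of $B$ and the induced subgraphs on $A\cup\{c\}$ and $B\cup\{c\}$ are block graphs (recursive definition). In a block graph any two vertices $u,v$ are connected by a unique shortest path, denoted $u\leftrightarrow v$ (of length $0$ if $u=v$); $E(u\leftrightarrow v)$ is its edge set, and $\Lambda(u\leftrightarrow v)$ is the multiset of all vertex colors and edge colors of the vertices (including endpoints) and edges of $u\leftrightarrow v$. Triangle-regular. A triangle is a set of three pairwise adjacent vertices; colored triangles (with their vertex and edge colors) are compared up to color-preserving isomorphism. $G$ is vertex-regular if any two vertices of the same color are incident with the same multiset of colored edges; edge-regular if any two edges of the same color are incident with the same multiset of colored vertices; edge triangle-regular if any two edges of the same color are contained in the same multiset of colored triangles; and triangle-regular if it is all three. *)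

(* Defs.v *)
From HB Require Import structures.
From mathcomp Require Import all_boot all_order all_algebra.
From mathcomp Require Import mpoly reals.
Set Implicit Arguments.
Unset Strict Implicit.
Unset Printing Implicit Defensive.
Import GRing.Theory.
Local Open Scope ring_scope.

(* The colors of non-edges, [ecol g s] with [s] not an edge, are never used. *)
Record cgraph (V : finType) (C : eqType) := CGraph {
  adj :> rel V;
  adj_sym : forall x y, adj x y = adj y x;
  adj_irr : irreflexive adj;
  vcol : V -> C;
  ecol : {set V} -> C
}.

Section Graphs.
Variables (V : finType) (C : eqType) (G : cgraph V C).

Definition is_edge (s : {set V}) : Prop :=
  exists x y : V, G x y /\ s = [set x; y].

Definition disjoint_colors : Prop :=
  forall (x : V) (s : {set V}), is_edge s -> vcol G x <> ecol G s.

Definition induced (S : {set V}) : rel V :=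
  [rel x y | [&& x \in S, y \in S & G x y]].

Definition connected_on (S : {set V}) : Prop :=
  forall x y : V, x \in S -> y \in S -> connect (induced S) x y.

Definition connected_graph : Prop := connected_on [set: V].

Definition complete_on (S : {set V}) : Prop :=
  forall x y : V, x \in S -> y \in S -> x != y -> G x y.

Definition separates (S A B : {set V}) (c : V) : Prop :=
  [/\ S = A :|: B :|: [set c],
      A != set0 /\ B != set0,
      [disjoint A & B],
      c \notin A :|: B &
      forall x y : V, x \in A -> y \in B -> ~~ G x y].

Inductive block_on : {set V} -> Prop :=
| BlockComplete S : connected_on S -> complete_on S -> block_on S
| BlockGlue S A B c :
    connected_on S -> separates S A B c ->
    block_on (A :|: [set c]) -> block_on (B :|: [set c]) -> block_on S.

Definition block_graph : Prop := block_on [set: V].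

(* As in [path], the walk [u :: p] is represented by its first vertex [u] and
   the sequence [p] of the following vertices. *)
Definition is_walk (u v : V) (p : seq V) : Prop := path G u p /\ last u p = v.

Definition shortest_path (u v : V) (p : seq V) : Prop :=
  is_walk u v p /\ forall q, is_walk u v q -> (size p <= size q)%N.

Definition path_edges (u : V) (p : seq V) : seq {set V} :=
  pairmap (fun x y => [set x; y]) u p.

(* Multisets are sequences up to [perm_eq]. *)
Definition path_colors (u : V) (p : seq V) : seq C :=
  map (vcol G) (u :: p) ++ map (ecol G) (path_edges u p).

(* Lambda(i <-> j) = Lambda(k <-> l); in a block graph the shortest paths are
   unique. *)
Definition same_path_colors (i j k l : V) : Prop :=
  exists p q : seq V,
    [/\ shortest_path i j p, shortest_path k l q &
        perm_eq (path_colors i p) (path_colors k q)].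

(* E(i <-> j) + E(k <-> l) = E(i <-> k) + E(j <-> l) *)
Definition same_path_edges (i j k l : V) : Prop :=
  exists pij pkl pik pjl : seq V,
    [/\ shortest_path i j pij, shortest_path k l pkl,
        shortest_path i k pik, shortest_path j l pjl &
        perm_eq (path_edges i pij ++ path_edges k pkl)
                (path_edges i pik ++ path_edges j pjl)].

Definition incident_edge_colors (x : V) : seq C :=
  [seq ecol G [set x; y] | y <- enum V & G x y].

Definition incident_vertex_colors (s : {set V}) : seq C :=
  [seq vcol G x | x <- enum s].

Definition vertex_regular : Prop :=
  forall x y : V, vcol G x = vcol G y ->
    perm_eq (incident_edge_colors x) (incident_edge_colors y).

Definition edge_regular : Prop :=
  forall s t : {set V}, is_edge s -> is_edge t -> ecol G s = ecol G t ->
    perm_eq (incident_vertex_colors s) (incident_vertex_colors t).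

Definition triangle (T : {set V}) : bool :=
  (#|T| == 3)%N && [forall x in T, forall y in T, (x != y) ==> G x y].

(* For triangles [T] and [T'], the condition [f @: T = T'] makes [f] a bijection
   from [T] to [T'], and adjacency is automatically preserved. *)
Definition triangle_iso (T T' : {set V}) : bool :=
  [exists f : {ffun V -> V},
    [&& f @: T == T',
        [forall x in T, vcol G (f x) == vcol G x] &
        [forall x in T, forall y in T,
          (x != y) ==> (ecol G [set f x; f y] == ecol G [set x; y])]]].

(* The multiplicity of the isomorphism class of [T] among the triangles
   containing the edge [s]. *)
Definition triangle_mult (s T : {set V}) : nat :=
  #|[set T' : {set V} | [&& triangle T', s \subset T' & triangle_iso T' T]]|.

Definition edge_triangle_regular : Prop :=
  forall s t : {set V}, is_edge s -> is_edge t -> ecol G s = ecol G t ->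
  forall T : {set V}, triangle T -> triangle_mult s T = triangle_mult t T.

Definition triangle_regular : Prop :=
  [/\ vertex_regular, edge_regular & edge_triangle_regular].

End Graphs.

(* R[sigma_ij]/(sigma_ij - sigma_ji) is realized as the polynomial ring with
   one variable for each pair (i, j) such that i precedes or equals j in the
   enumeration of V. *)
Definition spair (V : finType) : finType :=
  {p : V * V | (enum_rank p.1 <= enum_rank p.2)%N}.

Notation sigma_ring R V := {mpoly R[#|spair V|]}.

Section Ideals.
Variables (R : realType) (V : finType) (C : eqType) (G : cgraph V C).

Definition spair_of (i j : V) : spair V :=
  match leqP (enum_rank i) (enum_rank j) with
  | LeqNotGtn h => exist _ (i, j) h
  | GtnNotLeq h => exist _ (j, i) (ltnW h)
  end.

Definition sigma (i j : V) : sigma_ring R V :=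
  'X_(enum_rank (spair_of i j)).

Definition entry (A : 'M[R]_#|V|) (i j : V) : R :=
  A (enum_rank i) (enum_rank j).

Definition eval_at (A : 'M[R]_#|V|) (p : sigma_ring R V) : R :=
  p.@[fun s => entry A (val (enum_val s)).1 (val (enum_val s)).2].

Fact sigmaC (i j : V) : sigma i j = sigma j i.
Proof.
congr 'X_(enum_rank _); apply: val_inj; rewrite /spair_of.
case: leqP => h1; case: leqP => h2 //=.
  by have/val_inj/enum_rank_inj-> := anti_leq (introT andP (conj h1 h2)).
by move: (ltn_trans h1 h2); rewrite ltnn.
Qed.

Fact eval_at_sigma (A : 'M[R]_#|V|) (i j : V) :
  A^T = A -> eval_at A (sigma i j) = entry A i j.
Proof.
move=> symA; rewrite /eval_at mevalXU enum_rankK /spair_of.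
by case: leqP => h //=; rewrite /entry -[in LHS]symA mxE.
Qed.

Definition concentration_space (K : 'M[R]_#|V|) : Prop :=
  [/\ K^T = K,
      forall i j : V, i != j -> ~~ G i j -> entry K i j = 0,
      forall i j : V, vcol G i = vcol G j -> entry K i i = entry K j j &
      forall i j i' j' : V, G i j -> G i' j' ->
        ecol G [set i; j] = ecol G [set i'; j'] ->
        entry K i j = entry K i' j'].

Definition inverses (A : 'M[R]_#|V|) : Prop :=
  exists K, [/\ concentration_space K, K \in unitmx & A = invmx K].

Definition zariski_closed (Z : 'M[R]_#|V| -> Prop) : Prop :=
  exists P : sigma_ring R V -> Prop,
    forall A, Z A <-> A^T = A /\ forall p, P p -> eval_at A p = 0.

Definition zariski_closure (S : 'M[R]_#|V| -> Prop) (A : 'M[R]_#|V|) : Prop :=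
  forall Z, zariski_closed Z -> (forall B, S B -> Z B) -> Z A.

Definition inverse_space : 'M[R]_#|V| -> Prop := zariski_closure inverses.

Definition graph_ideal (p : sigma_ring R V) : Prop :=
  forall A, inverse_space A -> eval_at A p = 0.

Definition ideal_gen (S : sigma_ring R V -> Prop) (p : sigma_ring R V) : Prop :=
  exists (n : nat) (a g : 'I_n -> sigma_ring R V),
    (forall k, S (g k)) /\ p = \sum_(k < n) a k * g k.

Definition generates (S I : sigma_ring R V -> Prop) : Prop :=
  forall p, I p <-> ideal_gen S p.

Definition binomial (p : sigma_ring R V) : Prop :=
  exists a b : 'X_{1..#|spair V|}, p = 'X_[a] - 'X_[b].

Definition binomial_ideal (I : sigma_ring R V -> Prop) : Prop :=
  exists S, (forall p, S p -> binomial p) /\ generates S I.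

Definition linear_binomials (p : sigma_ring R V) : Prop :=
  exists i j k l : V,
    same_path_colors G i j k l /\ p = sigma i j - sigma k l.

Definition quadratic_binomials (p : sigma_ring R V) : Prop :=
  exists i j k l : V,
    same_path_edges G i j k l /\
    p = sigma i j * sigma k l - sigma i k * sigma j l.

End Ideals.

(* Main.v *)
From HB Require Import structures.
From mathcomp Require Import all_boot all_order all_algebra.
From mathcomp Require Import mpoly reals.
From mathcomp Require Import zify ring lra.
Require Import Defs.
Set Implicit Arguments.
Unset Strict Implicit.
Unset Printing Implicit Defensive.
Import Order.TTheory GRing.Theory Num.Theory.
Local Open Scope ring_scope.

(** A connected graph is a block graph iff any two non-adjacent neighbours [a],
    [b] of a vertex [k] are separated by [k]; in this case the geodesics are the
    walks none of whose steps could be shortcut by an edge.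

    If the ideal I is binomial, its variety is closed under the entrywise product,
    and [adj A] lies in L_G for every A in it. Multiplying with the identity matrix
    shows that the diagonal of A depends on vertex colors only, and multiplying with
    [(1 - e A)^-1] that the ratios [A_ij / (A_ii A_jj)] depend on edge colors only.
    Expanding the inverse of [D - e T], for D diagonal and T supported on the edges,
    to second order in e gives vertex regularity and the triangle counts. Weighted
    Laplacians, whose adjugates have rank one, give edge regularity, and the inverse
    of the M-matrix [n - Adj], whose minors are nonnegative, gives the separation
    property.

    Conversely, let G be a triangle-regular block graph and N the adjugate of a
    matrix [K = 1 + O(e)] in L_G. Separation by a vertex makes a 2x2 minor of N
    vanish, so N_ij is a product of edge entries divided by diagonal entries along
    the geodesic. The equations given by K N = det K then show, by induction on the
    order in e, that the diagonal and edge entries of N depend on colors only. Hence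
    the given binomials belong to I. They generate I by two further facts. Monomials
    whose geodesics have the same total content of colors are congruent: reading
    geodesics as words in the colors, arms at vertices of the same color can be
    exchanged whenever the result is again a geodesic, and any prescribed geodesic
    is created letter by letter. Monomials of different content are separated by a
    one-parameter family in L_G^-1 whose (i, j) entry is [e^w (1 + O(e))] with w a
    weight in which the content of the geodesic can be read off. *)

(** * Matrices indexed by vertices and the variety of inverses *)

(** Two obstacles shape the development. First, inverses of power series are avoided: adjugates of
    matrices over R[e] replace inverses, divisibility by e^n replaces truncation, and what holds
    outside the zeros of a nonzero polynomial in e extends to all e because the variety is closed.
    This also puts adjugates of singular matrices of L_G, such as Laplacians, in the variety.
    Second, triangle regularity compares edges without orientation, while along a geodesic one has
    to know which colors continue inside and outside the block of an edge at a given end. If the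
    ends have different colors, these recover the orientation; if they have the same color, only the
    sum over both ends is invariant, and the two summands are shown to be equal. After that the
    continuations of a geodesic depend on colors only, so geodesics can be transported between
    vertices and it suffices to manipulate words. In the separating family, the weights see only the
    two ends and the edges of a geodesic; edge regularity recovers its interior vertex colors. *)

Section Entries.
Variables (V : finType).

Definition ent (T : Type) (A : 'M[T]_#|V|) (i j : V) : T :=
  A (enum_rank i) (enum_rank j).

Definition mxV (T : Type) (f : V -> V -> T) : 'M[T]_#|V| :=
  \matrix_(a, b) f (enum_val a) (enum_val b).

Lemma ent_mxV (T : Type) (f : V -> V -> T) i j : ent (mxV f) i j = f i j.
Proof. by rewrite /ent mxE !enum_rankK. Qed.

Lemma entP (T : Type) (A B : 'M[T]_#|V|) : ent A =2 ent B -> A = B.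
Proof.
move=> eqAB; apply/matrixP=> a b.
by have := eqAB (enum_val a) (enum_val b); rewrite /ent !enum_valK.
Qed.

Lemma ent_tr (T : Type) (A : 'M[T]_#|V|) i j : ent A^T i j = ent A j i.
Proof. by rewrite /ent mxE. Qed.

Lemma sym_entP (T : Type) (A : 'M[T]_#|V|) :
  A^T = A <-> forall i j, ent A i j = ent A j i.
Proof.
split=> [symA i j|symA]; first by rewrite -ent_tr symA.
by apply/entP=> i j; rewrite ent_tr.
Qed.

Lemma ent_map (T U : Type) (f : T -> U) (A : 'M[T]_#|V|) i j :
  ent (map_mx f A) i j = f (ent A i j).
Proof. by rewrite /ent mxE. Qed.

Lemma sum_ord_rank (U : nmodType) (F : 'I_#|V| -> U) :
  \sum_k F k = \sum_(v : V) F (enum_rank v).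
Proof.
rewrite (reindex (@enum_rank V)) //.
by apply: onW_bij; exists enum_val; [exact: enum_rankK | exact: enum_valK].
Qed.

Variable (T : pzRingType).
Implicit Types A B : 'M[T]_#|V|.

Lemma ent_mul A B i j : ent (A *m B) i j = \sum_v ent A i v * ent B v j.
Proof. by rewrite /ent mxE sum_ord_rank. Qed.

Lemma ent_add A B i j : ent (A + B) i j = ent A i j + ent B i j.
Proof. by rewrite /ent mxE. Qed.

Lemma ent_opp A i j : ent (- A) i j = - ent A i j.
Proof. by rewrite /ent mxE. Qed.

Lemma ent_scale a A i j : ent (a *: A) i j = a * ent A i j.
Proof. by rewrite /ent mxE. Qed.

Lemma ent_scalar a i j : ent (a%:M : 'M[T]_#|V|) i j = a *+ (i == j).
Proof. by rewrite /ent mxE (inj_eq enum_rank_inj). Qed.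

End Entries.

Section DetEntries.
Variables (F : fieldType) (V : finType).
Implicit Type A : 'M[F]_#|V|.

Lemma det_neq0_ent A :
  (forall x : V -> F, (forall i, \sum_y ent A i y * x y = 0) -> forall y, x y = 0) ->
  \det A != 0.
Proof.
move=> injA; rewrite -det_tr; apply/negP => /det0P[x /eqP x0 xA].
apply: x0; apply/rowP=> a; rewrite mxE -[a]enum_valK.
apply: (injA (fun y => x 0 (enum_rank y))) => i.
have := congr1 (fun r : 'rV_#|V| => r 0 (enum_rank i)) xA.
rewrite [LHS]mxE [RHS]mxE sum_ord_rank => xAi; rewrite -[RHS]xAi.
by apply: eq_bigr => y _; rewrite mxE mulrC.
Qed.

Lemma det_eq0_ent A (x : V -> F) v :
  (forall i, \sum_y ent A i y * x y = 0) -> x v != 0 -> \det A = 0.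
Proof.
move=> Ax xv; apply/eqP; rewrite -det_tr; apply/det0P.
exists (\row_a x (enum_val a)).
  by apply: contraNneq xv => /rowP/(_ (enum_rank v)); rewrite !mxE enum_rankK => ->.
apply/rowP=> a; rewrite [RHS]mxE -[RHS](Ax (enum_val a)) mxE sum_ord_rank.
by apply: eq_bigr => y _; rewrite !mxE enum_rankK /ent enum_valK mulrC.
Qed.

End DetEntries.

Section PolyZero.
Variable R : numDomainType.

Lemma poly_fun0 (p : {poly R}) : (forall e, p.[e] = 0) -> p = 0.
Proof.
move=> p0; apply: (@roots_geq_poly_eq0 _ p [seq n%:R | n <- iota 0 (size p)]).
- by apply/allP=> x _; apply/rootP.
- rewrite map_inj_uniq ?iota_uniq // => m n /eqP; rewrite eqr_nat => /eqP; exact.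
- by rewrite size_map size_iota.
Qed.

(** Turns a statement about generic parameters into an identity of polynomials: [q * p] vanishes
    everywhere. *)
Lemma poly_fun0_generic (p q : {poly R}) :
  q != 0 -> (forall e, q.[e] != 0 -> p.[e] = 0) -> p = 0.
Proof.
move=> q0 pq0; suff: q * p = 0 by move/eqP; rewrite mulf_eq0 (negPf q0) => /eqP.
apply: poly_fun0 => e; rewrite hornerM.
by have [->|/pq0 ->] := eqVneq q.[e] 0; rewrite ?mul0r ?mulr0.
Qed.

End PolyZero.

Section IdealBasics.
Variables (R : realType) (V : finType) (C : eqType) (G : cgraph V C).
Local Notation I := (@graph_ideal R V C G).
Local Notation X := (@inverse_space R V C G).
Local Notation L := (@concentration_space R V C G).
Implicit Types (A B K : 'M[R]_#|V|) (p q : sigma_ring R V).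

HB.instance Definition _ A := GRing.RMorphism.copy (@eval_at R V A)
  (meval (fun s => entry A (val (enum_val s)).1 (val (enum_val s)).2)).

Lemma eval_atB A p q : eval_at A (p - q) = eval_at A p - eval_at A q.
Proof. exact: rmorphB. Qed.

Lemma eval_atM A p q : eval_at A (p * q) = eval_at A p * eval_at A q.
Proof. exact: rmorphM. Qed.

Lemma inverses_sym A : inverses G A -> A^T = A.
Proof. by case=> K [[symK _ _ _] _ ->]; rewrite trmx_inv symK. Qed.

Lemma inverses_in_X A : inverses G A -> X A.
Proof. by move=> invA Z _; apply. Qed.

Lemma graph_idealP p : I p <-> forall A, inverses G A -> eval_at A p = 0.
Proof.
split=> [Ip A /inverses_in_X|p0 A XA]; first exact: Ip.
(* The symmetric zeros of [p] form a Zariski closed set containing the inverses. *)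
have [||_] := XA (fun B => B^T = B /\ forall q, q = p -> eval_at B q = 0).
- by exists (fun q => q = p) => B; split.
- by move=> B invB; split=> [|q ->]; [exact: inverses_sym | exact: p0].
- exact.
Qed.

Lemma inverse_spaceP A : X A <-> A^T = A /\ forall p, I p -> eval_at A p = 0.
Proof.
split=> [XA|[symA A0] Z [P PZ] invZ].
  have [||? ?] := XA (fun B => B^T = B /\ forall q, I q -> eval_at B q = 0).
  - by exists I => B; split.
  - move=> B invB; split=> [|q Iq]; first exact: inverses_sym.
    exact: Iq (inverses_in_X invB).
  - by split.
apply/PZ; split=> // p Pp; apply: A0; apply/graph_idealP=> B /invZ/PZ[_]; exact.
Qed.

Lemma inverse_space_sym A : X A -> forall i j, ent A i j = ent A j i.
Proof. by case/inverse_spaceP=> /sym_entP. Qed.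

Definition gen_mx : 'M[sigma_ring R V]_#|V| := mxV (@sigma R V).

Lemma eval_gen_mx A : A^T = A -> map_mx (eval_at A) gen_mx = A.
Proof.
by move=> symA; apply/entP=> i j; rewrite ent_map ent_mxV eval_at_sigma.
Qed.

Lemma eval_adj_gen_mx A i j :
  A^T = A -> eval_at A (ent (\adj gen_mx) i j) = ent (\adj A) i j.
Proof.
by move=> symA; rewrite -(ent_map (eval_at A)) map_mx_adj eval_gen_mx.
Qed.

Lemma adj_inv_unit K : K \in unitmx -> \adj (invmx K) = (\det K)^-1 *: K.
Proof.
move=> Ku; have := mul_mx_adj (invmx K) => /(congr1 (mulmx K)).
by rewrite mulmxA mulmxV // mul1mx mul_mx_scalar det_inv.
Qed.

Lemma concentrationZ a K : L K -> L (a *: K).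
Proof.
case=> symK K0 Kv Ke; split; first by rewrite linearZ /= symK.
- by move=> i j ij nG; rewrite [LHS]ent_scale [X in a * X]K0 ?mulr0.
- by move=> i j ij; rewrite [LHS]ent_scale [RHS]ent_scale; congr (_ * _); apply: Kv.
- by move=> *; rewrite [LHS]ent_scale [RHS]ent_scale; congr (_ * _); apply: Ke.
Qed.

Lemma concentrationD A B : L A -> L B -> L (A + B).
Proof.
case=> symA A0 Av Ae [symB B0 Bv Be]; split; first by rewrite linearD /= symA symB.
- by move=> i j ij nG; rewrite [LHS]ent_add [X in X + _]A0 // [X in _ + X]B0 ?addr0.
- by move=> i j ij; rewrite [LHS]ent_add [RHS]ent_add; congr (_ + _); [apply: Av|apply: Bv].
- by move=> *; rewrite [LHS]ent_add [RHS]ent_add; congr (_ + _); [apply: Ae|apply: Be].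
Qed.

Lemma concentration1 a : L a%:M.
Proof.
split; first by rewrite tr_scalar_mx.
- by move=> i j /negPf ij _; rewrite [LHS]ent_scalar ij.
- by move=> i j _; rewrite [LHS]ent_scalar [RHS]ent_scalar !eqxx.
- move=> i j k l ij kl _; rewrite [LHS]ent_scalar [RHS]ent_scalar.
  have [eij|_] := eqVneq i j; first by rewrite eij adj_irr in ij.
  by have [ekl|//] := eqVneq k l; rewrite ekl adj_irr in kl.
Qed.

(* Being inverse to a matrix of the concentration space is the vanishing of
   linear forms in the entries of the adjugate. *)
Lemma adj_inverse_space A : X A -> L (\adj A).
Proof.
move=> /inverse_spaceP[symA A0].
have invL B : inverses G B -> L (\adj B).
  by case=> K [LK Ku ->]; rewrite adj_inv_unit //; apply: concentrationZ.
have ent0 i j : (forall B, inverses G B -> ent (\adj B) i j = 0) ->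
    ent (\adj A) i j = 0.
  move=> B0; rewrite -eval_adj_gen_mx //; apply/A0/graph_idealP=> B invB.
  by rewrite eval_adj_gen_mx ?B0 //; apply: inverses_sym invB.
have entE i j k l :
    (forall B, inverses G B -> ent (\adj B) i j = ent (\adj B) k l) ->
    ent (\adj A) i j = ent (\adj A) k l.
  move=> BE; apply/eqP; rewrite -subr_eq0 -!eval_adj_gen_mx // -eval_atB.
  apply/eqP/A0/graph_idealP=> B invB; have symB := inverses_sym invB.
  by rewrite eval_atB !eval_adj_gen_mx // BE // subrr.
split; first by rewrite trmx_adj symA.
- by move=> i j ij nG; apply: ent0 => B /invL[_ B0 _ _]; apply: B0.
- by move=> i j ij; apply: entE => B /invL[_ _ Bv _]; apply: Bv.
- by move=> i j k l ij kl e; apply: entE => B /invL[_ _ _ Be]; apply: Be.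
Qed.

Lemma inverse_space_adj K : L K -> \det K != 0 -> X (\adj K).
Proof.
move=> LK dK; have Ku : K \in unitmx by rewrite unitmxE unitfE.
apply: inverses_in_X; exists ((\det K)^-1 *: K); split.
- exact: concentrationZ.
- by rewrite unitmxZ // unitrV unitfE.
- rewrite invmxZ ?unitmxZ ?unitrV ?unitfE // invrK /invmx Ku scalerA.
  by rewrite mulfV ?scale1r.
Qed.

Lemma horner_adj (M : 'M[{poly R}]_#|V|) e :
  map_mx (horner_eval e) (\adj M) = \adj (map_mx (horner_eval e) M).
Proof. exact: map_mx_adj. Qed.

(** [char_poly_mx (- A)] is ['X + A]. Its determinant is monic, hence nonzero, so it deforms a
    possibly singular [A] into a generically invertible family. *)
Lemma horner_shift (A : 'M[R]_#|V|) t :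
  map_mx (horner_eval t) (char_poly_mx (- A)) = t%:M + A.
Proof.
apply/entP=> a b; rewrite ent_map /char_poly_mx !ent_add ent_opp ent_map.
rewrite !ent_scalar ent_opp.
by rewrite /horner_eval hornerD hornerN hornerC hornerMn hornerX opprK.
Qed.

(** Along the family, a polynomial of the ideal becomes a polynomial in the parameter that vanishes
    away from the zeros of [q]. *)
Lemma inverse_space_family (M : 'M[{poly R}]_#|V|) (q : {poly R}) :
  q != 0 ->
  (forall e, q.[e] != 0 -> X (map_mx (horner_eval e) M)) ->
  forall e, X (map_mx (horner_eval e) M).
Proof.
move=> q0 Xq.
have symM : M^T = M.
  apply/entP=> i j; apply/eqP; rewrite -subr_eq0; apply/eqP.
  apply: (poly_fun0_generic q0) => e /Xq /inverse_spaceP[/sym_entP symM _].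
  rewrite hornerD hornerN ent_tr; have := symM i j; rewrite !ent_map /horner_eval.
  by move=> ->; rewrite subrr.
move=> e; apply/inverse_spaceP; split; first by rewrite map_trmx symM.
move=> p Ip.
pose h (s : 'I_#|spair V|) := ent M (val (enum_val s)).1 (val (enum_val s)).2 : {poly R}.
pose P := mmap polyC h p : {poly R}.
have PE x : P.[x] = eval_at (map_mx (horner_eval x) M) p.
  rewrite /P /eval_at /meval /mmap horner_sum; apply: eq_bigr => m _.
  rewrite hornerM hornerC /mmap1 horner_prod; congr (_ * _).
  apply: eq_bigr => i _; rewrite horner_exp; congr (_ ^+ _).
  by rewrite [entry _ _ _]ent_map.
rewrite -PE; suff ->: P = 0 by rewrite horner0.
by apply: (poly_fun0_generic q0) => x /Xq /inverse_spaceP[_]; rewrite PE; apply.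
Qed.

Lemma adj_family (K : 'M[{poly R}]_#|V|) :
  \det K != 0 -> (forall e, L (map_mx (horner_eval e) K)) ->
  forall e, X (map_mx (horner_eval e) (\adj K)).
Proof.
move=> dK LK; apply: (@inverse_space_family _ (\det K)) => // e de.
rewrite horner_adj; apply: inverse_space_adj => //.
by rewrite -[\det _]/(_) det_map_mx.
Qed.

End IdealBasics.

(** * Binomial ideals: regularity from power series *)

Section Truncation.
Variable R : fieldType.
Implicit Types p q d : {poly R}.

Lemma dvdXn_coef n p q i : 'X^n %| p - q -> (i < n)%N -> p`_i = q`_i.
Proof.
by move=> /dvdpP[r pq] lin; rewrite -(subrK q p) pq coefD coefMXn lin add0r.
Qed.

(** A polynomial with nonzero constant term is a unit modulo ['X^n]; this replaces division of power
    series. *)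
Lemma dvdXn_cancel n d p : d.[0] != 0 -> 'X^n %| d * p -> 'X^n %| p.
Proof.
move=> d0; rewrite Gauss_dvdpr //; apply: coprimep_expl.
rewrite coprimep_sym.
have -> : 'X = 'X - 0%:P :> {poly R} by rewrite subr0.
by rewrite coprimep_XsubC /root.
Qed.

Lemma dvdXn_mul n p p' q q' :
  'X^n %| p - p' -> 'X^n %| q - q' -> 'X^n %| p * q - p' * q'.
Proof.
move=> dp dq.
have -> : p * q - p' * q' = (p - p') * q + p' * (q - q') by ring.
by apply: dvdp_add; [apply: dvdp_mulr | apply: dvdp_mull].
Qed.

Variable V : finType.
Local Notation M := ('M[R]_#|V|).
Local Notation MP := ('M[{poly R}]_#|V|).

Definition pmx3 (A0 A1 A2 : M) : MP :=
  map_mx polyC A0 + 'X *: map_mx polyC A1 + 'X^2 *: map_mx polyC A2.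

Lemma ent_pmx3 A0 A1 A2 (i j : V) :
  ent (pmx3 A0 A1 A2) i j =
  (ent A0 i j)%:P + 'X * (ent A1 i j)%:P + 'X^2 * (ent A2 i j)%:P.
Proof. by rewrite !ent_add !ent_scale !ent_map. Qed.

Lemma coef_pmx3 A0 A1 A2 (i j : V) :
  [/\ (ent (pmx3 A0 A1 A2) i j)`_0 = ent A0 i j,
      (ent (pmx3 A0 A1 A2) i j)`_1 = ent A1 i j &
      (ent (pmx3 A0 A1 A2) i j)`_2 = ent A2 i j].
Proof.
by split; rewrite ent_pmx3 !coefD coefC coefXM coefXnM coefC /= ?coefC /=
  ?addr0 ?add0r.
Qed.

Lemma pmx3_mul A0 A1 A2 B0 B1 B2 : exists E : MP,
  pmx3 A0 A1 A2 *m pmx3 B0 B1 B2 =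
  pmx3 (A0 *m B0) (A0 *m B1 + A1 *m B0)
    (A0 *m B2 + A1 *m B1 + A2 *m B0) + 'X^3 *: E.
Proof.
exists (map_mx polyC (A1 *m B2 + A2 *m B1) + 'X *: map_mx polyC (A2 *m B2)).
apply/matrixP=> a b; rewrite !mxE !(rmorphD, rmorph_sum) /=.
rewrite !mulrDr !mulr_sumr -!big_split /=.
by apply: eq_bigr => k _; rewrite !mxE !rmorphM /=; ring.
Qed.

Lemma pmx3_inv A0 A1 A2 Q : A0 *m Q = 1%:M -> exists E : MP,
  pmx3 A0 A1 A2 *m
    pmx3 Q (- (Q *m A1 *m Q)) (Q *m A1 *m Q *m A1 *m Q - Q *m A2 *m Q) =
  1%:M + 'X^3 *: E.
Proof.
move=> AQ; case: (pmx3_mul A0 A1 A2 Q (- (Q *m A1 *m Q))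
  (Q *m A1 *m Q *m A1 *m Q - Q *m A2 *m Q)) => E ->; exists E; congr (_ + _).
rewrite mulmxN mulmxBr !mulmxA AQ !mul1mx addNr mulmxN !mulmxA.
rewrite addrAC subrK subrr /pmx3 !map_mx0 !scaler0 !addr0.
by rewrite map_scalar_mx.
Qed.

(** The second [pmx3] is the Neumann series of [A0 + e A1 + e^2 A2] truncated at [e^3], so its
    product with [N] is [c] modulo [e^3]; multiplying by [\adj N] gives the claim. The scalar [c]
    allows [N] to be built from an adjugate, whose expansion carries a determinant. *)
Lemma adj_expand (N E : MP) (c : {poly R}) A0 A1 A2 Q (i j : V) :
  N = c *: pmx3 A0 A1 A2 + 'X^3 *: E -> A0 *m Q = 1%:M ->
  'X^3 %| \det N *
    ent (pmx3 Q (- (Q *m A1 *m Q))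
      (Q *m A1 *m Q *m A1 *m Q - Q *m A2 *m Q)) i j
    - c * ent (\adj N) i j.
Proof.
move=> defN AQ; set Z := pmx3 Q _ _.
have [E' WZ] := pmx3_inv A1 A2 AQ; rewrite -/Z in WZ.
move: Z WZ => Z WZ.
have : \adj N *m N *m Z = c *: \adj N + 'X^3 *: (c *: (\adj N *m E') + \adj N *m (E *m Z)).
  rewrite -mulmxA [in N *m Z]defN mulmxDl -!scalemxAl WZ.
  rewrite !mulmxDr -!scalemxAr mulmxDr mulmx1 -scalemxAr !scalerDr -!addrA.
  by rewrite !scalerA [c * _]mulrC.
rewrite mul_adj_mx mul_scalar_mx => /(congr1 (fun B => ent B i j)).
by rewrite !ent_scale ent_add !ent_scale => ->; rewrite addrC addKr dvdp_mulIl.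
Qed.

Lemma det_expand0 (N E : MP) (c : {poly R}) A0 A1 A2 Q :
  N = c *: pmx3 A0 A1 A2 + 'X^3 *: E -> A0 *m Q = 1%:M -> c.[0] != 0 ->
  (\det N).[0] != 0.
Proof.
move=> -> /mulmx1_unit[Au _] c0; rewrite -[_.[0]]/(horner_eval 0 _) -det_map_mx.
have -> : map_mx (horner_eval 0) (c *: pmx3 A0 A1 A2 + 'X^3 *: E) = c.[0] *: A0.
  by apply/matrixP=> a b; rewrite !mxE /horner_eval /= !hornerE !expr0n /= !(mul0r, addr0).
rewrite detZ mulf_neq0 ?expf_neq0 //.
by move: Au; rewrite unitmxE unitfE.
Qed.

(** By [det_expand0], [\det N] is a unit modulo [e^3], so equal entries of the adjugate have equal
    coefficients in the truncated inverse. *)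
Lemma adj_expand_eq (N E : MP) (c : {poly R}) A0 A1 A2 Q (i j k l : V) :
  N = c *: pmx3 A0 A1 A2 + 'X^3 *: E -> A0 *m Q = 1%:M -> c.[0] != 0 ->
  ent (\adj N) i j = ent (\adj N) k l ->
  ent (Q *m A1 *m Q) i j = ent (Q *m A1 *m Q) k l /\
  ent (Q *m A1 *m Q *m A1 *m Q - Q *m A2 *m Q) i j =
  ent (Q *m A1 *m Q *m A1 *m Q - Q *m A2 *m Q) k l.
Proof.
move=> defN AQ c0 adjE; have dN := det_expand0 defN AQ c0.
have := adj_expand i j defN AQ; have := adj_expand k l defN AQ.
set Z := pmx3 Q _ _; rewrite adjE => dkl dij.
have {dkl dij} := dvdp_sub dij dkl.
have -> : \det N * ent Z i j - c * ent (\adj N) k l -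
  (\det N * ent Z k l - c * ent (\adj N) k l) =
  \det N * (ent Z i j - ent Z k l) by ring.
move=> /(dvdXn_cancel dN) Zeq.
have := (dvdXn_coef Zeq (isT : 1 < 3)%N, dvdXn_coef Zeq (isT : 2 < 3)%N).
rewrite /Z; have [_ -> ->] := coef_pmx3 Q (- (Q *m A1 *m Q))
      (Q *m A1 *m Q *m A1 *m Q - Q *m A2 *m Q) i j.
have [_ -> ->] := coef_pmx3 Q (- (Q *m A1 *m Q))
      (Q *m A1 *m Q *m A1 *m Q - Q *m A2 *m Q) k l.
by case=> + ->; rewrite !ent_opp => /oppr_inj.
Qed.

Lemma adj_expand_eq0 (N E : MP) (c : {poly R}) A0 A1 A2 Q (i j : V) :
  N = c *: pmx3 A0 A1 A2 + 'X^3 *: E -> A0 *m Q = 1%:M -> c.[0] != 0 ->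
  ent (\adj N) i j = 0 ->
  ent (Q *m A1 *m Q *m A1 *m Q - Q *m A2 *m Q) i j = 0.
Proof.
move=> defN AQ c0 adj0; have dN := det_expand0 defN AQ c0.
have := adj_expand i j defN AQ; set Z := pmx3 Q _ _.
rewrite adj0 mulr0 subr0 => /(dvdXn_cancel dN); rewrite -[ent Z i j]subr0 => Z0.
have := dvdXn_coef Z0 (isT : 2 < 3)%N.
by rewrite /Z coef0; have [_ _ ->] := coef_pmx3 Q (- (Q *m A1 *m Q))
      (Q *m A1 *m Q *m A1 *m Q - Q *m A2 *m Q) i j.
Qed.

End Truncation.

(** * Entrywise products and the diagonal of the inverse *)

Section BinomialClosure.
Variables (R : realType) (V : finType) (C : eqType) (G : cgraph V C).
Local Notation X := (@inverse_space R V C G).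
Local Notation L := (@concentration_space R V C G).
Implicit Types (A B K : 'M[R]_#|V|) (p q : sigma_ring R V).

Definition dmx (T : pzRingType) (s : V -> T) : 'M[T]_#|V| :=
  mxV (fun i j => s i *+ (i == j)).

Definition amx (t : C -> R) : 'M[R]_#|V| :=
  mxV (fun i j => if G i j then t (ecol G [set i; j]) else 0).

Lemma ent_dmx (T : pzRingType) (s : V -> T) i j : ent (dmx s) i j = s i *+ (i == j).
Proof. exact: ent_mxV. Qed.

Lemma ent_amx t i j : ent (amx t) i j = if G i j then t (ecol G [set i; j]) else 0.
Proof. exact: ent_mxV. Qed.

Lemma ent_dmx_mul (T : pzRingType) (s : V -> T) (A : 'M[T]_#|V|) i j :
  ent (dmx s *m A) i j = s i * ent A i j.
Proof.
rewrite ent_mul (bigD1 i) //= ent_dmx eqxx big1 ?addr0 // => v.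
by rewrite ent_dmx eq_sym => /negPf ->; rewrite mul0r.
Qed.

Lemma ent_mul_dmx (T : pzRingType) (s : V -> T) (A : 'M[T]_#|V|) i j :
  ent (A *m dmx s) i j = ent A i j * s j.
Proof.
rewrite ent_mul (bigD1 j) //= ent_dmx eqxx big1 ?addr0 // => v.
by rewrite ent_dmx => /negPf ->; rewrite mulr0.
Qed.

Lemma dmx_mulV (s : V -> R) : (forall v, s v != 0) ->
  dmx (fun v => (s v)^-1) *m dmx s = 1%:M.
Proof.
move=> s0; apply/entP=> i j; rewrite ent_dmx_mul ent_dmx ent_scalar mulrnAr.
by rewrite mulVf.
Qed.

Lemma concentration_dmx (d : V -> R) :
  (forall i j, vcol G i = vcol G j -> d i = d j) -> L (dmx d).
Proof.
move=> dv; split.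
- by apply/sym_entP=> i j; rewrite !ent_dmx eq_sym; case: eqVneq => // ->.
- by move=> i j /negPf ij _; rewrite [LHS]ent_dmx ij.
- by move=> i j /dv e; rewrite [LHS]ent_dmx [RHS]ent_dmx e !eqxx.
- move=> i j k l ij kl _; rewrite [LHS]ent_dmx [RHS]ent_dmx.
  have [eij|_] := eqVneq i j; first by rewrite eij adj_irr in ij.
  by have [ekl|//] := eqVneq k l; rewrite ekl adj_irr in kl.
Qed.

Lemma concentration_amx t : L (amx t).
Proof.
split.
- by apply/sym_entP=> i j; rewrite !ent_amx adj_sym setUC.
- by move=> i j _ /negPf ij; rewrite [LHS]ent_amx ij.
- by move=> i j _; rewrite [LHS]ent_amx [RHS]ent_amx !adj_irr.
- by move=> i j k l ij kl e; rewrite [LHS]ent_amx [RHS]ent_amx ij kl e.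
Qed.

(* The inverse of [diag(1/s) - e T] is [S + e S T S + e^2 S T S T S] mod [e^3]. *)
Definition kpoly (s t : C -> R) : 'M[{poly R}]_#|V| :=
  pmx3 (dmx (fun v => (s (vcol G v))^-1)) (- amx t) 0.

Lemma horner_pmx3 (A0 A1 A2 : 'M[R]_#|V|) e :
  map_mx (horner_eval e) (pmx3 A0 A1 A2) = A0 + e *: A1 + e ^+ 2 *: A2.
Proof.
apply/entP=> i j; rewrite ent_map ent_pmx3 /horner_eval !hornerE.
by rewrite !ent_add !ent_scale.
Qed.

Lemma concentration_kpoly s t e : L (map_mx (horner_eval e) (kpoly s t)).
Proof.
rewrite horner_pmx3 scaler0 addr0 scalerN -scaleNr.
apply: concentrationD; first by apply: concentration_dmx => i j ->.
exact/concentrationZ/concentration_amx.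
Qed.

Lemma kpoly_expand s t : kpoly s t =
  1 *: pmx3 (dmx (fun v => (s (vcol G v))^-1)) (- amx t) 0 + 'X^3 *: 0.
Proof. by rewrite scaler0 addr0 scale1r. Qed.

Lemma det_kpoly0 s t : (forall c, s c != 0) -> (\det (kpoly s t)).[0] != 0.
Proof.
move=> s0; apply: (det_expand0 (kpoly_expand s t)
  (dmx_mulV (s := fun v => s (vcol G v)) _)) => //.
by rewrite hornerC oner_eq0.
Qed.

Lemma poly_neq0_horner (p : {poly R}) e : p.[e] != 0 -> p != 0.
Proof. by apply: contraNneq => ->; rewrite horner0. Qed.

Lemma adj_kpoly s t e : (forall c, s c != 0) ->
  X (map_mx (horner_eval e) (\adj (kpoly s t))).
Proof.
move=> s0; apply: adj_family; last exact: concentration_kpoly.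
exact: poly_neq0_horner (det_kpoly0 t s0).
Qed.

Lemma adj_kpoly0 s t i : (forall c, s c != 0) ->
  (ent (\adj (kpoly s t)) i i).[0] != 0.
Proof.
move=> s0; have s0v v : s (vcol G v) != 0 by [].
have := adj_expand i i (kpoly_expand s t) (dmx_mulV s0v).
rewrite mul1r => /dvdXn_coef => /(_ 0%N isT); rewrite coef0M -!horner_coef0.
move=> <-; rewrite mulf_neq0 ?det_kpoly0 //.
by rewrite ent_pmx3 !hornerE expr0n /= !(mul0r, addr0) ent_dmx eqxx mulr1n.
Qed.

Definition hadamard A B : 'M[R]_#|V| := mxV (fun i j => ent A i j * ent B i j).

Hypothesis binI : binomial_ideal (@graph_ideal R V C G).

(* Binomials are multiplicative for entrywise products of points. *)
Lemma hadamard_closed A B : X A -> X B -> X (hadamard A B).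
Proof.
case/inverse_spaceP=> symA A0 /inverse_spaceP[symB B0]; apply/inverse_spaceP.
split=> [|p].
  apply/sym_entP=> i j; rewrite !ent_mxV.
  by rewrite (proj1 (sym_entP A) symA) (proj1 (sym_entP B) symB).
case: binI => S [binS genS] /genS [n [a [g [Sg ->]]]].
rewrite (big_morph (eval_at _) (rmorphD _) (rmorph0 _)) big1 // => k _.
rewrite eval_atM; have [m [m' def_g]] := binS _ (Sg k).
have Ig : graph_ideal G (g k).
  apply/genS; exists 1%N, (fun _ => 1), (fun _ => g k); split=> //.
  by rewrite big_ord1 mul1r.
have evX D mm : @eval_at R V D 'X_[mm] =
    \prod_s entry D (val (enum_val s)).1 (val (enum_val s)).2 ^+ mm s.
  by rewrite /eval_at mevalX.
have evH mm : eval_at (hadamard A B) 'X_[mm] =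
    eval_at A 'X_[mm] * eval_at B 'X_[mm].
  rewrite !evX -big_split /=; apply: eq_bigr => s _.
  by rewrite -exprMn [entry (hadamard _ _) _ _]ent_mxV.
move: (A0 _ Ig) (B0 _ Ig); rewrite def_g !eval_atB !evH => /eqP.
rewrite subr_eq0 => /eqP -> /eqP; rewrite subr_eq0 => /eqP ->.
by rewrite subrr mulr0.
Qed.

Lemma inverse_space1 : X 1%:M.
Proof.
apply: inverses_in_X; exists 1%:M; split; rewrite ?unitmx1 ?invmx1 //.
exact: concentration1.
Qed.

(** [D] is the diagonal part of [A], so the diagonal entries of its adjugate, which lies in L_G, are
    [\det D] divided by those of [A]. *)
Lemma diag_inv A i j : X A -> (forall v, ent A v v != 0) ->
  vcol G i = vcol G j -> ent A i i = ent A j j.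
Proof.
move=> XA A0 cij; pose D := hadamard A 1%:M.
have defD : D = dmx (fun v => ent A v v).
  apply/entP=> a b; rewrite ent_mxV ent_dmx ent_scalar.
  by case: eqVneq => [->|]; rewrite ?mulr1 ?mulr0.
have [_ _ Dv _] := adj_inverse_space (hadamard_closed XA inverse_space1).
have Dij : ent (\adj D) i i = ent (\adj D) j j := Dv _ _ cij.
have detD v : ent A v v * ent (\adj D) v v = \det D.
  have := congr1 (fun B => ent B v v) (mul_mx_adj D).
  by rewrite defD ent_dmx_mul ent_scalar eqxx.
have dD : \det D != 0.
  have := dmx_mulV A0; rewrite -defD => /mulmx1_unit[_].
  by rewrite unitmxE unitfE.
apply: (@mulIf _ (ent (\adj D) i i)).
  by apply: contraNneq dD => adj0; rewrite -(detD i) adj0 mulr0.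
by rewrite detD Dij detD.
Qed.

Lemma adj_kpoly_diag s t i j : (forall c, s c != 0) ->
  vcol G i = vcol G j ->
  ent (\adj (kpoly s t)) i i = ent (\adj (kpoly s t)) j j.
Proof.
move=> s0 cij; set N := \adj _.
(* [diag_inv] asks for nonzero diagonal entries, which are available away from the zeros of [q]. *)
pose q := \prod_v ent N v v.
have q0 : q != 0.
  by apply/prodf_neq0=> v _; apply: poly_neq0_horner (adj_kpoly0 _ _ s0).
apply/eqP; rewrite -subr_eq0; apply/eqP; apply: (poly_fun0_generic q0) => e qe.
rewrite hornerD hornerN; apply/eqP; rewrite subr_eq0.
have := diag_inv (adj_kpoly t e s0) _ cij.
rewrite !ent_map /horner_eval -/N => -> // v.
rewrite ent_map /horner_eval -/N; apply: contraNneq qe => Nv.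
by rewrite /q (bigD1 v) //= hornerM [X in X * _]Nv mul0r.
Qed.

(** Up to the square of the value of [s] at [i], the sum is the coefficient of [e^2] in the diagonal
    entry of the inverse at [i], which collects the closed walks of length two. *)
Lemma weighted_degree_inv (s t : C -> R) i j : (forall c, s c != 0) ->
  vcol G i = vcol G j ->
  \sum_(y | G i y) t (ecol G [set i; y]) ^+ 2 * s (vcol G y) =
  \sum_(y | G j y) t (ecol G [set j; y]) ^+ 2 * s (vcol G y).
Proof.
move=> s0 cij; have s0v v : s (vcol G v) != 0 by [].
have [|_] := adj_expand_eq (kpoly_expand s t) (dmx_mulV s0v) _
  (adj_kpoly_diag t s0 cij); first by rewrite hornerC oner_eq0.
have coef2 v : ent (dmx (fun v0 => s (vcol G v0)) *m - amx t *m
    dmx (fun v0 => s (vcol G v0)) *m - amx t *m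
    dmx (fun v0 => s (vcol G v0)) -
    dmx (fun v0 => s (vcol G v0)) *m 0 *m dmx (fun v0 => s (vcol G v0))) v v =
    s (vcol G v) ^+ 2 * \sum_(y | G v y) t (ecol G [set v; y]) ^+ 2 * s (vcol G y).
  rewrite mulmx0 mul0mx subr0 ent_mul_dmx -!mulmxA ent_dmx_mul ent_mul.
  rewrite [in RHS]big_mkcond /= !mulr_sumr mulr_suml.
  apply: eq_bigr => y _; rewrite ent_dmx_mul !ent_opp !ent_amx [G y v]adj_sym.
  by case: (G v y); rewrite ?(oppr0, mul0r, mulr0) // [[set y; v]]setUC; ring.
rewrite !coef2 cij => /mulfI; apply.
by rewrite expf_neq0.
Qed.

End BinomialClosure.

(** * Regularity conditions as counts *)

Section SumByClass.
Variables (V : finType) (K : Type) (eqk : rel K) (T : nmodType).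
Hypothesis eqk_refl : forall x, eqk x x.
Hypothesis eqk_ltrans : forall x y z, eqk x y -> eqk x z = eqk y z.
Variable Q : T -> T -> Prop.
Hypotheses (Q0 : Q 0 0)
  (QD : forall a b c d, Q a b -> Q c d -> Q (a + c) (b + d)).

(** Since corresponding classes have equal sizes, terms can be removed in matching pairs. A relation
    [Q] takes the place of equality because the lemma serves both counts and congruences modulo a
    power of ['X]. *)
Lemma sum_by_class (A B : {set V}) (kA kB : V -> K) (F F' : V -> T) :
  (forall u, #|[set y in A | eqk (kA y) u]| = #|[set y in B | eqk (kB y) u]|) ->
  (forall y z, y \in A -> z \in B -> eqk (kA y) (kB z) -> Q (F y) (F' z)) ->
  Q (\sum_(y in A) F y) (\sum_(z in B) F' z).
Proof.
have [n] := ubnP #|A|; elim: n A B => // n IHn A B; rewrite ltnS => leAn cAB QF.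
have [A0|[y yA]] := set_0Vmem A.
  have B0 : B = set0.
    apply/setP=> z; rewrite in_set0; apply/negP=> zB.
    have := cAB (kB z); rewrite A0 (_ : [set _ in _ | _] = set0); last first.
      by apply/setP=> x; rewrite !inE.
    by rewrite cards0 => /esym/cards0_eq/setP/(_ z); rewrite !inE zB eqk_refl.
  by rewrite A0 B0 !big_set0.
have [z /[!inE] /andP[zB zy]] : exists z, z \in [set z in B | eqk (kB z) (kA y)].
  apply/set0Pn; rewrite -card_gt0 -cAB card_gt0; apply/set0Pn; exists y.
  by rewrite inE yA eqk_refl.
have yz : eqk (kA y) (kB z) by rewrite -(eqk_ltrans _ zy) eqk_refl.
rewrite (big_setD1 y yA) (big_setD1 z zB) /=; apply: QD; first exact: QF.
apply: IHn => [|u|y' z']; last by rewrite !inE => /andP[_ yA'] /andP[_ zB']; apply: QF.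
  by rewrite (cardsD1 y A) yA in leAn; apply: leq_trans leAn.
have cardD (E : {set V}) k x : x \in E -> #|[set y in E :\ x | eqk (k y) u]| =
    (#|[set y in E | eqk (k y) u]| - eqk (k x) u)%N.
  move=> xE; rewrite [in RHS](cardsD1 x) !inE xE addKn.
  by apply: eq_card => v; rewrite !inE andbA.
by rewrite !cardD // cAB (eqk_ltrans _ yz).
Qed.

End SumByClass.

Section ColoredTriangles.
Variables (V : finType) (C : eqType) (G : cgraph V C).

Lemma perm2P (T : eqType) (a b c d : T) :
  reflect ((a = c /\ b = d) \/ (a = d /\ b = c)) (perm_eq [:: a; b] [:: c; d]).
Proof.
apply: (iffP idP) => [p|[[-> ->]|[-> ->]]] //;
  last by rewrite -[[:: c; d]]/(rcons [:: c] d) perm_sym perm_rcons.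
have := perm_mem p a; rewrite !inE eqxx => /esym/orP[] /eqP E; subst.
  by move: p; rewrite perm_cons => /perm_consP [[|i]] // [u []] // [->] _; left.
have {p} : perm_eq [:: d; b] [:: d; c].
  by apply: perm_trans p _; rewrite -[[:: d; c]]/(rcons [:: d] c) perm_sym perm_rcons.
rewrite perm_cons => p; right; split=> //.
by have := perm_mem p b; rewrite !inE eqxx => /esym/eqP.
Qed.

Lemma incident_vertex_colors2 i j : i != j ->
  perm_eq (incident_vertex_colors G [set i; j]) [:: vcol G i; vcol G j].
Proof.
move=> ij; apply: (perm_map (vcol G) (t := [:: i; j])).
apply: uniq_perm; rewrite ?enum_uniq //= ?inE ?ij //.
by move=> x; rewrite mem_enum !inE.
Qed.

Lemma adj_neq x y : G x y -> x != y.
Proof. by apply: contraTneq => ->; rewrite adj_irr. Qed.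

Lemma edge_regularP : edge_regular G <-> forall i j k l, G i j -> G k l ->
  ecol G [set i; j] = ecol G [set k; l] ->
  perm_eq [:: vcol G i; vcol G j] [:: vcol G k; vcol G l].
Proof.
split=> [regG i j k l ij kl cE|regG s t].
  have := regG [set i; j] [set k; l] _ _ cE.
  move=> /(_ (ex_intro _ i (ex_intro _ j (conj ij erefl)))).
  move=> /(_ (ex_intro _ k (ex_intro _ l (conj kl erefl)))) p.
  rewrite -(permPl (incident_vertex_colors2 (adj_neq ij))) (permPl p).
  exact: incident_vertex_colors2 (adj_neq kl).
case=> i [j [ij ->]] [k [l [kl ->]]] cE.
rewrite (permPl (incident_vertex_colors2 (adj_neq ij))) perm_sym.
rewrite (permPl (incident_vertex_colors2 (adj_neq kl))).
exact: regG.
Qed.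

(** A triangle over [ij] is given by its apex, and under edge regularity the colors recorded here
    determine its class once the color of [ij] is known. The two sides are unordered because an
    isomorphism of triangles may swap [i] and [j]. *)
Definition apexes (i j : V) (c d z : C) : pred V :=
  [pred y | [&& G i y, G j y, vcol G y == z &
     perm_eq [:: ecol G [set i; y]; ecol G [set j; y]] [:: c; d]]].

Definition triangle_counts_regular : Prop := forall i j k l, G i j -> G k l ->
  ecol G [set i; j] = ecol G [set k; l] ->
  forall c d z, #|apexes i j c d z| = #|apexes k l c d z|.

Let tri i j y : {set V} := y |: [set i; j].

Lemma vertex_regularP : vertex_regular G <-> forall x y, vcol G x = vcol G y ->
  forall c, #|[pred z | G x z && (ecol G [set x; z] == c)]| =
            #|[pred z | G y z && (ecol G [set y; z] == c)]|.
Proof.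
have cntE c x : count_mem c (incident_edge_colors G x) =
    #|[pred z | G x z && (ecol G [set x; z] == c)]|.
  rewrite /incident_edge_colors count_map count_filter cardE /enum_mem.
  rewrite size_filter count_filter; apply: eq_count => z.
  by rewrite /= !inE andbT andbC.
split=> [regG x y /regG /permP p c|regG x y xy]; first by rewrite -!cntE p.
by apply/allP => c _ /=; rewrite !cntE (regG _ _ xy).
Qed.

Definition same_colored_triple (i j y k l z : V) : Prop :=
  perm_eq [:: ecol G [set i; j]; ecol G [set i; y]; ecol G [set j; y]]
          [:: ecol G [set k; l]; ecol G [set k; z]; ecol G [set l; z]] /\
  perm_eq [:: vcol G i; vcol G j; vcol G y] [:: vcol G k; vcol G l; vcol G z].

Lemma same_colored_triple_trans i j y k l z a b c :
  same_colored_triple i j y k l z -> same_colored_triple k l z a b c ->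
  same_colored_triple i j y a b c.
Proof. by case=> p q [p' q']; split; [rewrite (permPl p) | rewrite (permPl q)]. Qed.

Lemma same_colored_triple_sym i j y k l z :
  same_colored_triple i j y k l z -> same_colored_triple k l z i j y.
Proof. by case=> p q; split; rewrite perm_sym. Qed.

Definition distinct3 (i j y : V) := [&& i != j, i != y & j != y].

Lemma perm3P (T : eqType) (s : seq T) (P : seq T -> Prop) a b c :
  perm_eq s [:: a; b; c] -> P [:: a; b; c] -> P [:: a; c; b] -> P [:: b; a; c] ->
  P [:: b; c; a] -> P [:: c; a; b] -> P [:: c; b; a] -> P s.
Proof.
move=> p Pabc Pacb Pbac Pbca Pcab Pcba.
have sz := perm_size p; case: s sz p => [|x [|y [|z []]]] //= _ p.
have := perm_mem p x; rewrite !inE eqxx /= => /esym/or3P[] /eqP E; subst x.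
- by move: p; rewrite perm_cons => /perm2P[] [-> ->].
- have : perm_eq [:: b; y; z] [:: b; a; c].
    by rewrite (permPl p); apply/permP=> f /=; lia.
  by rewrite perm_cons => /perm2P[] [-> ->].
- have : perm_eq [:: c; y; z] [:: c; a; b].
    by rewrite (permPl p); apply/permP=> f /=; lia.
  by rewrite perm_cons => /perm2P[] [-> ->].
Qed.

Lemma perm_triple_same i j y k l z :
  perm_eq [:: i; j; y] [:: k; l; z] -> same_colored_triple i j y k l z.
Proof.
move=> p; pose P s := forall i j y, s = [:: i; j; y] ->
  same_colored_triple i j y k l z.
suff /(_ i j y erefl) : P [:: i; j; y] by [].
by apply: (@perm3P _ _ P _ _ _ p); rewrite /P => {p P i j y} i j y [<- <- <-]; split;
  rewrite ?[[set l; k]]setUC ?[[set z; k]]setUC ?[[set z; l]]setUC;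
  apply/permP=> a /=; lia.
Qed.

Lemma triangleP i j y : [/\ G i j, G i y & G j y] -> triangle G (tri i j y).
Proof.
move=> [ij iy jy]; apply/andP; split.
  rewrite cardsU1 cards2 !inE ![y == _]eq_sym (negPf (adj_neq iy)).
  by rewrite (negPf (adj_neq jy)) (adj_neq ij).
have [ji yi yj] : [/\ G j i, G y i & G y j] by split; rewrite adj_sym.
apply/forall_inP=> a; rewrite !inE => /or3P[] /eqP->;
  apply/forall_inP=> b; rewrite !inE => /or3P[] /eqP->;
  by rewrite ?eqxx ?ij ?iy ?jy ?ji ?yi ?yj ?implybT.
Qed.

Lemma triangle_iso_triple i j y T : [/\ G i j, G i y & G j y] ->
  triangle_iso G (tri i j y) T -> exists k l z,
  T = tri k l z /\ same_colored_triple k l z i j y.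
Proof.
move=> [ij iy jy] /existsP[f /and3P[/eqP fT /forall_inP fv /forall_inP fe]].
exists (f i), (f j), (f y); split.
  by rewrite -fT /tri !imsetU !imset_set1.
have memT x : x \in [:: i; j; y] -> x \in tri i j y.
  by rewrite !inE; case/or3P=> ->; rewrite ?orbT.
have fvE x : x \in [:: i; j; y] -> vcol G (f x) = vcol G x.
  by move=> /memT/fv/eqP.
have feE x x' : x \in [:: i; j; y] -> x' \in [:: i; j; y] -> G x x' ->
    ecol G [set f x; f x'] = ecol G [set x; x'].
  move=> /memT/fe/forall_inP fx /memT/fx/implyP + xx'.
  by move=> /(_ (adj_neq xx'))/eqP.
by split; rewrite ?feE ?fvE ?inE ?eqxx ?orbT.
Qed.

Lemma triple_iso i j y k l z :
  distinct3 i j y -> vcol G i = vcol G k -> vcol G j = vcol G l ->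
  vcol G y = vcol G z -> ecol G [set i; j] = ecol G [set k; l] ->
  ecol G [set i; y] = ecol G [set k; z] -> ecol G [set j; y] = ecol G [set l; z] ->
  triangle_iso G (tri i j y) (tri k l z).
Proof.
case/and3P=> ij iy jy vi vj vy eij eiy ejy.
pose f : {ffun V -> V} := [ffun x => if x == i then k else if x == j then l else z].
have fi : f i = k by rewrite ffunE eqxx.
have fj : f j = l by rewrite ffunE eq_sym (negPf ij) eqxx.
have fy : f y = z by rewrite ffunE eq_sym (negPf iy) eq_sym (negPf jy).
apply/existsP; exists f; apply/and3P; split.
- by rewrite /tri !imsetU !imset_set1 fi fj fy.
- by apply/forall_inP=> a; rewrite !inE => /or3P[] /eqP->; rewrite ?fi ?fj ?fy eq_sym; apply/eqP.
apply/forall_inP=> a; rewrite !inE => /or3P[] /eqP->;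
  apply/forall_inP=> b; rewrite !inE => /or3P[] /eqP->;
  rewrite ?eqxx // ?fi ?fj ?fy; apply/implyP=> _;
  by rewrite ?[[set l; k]]setUC ?[[set z; k]]setUC ?[[set z; l]]setUC
    ?[[set j; i]]setUC ?[[set y; i]]setUC ?[[set y; j]]setUC ?eij ?eiy ?ejy.
Qed.

Lemma triangle_iso_trans (A B T : {set V}) : #|A| = #|B| ->
  triangle_iso G A B -> triangle_iso G B T -> triangle_iso G A T.
Proof.
move=> cAB /existsP[f /and3P[/eqP fA /forall_inP fv /forall_inP fe]].
move=> /existsP[g /and3P[/eqP gB /forall_inP gv /forall_inP ge]].
have finj : {in A &, injective f} by apply/imset_injP; rewrite fA cAB.
have fB x : x \in A -> f x \in B by move=> xA; rewrite -fA imset_f.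
apply/existsP; exists [ffun x => g (f x)]; apply/and3P; split.
- rewrite -gB -fA -imset_comp; apply/eqP/eq_imset => x.
  by rewrite ffunE.
- apply/forall_inP=> x xA; rewrite ffunE (eqP (gv _ (fB _ xA))); exact: fv.
apply/forall_inP=> x xA; apply/forall_inP=> y yA; apply/implyP=> xy.
have /forall_inP/(_ _ (fB _ yA))/implyP := ge _ (fB _ xA).
rewrite !ffunE (inj_in_eq finj) // => /(_ xy)/eqP ->.
by have /forall_inP/(_ _ yA)/implyP/(_ xy) := fe _ xA.
Qed.

Definition same_apex_key (i j y k l z : V) : Prop :=
  vcol G y = vcol G z /\
  perm_eq [:: ecol G [set i; y]; ecol G [set j; y]]
          [:: ecol G [set k; z]; ecol G [set l; z]].

Lemma tri_swap i j y : tri i j y = tri j i y.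
Proof. by rewrite /tri setUC [[set i; j]]setUC setUC. Qed.

Section EdgeRegular.
Hypothesis regG : edge_regular G.

(** By edge regularity, the color of a side and the color of the apex determine the color of the
    other end of the side, so matching the sides also matches the ends. *)
Lemma apex_key_match i j y k l z :
  [/\ G i j, G i y & G j y] -> [/\ G k l, G k z & G l z] ->
  same_apex_key i j y k l z ->
  [/\ vcol G i = vcol G k, vcol G j = vcol G l,
      ecol G [set i; y] = ecol G [set k; z] &
      ecol G [set j; y] = ecol G [set l; z]] \/
  [/\ vcol G i = vcol G l, vcol G j = vcol G k,
      ecol G [set i; y] = ecol G [set l; z] &
      ecol G [set j; y] = ecol G [set k; z]].
Proof.
move=> [ij iy jy] [kl kz lz] [vE pE].
have /edge_regularP regE := regG.
have vy (a b : C) : perm_eq [:: a; vcol G y] [:: b; vcol G z] -> a = b.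
  by rewrite vE => /perm2P[] [] // -> ->.
case/perm2P: pE => -[e1 e2]; [left|right]; split=> //; apply: vy; exact: regE.
Qed.

Lemma apex_key_iso i j y k l z :
  [/\ G i j, G i y & G j y] -> [/\ G k l, G k z & G l z] ->
  ecol G [set i; j] = ecol G [set k; l] -> same_apex_key i j y k l z ->
  triangle_iso G (tri i j y) (tri k l z).
Proof.
move=> tij tkl cE key; have [ij iy jy] := tij; have [vE _] := key.
have dist : distinct3 i j y by rewrite /distinct3 !adj_neq.
have [[*]|[*]] := apex_key_match tij tkl key; first exact: triple_iso.
by rewrite [tri k l z]tri_swap; apply: triple_iso; rewrite // [[set l; k]]setUC.
Qed.

(** The end colors of the two edges agree as multisets by edge regularity; cancelling them leaves
    the apex colors. *)
Lemma triple_apex_key i j y k l z : G i j -> G k l ->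
  ecol G [set i; j] = ecol G [set k; l] ->
  same_colored_triple i j y k l z -> same_apex_key i j y k l z.
Proof.
move=> ij kl cE [pe pv]; split; last by move: pe; rewrite cE perm_cons.
have /edge_regularP/(_ _ _ _ _ ij kl cE) pij := regG.
have cancel (a b c d e : nat) : (a + (b + 1) = c + (d + e) -> a + b = c + d -> e = 1)%N.
  by lia.
have := permP pij (pred1 (vcol G y)); rewrite /= !addn0.
have := permP pv (pred1 (vcol G y)); rewrite /= !addn0 eqxx => /cancel H /H.
by case: eqP.
Qed.

Lemma card_tri i j y : [/\ G i j, G i y & G j y] -> #|tri i j y| = 3%N.
Proof. by move=> /triangleP/andP[/eqP]. Qed.

Let nbr2 i j y := G i y && G j y.

Lemma triangle_multE i j T : G i j ->
  triangle_mult G [set i; j] T = #|[pred y | nbr2 i j y && triangle_iso G (tri i j y) T]|.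
Proof.
move=> ij; rewrite /triangle_mult -(card_in_imset (f := tri i j)); last first.
  move=> y y'; rewrite !inE => /andP[/andP[iy jy] _] /andP[/andP[iy' jy'] _] yy'.
  have : y \in tri i j y' by rewrite -yy' !inE eqxx.
  rewrite !inE ![_ == i]eq_sym ![_ == j]eq_sym (negPf (adj_neq iy)) (negPf (adj_neq jy)).
  by rewrite !orbF => /eqP.
apply: eq_card => T'; rewrite !inE; apply/and3P/imsetP => [[triT sT isoT]|].
  case/andP: (triT) => /eqP cT /forall_inP eT.
  have : #|T' :\: [set i; j]| == 1%N.
    by rewrite cardsD (setIidPr sT) cT cards2 adj_neq.
  case/cards1P=> y Dy; have T'E : T' = tri i j y.
    by rewrite /tri -Dy setUC -{1}(setID T' [set i; j]) (setIidPr sT).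
  have iT : i \in T' by rewrite T'E !inE eqxx orbT.
  have jT : j \in T' by rewrite T'E !inE eqxx !orbT.
  have : y \in T' :\: [set i; j] by rewrite Dy !inE.
  rewrite !inE negb_or => /andP[/andP[yi yj] yT].
  have iy : G i y by have /forall_inP/(_ _ yT)/implyP := eT _ iT; rewrite eq_sym; apply.
  have jy : G j y by have /forall_inP/(_ _ yT)/implyP := eT _ jT; rewrite eq_sym; apply.
  by exists y => //; rewrite inE /nbr2 iy jy -T'E.
case=> y; rewrite inE => /andP[/andP[iy jy] isoT] ->; split=> //.
  exact: triangleP.
by rewrite /tri subsetUr.
Qed.

Lemma tri_perm a b c a' b' c' : #|tri a b c| = 3%N ->
  tri a b c = tri a' b' c' -> perm_eq [:: a; b; c] [:: a'; b'; c'].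
Proof.
have uniq3 x y z : #|tri x y z| = 3%N -> uniq [:: x; y; z].
  rewrite /tri cardsU1 cards2 /= !inE ![z == _]eq_sym.
  by case: (x == y); case: (x == z); case: (y == z).
move=> c3 TE; apply: uniq_perm; [exact: uniq3 | by apply: uniq3; rewrite -TE|].
move=> w; have /setP/(_ w) := TE; rewrite !inE.
by case: (w == c); case: (w == c'); case: (w == a); case: (w == b);
  case: (w == a'); case: (w == b').
Qed.

Lemma iso_tri_key i j y k l z (T : {set V}) : #|T| = 3%N ->
  [/\ G i j, G i y & G j y] -> [/\ G k l, G k z & G l z] ->
  ecol G [set i; j] = ecol G [set k; l] ->
  triangle_iso G (tri i j y) T ->
  triangle_iso G (tri k l z) T <-> same_apex_key k l z i j y.
Proof.
move=> cT tij tkl cE isoT; have [ij _ _] := tij; have [kl _ _] := tkl.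
split=> [isoT'|key].
  have [a [b [c [TE s1]]]] := triangle_iso_triple tij isoT.
  have [a' [b' [c' [TE' s2]]]] := triangle_iso_triple tkl isoT'.
  apply: triple_apex_key; rewrite ?cE //.
  apply: same_colored_triple_trans (same_colored_triple_sym s2) _.
  apply: same_colored_triple_trans s1; apply: perm_triple_same.
  by apply: tri_perm; rewrite -TE' // TE.
apply: triangle_iso_trans isoT; first by rewrite !card_tri.
exact: apex_key_iso.
Qed.

Lemma triangle_iso_refl T : triangle_iso G T T.
Proof.
apply/existsP; exists [ffun x => x]; apply/and3P; split.
- by apply/eqP; rewrite -[RHS]imset_id; apply: eq_imset => x; rewrite ffunE.
- by apply/forall_inP=> x _; rewrite ffunE.
- apply/forall_inP=> x _; apply/forall_inP=> y _; rewrite !ffunE eqxx.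
  exact: implybT.
Qed.

Lemma edge_triangle_regularP : edge_triangle_regular G <-> triangle_counts_regular.
Proof.
have keyE i j k l z y : y \in apexes i j (ecol G [set k; z]) (ecol G [set l; z]) (vcol G z) <->
    nbr2 i j y /\ same_apex_key i j y k l z.
  rewrite unfold_in /apexes /= /same_apex_key /nbr2; split=> [/and4P[-> -> /eqP-> ->] //|].
  by case=> /andP[-> ->] [-> ->]; rewrite eqxx.
have multE i j k l z (T : {set V}) : #|T| = 3%N -> G i j -> [/\ G k l, G k z & G l z] ->
    ecol G [set i; j] = ecol G [set k; l] -> triangle_iso G (tri k l z) T ->
    triangle_mult G [set i; j] T =
    #|apexes i j (ecol G [set k; z]) (ecol G [set l; z]) (vcol G z)|.
  move=> cT ij tkl cE isoT; rewrite triangle_multE //; apply: eq_card => y.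
  rewrite [LHS]inE; apply/andP/idP=> [[nij iso]|/keyE[nij key]].
    apply/keyE; split=> //; case/andP: (nij) => iy jy.
    by apply/(iso_tri_key cT tkl _ _ isoT).
  split=> //; case/andP: (nij) => iy jy.
  by apply/(iso_tri_key cT tkl _ _ isoT).
split=> [regG3 i j k l ij kl cE c d z|regT s t].
  have edge (u v : V) : G u v -> is_edge G [set u; v] by exists u, v.
  have card0E (u v u' v' : V) : G u v -> G u' v' ->
     ecol G [set u; v] = ecol G [set u'; v'] -> forall y, apexes u v c d z y ->
     #|apexes u v c d z| = #|apexes u' v' c d z|.
    move=> uv u'v' e y /and4P[uy vy /eqP zE pE].
    have tuv : [/\ G u v, G u y & G v y] by [].
    have E w w' : apexes w w' c d z =1
        apexes w w' (ecol G [set u; y]) (ecol G [set v; y]) (vcol G y).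
      by move=> x; rewrite /apexes /= zE (permPr pE).
    rewrite !(eq_card (E _ _)) -!(@multE _ _ u v y (tri u v y)) ?card_tri //;
      try exact: triangle_iso_refl.
    by apply: regG3; [exact: edge|exact: edge| |exact: triangleP].
  (* A key realized at one of the edges is the key of an actual triangle; a key realized at neither
     gives zero on both sides. *)
  have [[y /card0E]|no] := altP (@existsP _ (apexes i j c d z)); first by apply.
  have [[y Ay]|no'] := altP (@existsP _ (apexes k l c d z)).
    exact: esym (card0E k l i j kl ij (esym cE) y Ay).
  rewrite !eq_card0 // => y; apply/negP => Ay.
    by case/existsP: no'; exists y.
  by case/existsP: no; exists y.
case=> i [j [ij ->]] [k [l [kl ->]]] cE T /andP[/eqP cT _].
have cardE (u v u' v' y : V) : G u v -> G u' v' ->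
     ecol G [set u; v] = ecol G [set u'; v'] ->
     nbr2 u v y -> triangle_iso G (tri u v y) T ->
     triangle_mult G [set u; v] T = triangle_mult G [set u'; v'] T.
  move=> uv u'v' e /andP[uy vy] isoT.
  have tuv : [/\ G u v, G u y & G v y] by [].
  by rewrite !(@multE _ _ u v y T) //; apply: regT.
rewrite !triangle_multE //.
have [[y /andP[]]|no] := altP (@existsP _ [pred y | nbr2 i j y && triangle_iso G (tri i j y) T]).
  by rewrite -!triangle_multE //; apply: cardE.
have [[y /andP[nb iso]]|no'] :=
  altP (@existsP _ [pred y | nbr2 k l y && triangle_iso G (tri k l y) T]).
  by rewrite -!triangle_multE //; apply/esym/(cardE _ _ _ _ y) => //; rewrite cE.
rewrite !eq_card0 // => y; apply/negP => Ay.
  by case/existsP: no'; exists y.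
by case/existsP: no; exists y.
Qed.

Definition apex_key i j y := (ecol G [set i; y], ecol G [set j; y], vcol G y).

Definition eq_key (u v : C * C * C) :=
  (u.2 == v.2) && perm_eq [:: u.1.1; u.1.2] [:: v.1.1; v.1.2].

Lemma sum_apexes (T : nmodType) (Q : T -> T -> Prop) (F : V -> V -> V -> T) i j k l :
  Q 0 0 -> (forall a b c d, Q a b -> Q c d -> Q (a + c) (b + d)) ->
  triangle_counts_regular -> G i j -> G k l ->
  ecol G [set i; j] = ecol G [set k; l] ->
  (forall y z, [/\ G i j, G i y & G j y] -> [/\ G k l, G k z & G l z] ->
     same_apex_key i j y k l z -> Q (F i j y) (F k l z)) ->
  Q (\sum_(y | G i y && G j y) F i j y) (\sum_(y | G k y && G l y) F k l y).
Proof.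
move=> Q0 QD regT ij kl cE QF; pose A i j := [set y | G i y && G j y].
have AE v w (f : V -> T) : \sum_(y | G v y && G w y) f y = \sum_(y in A v w) f y.
  by apply: eq_bigl => y; rewrite inE.
rewrite !AE.
apply: (@sum_by_class _ _ eq_key _ _ _ _ Q0 QD (A i j) (A k l) (apex_key i j) (apex_key k l)).
- by move=> x; rewrite /eq_key eqxx perm_refl.
- by move=> x y z /andP[/eqP xy p]; rewrite /eq_key xy (permPl p).
- move=> u; have := regT i j k l ij kl cE u.1.1 u.1.2 u.2.
  have cE' v w : #|[set y in A v w | eq_key (apex_key v w y) u]| =
      #|apexes v w u.1.1 u.1.2 u.2|.
    apply: eq_card => y; rewrite [RHS]unfold_in /apexes /= !inE /eq_key /= !andbA.
    by [].
  by rewrite !cE'.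
- move=> y z; rewrite !inE => /andP[iy jy] /andP[kz lz] /andP[/eqP vE pE].
  by apply: QF.
Qed.

End EdgeRegular.

Lemma sum_incident (T : nmodType) (Q : T -> T -> Prop) (F : V -> V -> T) i j :
  Q 0 0 -> (forall a b c d, Q a b -> Q c d -> Q (a + c) (b + d)) ->
  vertex_regular G -> vcol G i = vcol G j ->
  (forall y z, G i y -> G j z -> ecol G [set i; y] = ecol G [set j; z] -> Q (F i y) (F j z)) ->
  Q (\sum_(y | G i y) F i y) (\sum_(y | G j y) F j y).
Proof.
move=> Q0 QD /vertex_regularP regV ij QF.
have AE v (f : V -> T) : \sum_(y | G v y) f y = \sum_(y in [set y | G v y]) f y.
  by apply: eq_bigl => y; rewrite inE.
rewrite !AE; apply: (@sum_by_class _ _ (@eq_op C) _ _ _ _ Q0 QD _ _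
  (fun y => ecol G [set i; y]) (fun y => ecol G [set j; y])).
- exact: eqxx.
- by move=> x y z /eqP->.
- move=> u; have cE v : #|[set y in [set y | G v y] | ecol G [set v; y] == u]| =
      #|[pred z | G v z && (ecol G [set v; z] == u)]|.
    by apply: eq_card => y; rewrite !inE.
  by rewrite !cE; apply: regV.
- by move=> y z; rewrite !inE => iy jz /eqP; apply: QF.
Qed.

End ColoredTriangles.

(** * Block graphs and separation by vertices *)

Section Separation.
Variables (V : finType) (C : eqType) (G : cgraph V C).

Definition avoid (k : V) : rel V := [rel x y | [&& x != k, y != k & G x y]].

Definition geodesic_cut : Prop := forall a k b,
  G a k -> G k b -> a != b -> ~~ G a b -> ~~ connect (avoid k) a b.

Lemma avoid_sym k : ssrbool.symmetric (avoid k).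
Proof. by move=> x y; rewrite /avoid /= adj_sym andbCA. Qed.

Lemma connect_avoid_sym k : connect_sym (avoid k).
Proof. exact/sym_connect_sym/avoid_sym. Qed.

Lemma avoid1 k x y : x != k -> y != k -> G x y -> connect (avoid k) x y.
Proof. by move=> xk yk xy; apply: connect1; apply/and3P. Qed.

(** Otherwise [x] would separate [a] from [b], although the walk a, y, b avoids [x]. *)
Lemma cut_common_nbrs a b x y : geodesic_cut ->
  G x y -> G a x -> G a y -> G b x -> G b y -> a != b -> G a b.
Proof.
move=> sepG xy ax ay bx b_y ab; apply/negPn/negP => nab.
have := sepG a x b ax; rewrite adj_sym bx => /(_ isT ab nab)/negP; apply.
have yx : y != x by rewrite eq_sym (adj_neq xy).
apply: (@connect_trans _ _ y); apply: avoid1 => //; rewrite ?(adj_neq ax) ?(adj_neq bx) //.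
by rewrite adj_sym.
Qed.

Lemma cut_common_nbr_trans u a b c : geodesic_cut ->
  G u a -> G u b -> G u c -> G a b -> G b c -> a != c -> G a c.
Proof.
move=> sepG ua ub uc ab bc ac.
by apply: (@cut_common_nbrs a c u b) => //; rewrite adj_sym.
Qed.

Lemma induced_sym (S : {set V}) : ssrbool.symmetric (induced G S).
Proof. by move=> x y; rewrite /induced /= adj_sym andbCA. Qed.

Lemma connect_sub_induced (S S' : {set V}) x y : S \subset S' ->
  connect (induced G S) x y -> connect (induced G S') x y.
Proof.
move=> /subsetP sS; apply: connect_sub => a b /and3P[aS bS ab].
by apply: connect1; apply/and3P; split=> //; apply: sS.
Qed.

(** A non-recursive form of the block property, between [block_on] and [geodesic_cut]; it is
    relative to [S] so that inductions over vertex sets apply. *)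
Definition vertex_cuts (S : {set V}) : Prop := forall x y,
  x \in S -> y \in S -> x != y -> ~~ G x y ->
  exists2 c, c \in S :\: [set x; y] & ~~ connect (induced G (S :\ c)) x y.

Lemma vertex_cuts_sub (S T : {set V}) : T \subset S -> connected_on G T ->
  vertex_cuts S -> vertex_cuts T.
Proof.
move=> sTS conT cutS x y xT yT xy nxy.
have [xS yS] := (subsetP sTS _ xT, subsetP sTS _ yT).
have [c] := cutS x y xS yS xy nxy.
rewrite !inE negb_or => /andP[/andP[cx cy] cS] nc.
have nT : ~~ connect (induced G (T :\ c)) x y.
  by apply: contra nc; apply: connect_sub_induced; apply: setSD.
exists c => //; rewrite !inE negb_or cx cy /=; apply: contraNT nT => cT.
have -> : T :\ c = T by apply/setDidPl; rewrite disjoint_sym disjoints1.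
exact: conT.
Qed.

Lemma block_vertex_cuts S : block_on G S -> vertex_cuts S.
Proof.
elim=> {S} [S _ cS x y xS yS xy /negP[]|S A B c _ [SE _ dAB cAB nAB] blA IHA blB IHB].
  exact: cS.
move: cAB; rewrite inE negb_or => /andP[cA cB].
(* A walk from [A] to [B] has to pass through the glueing vertex [c]. *)
have mixed x y : x \in A -> y \in B -> ~~ connect (induced G (S :\ c)) x y.
  move=> xA yB; apply/connectP => -[p].
  elim: p x xA => [|z p IHp] x xA /=.
    by move=> _ yx; move: dAB => /disjointFr/(_ xA); rewrite -yx yB.
  case/andP=> /and3P[_ zS xz]; apply: IHp; move: zS.
  rewrite SE !inE => /andP[/negPf -> /orP[/orP[//|zB]|//]].
  by have := nAB _ _ xA zB; rewrite xz.
(* Collapsing [B'] onto [c] maps walks avoiding [d] to walks avoiding [d]. *)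
have same (A' B' : {set V}) : S = A' :|: B' :|: [set c] -> c \notin A' ->
    c \notin B' -> [disjoint A' & B'] ->
    (forall x y, x \in A' -> y \in B' -> ~~ G x y) ->
    vertex_cuts (A' :|: [set c]) ->
    forall x y, x \in A' :|: [set c] -> y \in A' :|: [set c] -> x != y -> ~~ G x y ->
    exists2 d, d \in S :\: [set x; y] & ~~ connect (induced G (S :\ d)) x y.
  move=> SE' cA' cB' dAB' nAB' cutA x y xA yA xy nxy.
  have [d] := cutA x y xA yA xy nxy.
  rewrite in_setD => /andP[dxy dA] nd; exists d.
    by rewrite in_setD dxy SE'; move: dA; rewrite !inE => /orP[] ->; rewrite ?orbT.
  move: dxy; rewrite !inE negb_or => /andP[dx dy].
  apply: contra nd => /connectP[p xp yE].
  pose r z := if z \in B' then c else z.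
  have notB z : z \in A' :|: [set c] -> z \notin B'.
    rewrite !inE => /orP[zA|/eqP-> //].
    by rewrite (disjointFr dAB' zA).
  have rA z : z \in A' :|: [set c] -> r z = z by move=> /notB; rewrite /r => /negPf->.
  (* When [d] is [c] itself, the image of [B'] under the collapse is forbidden; the invariant
     records that the walk then never enters [B']. *)
  suff walk q z : (z \notin B') || (d != c) -> path (induced G (S :\ d)) z q ->
      connect (induced G ((A' :|: [set c]) :\ d)) (r z) (r (last z q)).
    by have := walk p x; rewrite notB // -yE !rA //; apply.
  elim: q z {xA xy nxy dx xp yE} => [|z q IHq] {}x walk /=; first by rewrite connect0.
  case/andP=> /and3P[xS zS xz] zq.
  have SE2 v : v \in S :\ d -> [/\ v != d & [|| v \in A', v \in B' | v == c]].
    by rewrite SE' !inE -orbA => /andP[].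
  have [[xd xS'] [zd zS']] := (SE2 _ xS, SE2 _ zS).
  have nBA v w : v \in B' -> w \in A' -> ~~ G v w by move=> vB wA; rewrite adj_sym nAB'.
  have rstep : connect (induced G ((A' :|: [set c]) :\ d)) (r x) (r z) /\
      ((z \notin B') || (d != c)).
    rewrite /r; case: (boolP (x \in B')) => xB; case: (boolP (z \in B')) => zB.
    - by split; rewrite ?connect0 //=; move: walk; rewrite xB.
    - split; last by [].
      case/or3P: zS' => [zA|zB'|/eqP->]; rewrite ?connect0 //.
        by have := nBA _ _ xB zA; rewrite xz.
      by rewrite zB' in zB.
    - case/or3P: xS' => [xA|xB'|/eqP xc].
      + by have := nAB' _ _ xA zB; rewrite xz.
      + by rewrite xB' in xB.
      + by rewrite xc connect0 eq_sym -xc xd orbT.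
    split=> //; apply: connect1; apply/and3P; split=> //; rewrite !inE.
      by rewrite xd /=; move: xS'; rewrite (negPf xB).
    by rewrite zd /=; move: zS'; rewrite (negPf zB).
  case: rstep => c1 walk'; apply: connect_trans c1 _.
  exact: IHq walk' zq.
move=> x y xS yS xy nxy.
have SE2 : S = B :|: A :|: [set c] by rewrite SE [A :|: B]setUC.
have sAB : [disjoint B & A] by rewrite disjoint_sym.
have nBA u v : u \in B -> v \in A -> ~~ G u v by move=> uB vA; rewrite adj_sym nAB.
have sameA := same _ _ SE cA cB dAB nAB IHA x y.
have sameB := same _ _ SE2 cB cA sAB nBA IHB x y.
have mix u v : u \in A -> v \in B -> c \in S :\: [set u; v].
  move=> uA vB; rewrite SE !inE eqxx !orbT andbT negb_or.
  by apply/andP; split; apply: contraNneq cA => E; rewrite ?E // in uA *;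
     move: vB; rewrite -E (negPf cB).
move: xS yS; rewrite {1 2}SE => /setUP[/setUP[xA|xB]|xc] /setUP[/setUP[yA|yB]|yc].
- by apply: sameA; rewrite // inE ?xA ?yA.
- by exists c; [exact: mix | exact: mixed].
- by apply: sameA; rewrite // inE ?xA ?yc ?orbT.
- exists c; first by rewrite setUC; exact: mix.
  by rewrite (sym_connect_sym (induced_sym _)); exact: mixed.
- by apply: sameB; rewrite // inE ?xB ?yB.
- by apply: sameB; rewrite // inE ?xB ?yc ?orbT.
- by apply: sameA; rewrite // inE ?xc ?yA ?orbT.
- by apply: sameB; rewrite // inE ?xc ?yB ?orbT.
- by apply: sameA; rewrite // inE ?xc ?yc ?orbT.
Qed.

Lemma vertex_cuts_block S : connected_on G S -> vertex_cuts S -> block_on G S.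
Proof.
have [n] := ubnP #|S|; elim: n S => // n IHn S; rewrite ltnS => leSn conS cutS.
have [/existsP[x /existsP[y /and5P[xS yS xy nxy _]]]|comp] :=
  boolP [exists x, exists y, [&& x \in S, y \in S, x != y, ~~ G x y & true]]; last first.
  apply: BlockComplete => // x y xS yS xy; apply: contraNT comp => nxy.
  by apply/existsP; exists x; apply/existsP; exists y; rewrite xS yS xy nxy.
have [c] := cutS x y xS yS xy nxy.
rewrite !inE negb_or => /andP[/andP[cx cy] cS] nc.
pose e := induced G (S :\ c).
(* The component of [x] after removal of the cut vertex is glued at [c] to everything else. *)
pose A := [set z in S :\ c | connect e x z].
pose B := [set z in S :\ c | ~~ connect e x z].
have xA : x \in A by rewrite !inE xS eq_sym cx connect0.
have yB : y \in B by rewrite !inE yS eq_sym cy nc.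
have cAB : c \notin A :|: B by rewrite !inE eqxx.
have SE : S = A :|: B :|: [set c].
  apply/setP=> z; rewrite !inE; have [->|_] := eqVneq z c; first by rewrite cS orbT.
  by rewrite orbF /=; case: (connect e x z); case: (z \in S).
have dAB : [disjoint A & B].
  by apply/pred0P=> z /=; rewrite !inE; case: (connect e x z); rewrite ?andbF.
have nAB u v : u \in A -> v \in B -> ~~ G u v.
  rewrite !inE => /andP[/andP[uc uS] xu] /andP[/andP[vc vS]]; apply: contra => uv.
  apply: connect_trans xu _; apply: connect1.
  by apply/and3P; rewrite !inE uc uS vc vS.
have sep : separates G S A B c.
  split=> //; split; apply/set0Pn; [by exists x | by exists y].
have sub (T U : {set V}) : S = T :|: U :|: [set c] -> U != set0 -> [disjoint T & U] ->
    c \notin T :|: U -> (forall u v, u \in T -> v \in U -> ~~ G u v) ->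
    block_on G (T :|: [set c]).
  move=> SE' /set0Pn[w wU] dTU cTU nTU.
  have sT : T :|: [set c] \subset S.
    by rewrite SE'; apply: setUSS; rewrite ?subsetUl.
  have cT z : z \in T :|: [set c] -> z \notin U.
    rewrite !inE => /orP[zT|/eqP->]; first by rewrite (disjointFr dTU zT).
    by move: cTU; rewrite inE negb_or => /andP[].
  (* A walk in [S] between vertices of [T] stays in [T] up to its first visit
     of [c]. *)
  have toc z : z \in T :|: [set c] -> connect (induced G (T :|: [set c])) z c.
    move=> zT; have /connectP[p] := conS z c (subsetP sT _ zT) cS.
    elim: p z zT => [|v p IHp] z zT /=; first by move=> _ ->.
    case/andP=> /and3P[_ vS zv] vp cE.
    have [->|zc] := eqVneq z c; first exact: connect0.
    have vT : v \in T :|: [set c].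
      move: vS zT; rewrite SE' !inE (negPf zc) orbF -orbA => /or3P[->|vU|->] zT //.
        by have := nTU _ _ zT vU; rewrite zv.
      by rewrite orbT.
    apply: connect_trans (IHp v vT vp cE); apply: connect1.
    by apply/and3P.
  have conT : connected_on G (T :|: [set c]).
    move=> u v /toc uc /toc vc; apply: connect_trans uc _.
    by rewrite (sym_connect_sym (induced_sym _)).
  apply: IHn => //; last exact: vertex_cuts_sub cutS.
  apply: leq_trans leSn; apply: proper_card; apply/properP; split=> //.
  exists w; last by apply: contraL wU => /cT.
  by rewrite SE' !inE wU orbT.
case: (sep) => _ [A0 B0] _ _ _.
apply: (BlockGlue conS sep); first exact: sub SE B0 dAB cAB nAB.
apply: (sub B A); rewrite 1?[B :|: A]setUC // 1?disjoint_sym //.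
by move=> u v uB vA; rewrite adj_sym nAB.
Qed.

Lemma connected_setT : connected_graph G -> forall x y, connect G x y.
Proof.
move=> conG x y; have := conG x y (in_setT _) (in_setT _).
by apply: connect_sub => a b /and3P[_ _]; apply: connect1.
Qed.

Lemma induced_avoid c : induced G ([set: V] :\ c) =2 avoid c.
Proof. by move=> x y; rewrite /induced /avoid /= !inE !andbT. Qed.

(** The vertex that separates [a] from [b] can only be [k], since the walk a, k, b avoids every
    other candidate. *)
Lemma block_geodesic_cut : block_graph G -> geodesic_cut.
Proof.
move=> /block_vertex_cuts cutG a k b ak kb ab nab.
have [c] := cutG a b (in_setT _) (in_setT _) ab nab.
rewrite !inE negb_or andbT (eq_connect (induced_avoid c)) => /andP[ca cb] nc.
have [<- //|ck] := eqVneq c k.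
by case/negP: nc; apply: (@connect_trans _ _ k); apply: avoid1; rewrite // eq_sym.
Qed.

Lemma shortest_path_exists x y : connect G x y -> exists p, shortest_path G x y p.
Proof.
move=> /connectP[p xp yE].
pose P n := [exists t : n.-tuple V, path G x t && (last x t == y)].
have exP : exists n, P n.
  by exists (size p); apply/existsP; exists (in_tuple p); rewrite xp -yE eqxx.
case: (ex_minnP exP) => n /existsP[t /andP[xt /eqP ty]] minn.
exists t; split=> // q [xq qy]; rewrite size_tuple; apply: minn.
by apply/existsP; exists (in_tuple q); rewrite xq qy eqxx.
Qed.

Lemma shortest_cons2 x y v w p : shortest_path G x y (v :: w :: p) ->
  [/\ G x v, G v w, path G w p & last w p = y] /\
  [/\ x != w, ~~ G x w & v \notin w :: p].
Proof.
case=> -[/= /and3P[xv vw wp] py] minp; split=> //; split.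
- apply/eqP => xw; have := minp p; rewrite /is_walk xw.
  by move=> /(_ (conj wp py)); rewrite /= ltnNge leqnSn.
- apply/negP=> xw; have := minp (w :: p); rewrite /is_walk /= xw wp.
  by move=> /(_ (conj isT py)); rewrite ltnn.
have vwp : path G v (w :: p) by rewrite /= vw.
have pvy : last v (w :: p) = y by [].
apply/negP; case/splitPr def_p: {1}(w :: p) / => [p1 p2].
move: vwp pvy; rewrite def_p cat_path last_cat /= => /and3P[_ _ vp2] p2y.
have := minp (v :: p2); rewrite /is_walk /= xv => /(_ (conj vp2 p2y)).
by have := congr1 size def_p; rewrite size_cat /= => ->; rewrite addnS ltnS; lia.
Qed.

(** The second vertex [v] of a shortest path separates its two neighbours on the path, and the rest
    of the path joins the later neighbour to [y] without returning to [v]. *)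
Lemma geodesic_vertex_cuts : connected_graph G -> geodesic_cut -> vertex_cuts [set: V].
Proof.
move=> conG cutG x y _ _ xy nxy.
have [p sp] := shortest_path_exists (connected_setT conG x y).
case: p sp => [|v [|w p]] sp.
- by case: sp => -[_ /= E]; rewrite E eqxx in xy.
- by case: sp => -[/=]; rewrite andbT => xv E; rewrite -E xv in nxy.
have [[xv vw wp py] [xw nxw vp]] := shortest_cons2 sp.
have nc := cutG x v w xv vw xw nxw.
have wy : connect (avoid v) w y.
  apply/connectP; exists p => //; move: vp wp {sp py}.
  elim: p w {vw xw nxw nc} => //= u p IHp w; rewrite !inE !negb_or.
  move=> /and3P[vw vu vp] /andP[wu up].
  rewrite {1}/avoid /= [w == v]eq_sym [u == v]eq_sym vw vu wu /=.
  by apply: IHp => //; rewrite inE negb_or vu.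
exists v.
  rewrite !inE negb_or andbT eq_sym (adj_neq xv) /=.
  apply: contraNneq vp => ->; rewrite -py; exact: mem_last.
rewrite (eq_connect (induced_avoid v)); apply: contra nc => xy'.
by apply: connect_trans xy' _; rewrite connect_avoid_sym.
Qed.

Lemma geodesic_cut_block : connected_graph G -> geodesic_cut -> block_graph G.
Proof. by move=> conG cutG; apply: vertex_cuts_block => //; apply: geodesic_vertex_cuts. Qed.

End Separation.

(** Meant for one off-diagonal and two diagonal entries of an expanded inverse: the former has no
    constant term, the latter have no linear term. *)
Lemma coef2_mul3 (R : comNzRingType) (p q r : {poly R}) :
  p`_0 = 0 -> q`_1 = 0 -> r`_1 = 0 -> (p * q * r)`_2 = p`_2 * q`_0 * r`_0.
Proof.
move=> p0 q1 r1; rewrite !(coefM, big_ord_recr, big_ord0) /= p0 q1 r1.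
by ring.
Qed.

(** * Edge ratios and weighted triangle counts *)

Section Ratios.
Variables (R : realType) (V : finType) (C : eqType) (G : cgraph V C).
Local Notation X := (@inverse_space R V C G).
Local Notation L := (@concentration_space R V C G).
Implicit Types (A B K : 'M[R]_#|V|) (p q : sigma_ring R V).
Hypothesis binI : binomial_ideal (@graph_ideal R V C G).

Let one_c : C -> R := fun _ => 1.

Let one_c0 c : one_c c != 0. Proof. exact: oner_neq0. Qed.

Let Kone := kpoly G one_c one_c.

Section HadamardExpansion.
Variable Xi : 'M[R]_#|V|.
Hypotheses (XXi : X Xi) (Xi0 : forall v, ent Xi v v != 0).

Let N : 'M[{poly R}]_#|V| := mxV (fun i j => (ent Xi i j)%:P * ent (\adj Kone) i j).
Let A : 'M[R]_#|V| := amx G one_c.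
Let Q : 'M[R]_#|V| := dmx (fun v => (ent Xi v v)^-1).

Let N_in_X e : X (map_mx (horner_eval e) N).
Proof.
have -> : map_mx (horner_eval e) N =
    hadamard Xi (map_mx (horner_eval e) (\adj Kone)).
  by apply/entP=> i j; rewrite ent_map !ent_mxV ent_map /horner_eval !hornerE.
by apply: hadamard_closed => //; apply: adj_kpoly.
Qed.

(** Up to the scalar [\det Kone], the adjugate of [Kone] is the geometric series [1 + e A + e^2 A^2]
    modulo [e^3], and the entrywise product with [Xi] acts on each coefficient. *)
Let N_expand : exists E, N = \det Kone *: pmx3 (dmx (fun v => ent Xi v v))
  (hadamard Xi A) (hadamard Xi (A *m A)) + 'X^3 *: E.
Proof.
have QS : dmx (fun v : V => (one_c (vcol G v))^-1) *m 1%:M = 1%:M :> 'M[R]_#|V|.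
  rewrite mulmx1; apply/entP=> a b.
  by rewrite ent_dmx ent_scalar /one_c invr1.
pose Y : 'M[{poly R}]_#|V| := pmx3 1%:M A (A *m A).
have YE i j : 'X^3 %| \det Kone * ent Y i j - ent (\adj Kone) i j.
  have := adj_expand i j (kpoly_expand G one_c one_c) QS.
  by rewrite mul1r !mul1mx !mulmx1 opprK mulmxN mulNmx opprK subr0.
exists (mxV (fun i j => - (ent Xi i j)%:P *
  ((\det Kone * ent Y i j - ent (\adj Kone) i j) %/ 'X^3))).
apply/entP=> i j; rewrite !ent_mxV ent_add !ent_scale ent_mxV mulrCA.
rewrite [_ * (_ %/ _)]mulrC divpK // ent_pmx3 /Y ent_pmx3 !ent_mxV ent_scalar.
by case: eqVneq => [->|_]; rewrite ?mulr1n ?mulr0n !rmorphM /=; ring.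
Qed.

Let adjN_in i j e : (ent (\adj N) i j).[e] = ent (\adj (map_mx (horner_eval e) N)) i j.
Proof. by rewrite -horner_adj ent_map. Qed.

Let QE : dmx (fun v => ent Xi v v) *m Q = 1%:M.
Proof.
by apply: mulmx1C; apply: dmx_mulV.
Qed.

Let detK0 : (\det Kone).[0] != 0.
Proof. exact: det_kpoly0. Qed.

(** Up to sign, the ratio is the coefficient of [e] in the inverse of the expansion of [N], and
    [\adj N] takes equal values on edges of equal color. *)
Lemma edge_ratio_inv i j k l : G i j -> G k l ->
  ecol G [set i; j] = ecol G [set k; l] ->
  ent Xi i j / (ent Xi i i * ent Xi j j) = ent Xi k l / (ent Xi k k * ent Xi l l).
Proof.
move=> ij kl cE; case: N_expand => E defN.
have adjE : ent (\adj N) i j = ent (\adj N) k l.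
  apply/eqP; rewrite -subr_eq0; apply/eqP/poly_fun0 => e.
  rewrite hornerD hornerN !adjN_in.
  have [_ _ _ Ne] := adj_inverse_space (N_in_X e).
  by rewrite [ent _ i j](Ne _ _ _ _ ij kl cE) subrr.
have [+ _] := adj_expand_eq defN QE detK0 adjE.
rewrite !ent_mul_dmx !ent_dmx_mul !ent_mxV ij kl !mulr1 => QBQ.
by rewrite !invfM !mulrA [_ / ent Xi i i]mulrC QBQ [_ * ent Xi k l]mulrC.
Qed.

(** [\adj N] vanishes at the non-edge [ij]; up to a nonzero factor, the sum is the coefficient of
    [e^2] of the truncated inverse there. *)
Lemma nonedge_sum i j : i != j -> ~~ G i j ->
  \sum_(y | G i y && G y j) (ent Xi i y * ent Xi y j / ent Xi y y - ent Xi i j) = 0.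
Proof.
move=> ij nG; case: N_expand => E defN.
have adjE : ent (\adj N) i j = 0.
  apply: poly_fun0 => e; rewrite adjN_in.
  by have [_ N0 _ _] := adj_inverse_space (N_in_X e); apply: N0.
have := adj_expand_eq0 defN QE detK0 adjE.
set B := hadamard Xi A; set S := \sum_(y | _) _.
have -> : ent (Q *m B *m Q *m B *m Q - Q *m hadamard Xi (A *m A) *m Q) i j =
   (ent Xi i i)^-1 * (ent Xi j j)^-1 * S.
  rewrite ent_add ent_opp ![ent (_ *m Q) i j]ent_mul_dmx -!mulmxA !ent_dmx_mul.
  rewrite [ent (hadamard _ _) i j]ent_mxV !ent_mul /S sumrB big_const.
  rewrite [\sum_(y | _) _ / _]big_mkcond /= iter_addr_0.
  have -> : \sum_v ent B i v * ent (Q *m B) v j = \sum_i0 (if G i i0 && G i0 j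
      then ent Xi i i0 * ent Xi i0 j / ent Xi i0 i0 else 0).
    apply: eq_bigr => y _; rewrite ent_dmx_mul !ent_mxV.
    by case: (G i y); case: (G y j); rewrite /= /one_c ?mulr1 ?mulr0 ?mul0r //; ring.
  have -> : \sum_v ent A i v * ent A v j = #|[pred y | G i y && G y j]|%:R.
    rewrite -sum1_card natr_sum [RHS]big_mkcond /=.
    apply: eq_bigr => y _; rewrite !ent_mxV inE.
    by case: (G i y); case: (G y j); rewrite /= ?mulr1 ?mulr0.
  by rewrite -mulr_natr; ring.
by move/eqP; rewrite !mulf_eq0 !invr_eq0 !(negPf (Xi0 _)) => /eqP.
Qed.

End HadamardExpansion.

Lemma adj_kpoly_ratio (s t : C -> R) i j k l : (forall c, s c != 0) ->
  G i j -> G k l -> ecol G [set i; j] = ecol G [set k; l] ->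
  let N v w := ent (\adj (kpoly G s t)) v w in
  N i j * N k k * N l l = N k l * N i i * N j j.
Proof.
move=> s0 ij kl cE N; pose q := \prod_v N v v.
have q0 : q != 0.
  by apply/prodf_neq0=> v _; apply: poly_neq0_horner (adj_kpoly0 _ _ _ s0).
apply/eqP; rewrite -subr_eq0; apply/eqP; apply: (poly_fun0_generic q0) => e qe.
have Ne v : (N v v).[e] != 0.
  apply: contraNneq qe => Nv.
  by rewrite /q (bigD1 v) //= hornerM Nv mul0r.
have Ne' v : ent (map_mx (horner_eval e) (\adj (kpoly G s t))) v v != 0.
  by rewrite ent_map; exact: Ne.
have := edge_ratio_inv (adj_kpoly t e s0) Ne' ij kl cE.
rewrite !ent_map /horner_eval -!/(N _ _) => /eqP.
rewrite eqr_div ?mulf_neq0 // => /eqP rE; rewrite !hornerE; apply/eqP.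
by rewrite subr_eq0 -!mulrA rE.
Qed.

(** Compares the coefficients of [e^2] in the cubic identity [adj_kpoly_ratio]. The coefficient of
    [e^2] in an edge entry collects the walks of length two between its ends, that is, the triangles
    over the edge. *)
Lemma triangle_sum_inv (s t : C -> R) i j k l : (forall c, s c != 0) ->
  G i j -> G k l -> ecol G [set i; j] = ecol G [set k; l] ->
  let Q i j := \sum_(y | G i y && G j y)
     t (ecol G [set i; y]) * t (ecol G [set j; y]) * s (vcol G y) in
  Q i j = Q k l.
Proof.
move=> s0 ij kl cE Q; have s0v v : s (vcol G v) != 0 by [].
have := adj_kpoly_ratio t s0 ij kl cE; set N := \adj _ => /= NE.
set K := kpoly G s t in N NE *.
pose S := dmx (fun v => s (vcol G v)) : 'M[R]_#|V|.
pose A : 'M[R]_#|V| := amx G t.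
pose Y : 'M[{poly R}]_#|V| := pmx3 S (S *m A *m S) (S *m A *m S *m A *m S).
have YE v w : 'X^3 %| \det K * ent Y v w - ent N v w.
  have := adj_expand v w (kpoly_expand G s t) (dmx_mulV s0v).
  by rewrite mul1r mulmx0 mul0mx subr0 !(mulmxN, mulNmx, opprK).
have dvd3 a b c d e f : 'X^3 %| \det K ^+ 3 * (ent Y a b * ent Y c d * ent Y e f) -
    ent N a b * ent N c d * ent N e f.
  have := dvdXn_mul (dvdXn_mul (YE a b) (YE c d)) (YE e f).
  by rewrite [X in X - _](_ : _ = \det K ^+ 3 * (ent Y a b * ent Y c d * ent Y e f)) //; ring.
have := dvdp_sub (dvd3 i j k k l l) (dvd3 k l i i j j); rewrite NE opprB addrA.
rewrite subrK -mulrBr => /dvdXn_cancel Y3.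
have {}Y3 := dvdXn_coef (Y3 _) (isT : 2 < 3)%N.
have SA v w : ent (S *m A *m S) v w = s (vcol G v) * ent A v w * s (vcol G w).
  by rewrite ent_mul_dmx ent_dmx_mul.
have SAA v w : ent (S *m A *m S *m A *m S) v w =
    s (vcol G v) * Q v w * s (vcol G w).
  rewrite ent_mul_dmx -!mulmxA ent_dmx_mul ent_mul; congr (_ * _ * _).
  rewrite /Q [RHS]big_mkcond; apply: eq_bigr => y _.
  rewrite ent_dmx_mul !ent_amx [G y w]adj_sym [[set y; w]]setUC.
  by case: (G v y); case: (G w y); rewrite /= ?(mul0r, mulr0) //; ring.
have coefY a b c d : a != b -> (ent Y a b * ent Y c c * ent Y d d)`_2 =
    s (vcol G a) * s (vcol G b) * s (vcol G c) * s (vcol G d) * Q a b.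
  move=> /negPf ab; have Y1 v : (ent Y v v)`_1 = 0.
    have [_ -> _] := coef_pmx3 S (S *m A *m S) (S *m A *m S *m A *m S) v v.
    by rewrite SA ent_amx adj_irr mulr0 mul0r.
  have Y0 v w : (ent Y v w)`_0 = s (vcol G v) *+ (v == w).
    have [-> _ _] := coef_pmx3 S (S *m A *m S) (S *m A *m S *m A *m S) v w.
    by rewrite ent_dmx.
  have Y2 v w : (ent Y v w)`_2 = s (vcol G v) * Q v w * s (vcol G w).
    have [_ _ ->] := coef_pmx3 S (S *m A *m S) (S *m A *m S *m A *m S) v w.
    exact: SAA.
  rewrite coef2_mul3 ?Y1 ?Y0 ?ab ?Y2 ?eqxx ?mulr1n ?mulr0n //; ring.
have irr v w : G v w -> v != w.
  by apply: contraTneq => ->; rewrite adj_irr.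
move: Y3; rewrite !coefY ?irr //.
have -> : s (vcol G k) * s (vcol G l) * s (vcol G i) * s (vcol G j) =
   s (vcol G i) * s (vcol G j) * s (vcol G k) * s (vcol G l) by ring.
by move=> H; apply: (mulfI _ (H _)); rewrite ?mulf_neq0 // horner_exp expf_neq0 // det_kpoly0.
Qed.

End Ratios.

(** * Binomial ideals: block graphs and edge regularity *)

Section MMatrix.
Variables (R : realType) (V : finType) (C : eqType) (G : cgraph V C).
Implicit Types (x : V -> R).

(** Exceeds every degree, which makes [mmatrix] strictly diagonally dominant. *)
Let n1 : R := #|V|.+1%:R.

(** At a vertex where [x] has a negative minimum, the expression would be at most [n1] minus the
    degree, times this minimum, hence negative. *)
Lemma min_principle (S : pred V) x :
  (forall i, S i -> 0 <= n1 * x i - \sum_(y | S y && G i y) x y) ->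
  forall i, S i -> 0 <= x i.
Proof.
move=> Kx i Si; case: (arg_minP x Si) => m Sm xm.
apply: le_trans (xm i Si); rewrite leNgt; apply/negP=> xm0.
have := Kx m Sm; apply/negP; rewrite -ltNge.
have le_sum : #|[pred y | S y && G m y]|%:R * x m <= \sum_(y | S y && G m y) x y.
  rewrite -sum1_card natr_sum mulr_suml /= ler_sum // => y /andP[Sy _].
  by rewrite mul1r xm.
have cardn : #|[pred y | S y && G m y]|%:R < n1 by rewrite ltr_nat ltnS max_card.
set d := #|_|%:R in le_sum cardn *; nra.
Qed.

Lemma min_principle_eq0 (S : pred V) x i :
  (forall j, S j -> 0 <= n1 * x j - \sum_(y | S y && G j y) x y) ->
  S i -> x i = 0 -> forall y, S y -> G i y -> x y = 0.
Proof.
move=> Kx Si xi0; have x0 := min_principle Kx.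
have := Kx i Si; rewrite xi0 mulr0 add0r oppr_ge0 => sum_le0 y Sy iy.
have : \sum_(y | S y && G i y) x y == 0.
  by rewrite eq_le sum_le0 sumr_ge0 // => z /andP[/x0].
rewrite psumr_eq0 => [/allP/(_ y)|z /andP[/x0] //].
by rewrite mem_index_enum Sy iy => /(_ isT)/eqP.
Qed.

Definition mmatrix : 'M[R]_#|V| := n1%:M - amx G (fun=> 1).

Lemma ent_mmatrix_mul (B : 'M[R]_#|V|) i j :
  ent (mmatrix *m B) i j = n1 * ent B i j - \sum_(y | G i y) ent B y j.
Proof.
rewrite mulmxBl mul_scalar_mx ent_add ent_opp ent_scale ent_mul big_mkcond.
congr (_ - _); rewrite [RHS]big_mkcond; apply: eq_bigr => y _.
by rewrite ent_amx; case: (G i y); rewrite ?mul1r ?mul0r.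
Qed.

Lemma concentration_mmatrix : concentration_space G mmatrix.
Proof.
apply: concentrationD; first exact: concentration1.
rewrite -scaleN1r; apply: concentrationZ; exact: concentration_amx.
Qed.

Lemma mmatrix_unit : mmatrix \in unitmx.
Proof.
rewrite unitmxE unitfE; apply/det0P => -[v v0 vK].
pose B : 'M[R]_#|V| := \matrix_(i, j) v 0 i.
have [symK _ _ _] := concentration_mmatrix.
have KB : mmatrix *m B = 0.
  apply: trmx_inj; rewrite trmx_mul symK trmx0; apply/matrixP=> i j.
  have := congr1 (fun u : 'rV_#|V| => u 0 j) vK.
  rewrite [LHS]mxE [RHS]mxE => vKj; rewrite [LHS]mxE [RHS]mxE -[RHS]vKj.
  by apply: eq_bigr => k _; rewrite [B^T i k]mxE [B k i]mxE.
(* Used for [e = 1] and [e = -1]: the minimum principle applies to a kernel vector and to its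
   negative. *)
have v_ge0 (e : R) y : 0 <= e * ent B y y.
  have -> : e * ent B y y = e * v 0 (enum_rank y) by rewrite /ent mxE.
  apply: (@min_principle predT (fun y => e * v 0 (enum_rank y))) => // i _.
  have := congr1 (fun M => ent M i i) KB; rewrite ent_mmatrix_mul.
  rewrite [in RHS]/ent mxE => eq0; rewrite -mulr_sumr mulrCA -mulrBr.
  move: eq0; rewrite {1}/ent mxE.
  rewrite (eq_bigr (fun y => v 0 (enum_rank y))) => [->|z _]; last by rewrite /ent mxE.
  by rewrite mulr0.
apply/negP: v0; apply/negPn/eqP/rowP=> a; rewrite mxE.
have := v_ge0 1 (enum_val a); have := v_ge0 (-1) (enum_val a).
rewrite /ent mxE enum_valK; lra.
Qed.

Let Xi := invmx mmatrix.

Let Xi_col i j : n1 * ent Xi i j - \sum_(y | G i y) ent Xi y j = (i == j)%:R.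
Proof. by rewrite -ent_mmatrix_mul mulmxV ?mmatrix_unit // ent_scalar. Qed.

Lemma mmatrix_inv_in_X : inverse_space G Xi.
Proof.
apply: inverses_in_X; exists mmatrix; split=> //; last exact: mmatrix_unit.
exact: concentration_mmatrix.
Qed.

Lemma mmatrix_inv_ge0 i j : 0 <= ent Xi i j.
Proof.
by apply: (@min_principle predT (fun i => ent Xi i j)) => // k _; rewrite Xi_col ler0n.
Qed.

Lemma mmatrix_inv_diag j : 0 < ent Xi j j.
Proof.
have XE : n1 * ent Xi j j - \sum_(y | G j y) ent Xi y j = 1 by rewrite Xi_col eqxx.
have : 0 <= \sum_(y | G j y) ent Xi y j by apply: sumr_ge0 => y _; exact: mmatrix_inv_ge0.
have : 0 < n1 by rewrite ltr0n.
move: XE; set S := \sum_(y | _) _; move=> XE n0 S0.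
by rewrite -(pmulr_rgt0 _ n0); lra.
Qed.

(* Up to a factor, the minor is an entry of the inverse of the matrix obtained
   from [mmatrix] by deleting row and column [y]. *)
Let minor y b a := ent Xi a b * ent Xi y y - ent Xi a y * ent Xi y b.

Let minor_eqn y b a : a != y ->
  n1 * minor y b a - \sum_(c | (c != y) && G a c) minor y b c =
  (a == b)%:R * ent Xi y y.
Proof.
move=> ay; have -> : \sum_(c | (c != y) && G a c) minor y b c = \sum_(c | G a c) minor y b c.
  rewrite [RHS](bigID (fun c => c != y)) /= [X in _ + X]big1 ?addr0.
    by apply: eq_bigl => c; rewrite andbC.
  by move=> c /andP[_ /negPn/eqP ->]; rewrite /minor mulrC subrr.
have Xay : \sum_(c | G a c) ent Xi c y = n1 * ent Xi a y.
  by have /eqP := Xi_col a y; rewrite (negPf ay) subr_eq0 => /eqP ->.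
by rewrite -Xi_col /minor sumrB -!mulr_suml Xay; ring.
Qed.

Lemma mmatrix_minor_ge0 y a b : a != y ->
  0 <= ent Xi a b * ent Xi y y - ent Xi a y * ent Xi y b.
Proof.
apply: (@min_principle (fun a => a != y) (minor y b)) => i iy.
by rewrite minor_eqn // mulr_ge0 ?ler0n ?mmatrix_inv_ge0.
Qed.

(** By [min_principle_eq0], a zero of the minor at [a] would spread along a walk avoiding [y] to [b]
    and its neighbours, while the right-hand side of [minor_eqn] at [b] is the positive number
    [ent Xi y y]. *)
Lemma mmatrix_minor_eq0 y a b : a != y -> b != y ->
  ent Xi a b * ent Xi y y - ent Xi a y * ent Xi y b = 0 ->
  ~~ connect (avoid G y) a b.
Proof.
move=> ay b_y; rewrite -[LHS]/(minor y b a) => ab0; apply/negP => cab.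
have K0 j : j != y -> 0 <= n1 * minor y b j - \sum_(z | (z != y) && G j z) minor y b z.
  by move=> jy; rewrite minor_eqn // mulr_ge0 ?ler0n ?mmatrix_inv_ge0.
have b0 : minor y b b = 0.
  case/connectP: cab => p; elim: p a ay ab0 => [|c p IHp] a ay ab0 /=.
    by move=> _ bE; rewrite [X in minor _ _ X]bE.
  case/andP=> /and3P[_ cy ac]; apply: IHp => //.
  exact: (@min_principle_eq0 (fun a => a != y) (minor y b) a).
have := minor_eqn b b_y; rewrite b0 mulr0 big1 => [|c /andP[cy bc]]; last first.
  exact: (@min_principle_eq0 (fun a => a != y) (minor y b) b).
rewrite eqxx mul1r subr0 => /eqP; rewrite eq_sym gt_eqF //.
exact: mmatrix_inv_diag.
Qed.

(** For [Xi] the inverse of [mmatrix], all terms of [nonedge_sum] have the same sign, so each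
    vanishes; the term of [k] is a minor whose vanishing means separation. *)
Lemma binomial_geodesic_cut :
  binomial_ideal (@graph_ideal R V C G) -> geodesic_cut G.
Proof.
move=> binI a k b ak kb ab nab.
have Xi0 v : ent Xi v v != 0 by rewrite gt_eqF // mmatrix_inv_diag.
have := nonedge_sum binI mmatrix_inv_in_X Xi0 ab nab.
have symXi := inverse_space_sym mmatrix_inv_in_X.
pose F y := ent Xi a b - ent Xi a y * ent Xi y b / ent Xi y y.
rewrite (eq_bigr (fun y => - F y)) => [|y _]; last by rewrite opprB.
rewrite sumrN => /eqP; rewrite oppr_eq0.
have FE y : F y = (ent Xi a b * ent Xi y y - ent Xi a y * ent Xi y b) / ent Xi y y.
  by rewrite /F mulrBl mulfK.
rewrite psumr_eq0 => [/allP/(_ k)|y /andP[ay _]]; last first.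
  rewrite FE mulr_ge0 ?invr_ge0 ?mmatrix_inv_ge0 // mmatrix_minor_ge0 //.
  exact: adj_neq ay.
rewrite mem_index_enum ak kb => /(_ isT) /=.
rewrite FE mulf_eq0 invr_eq0 (negPf (Xi0 k)) orbF => /eqP.
apply: mmatrix_minor_eq0; first exact: adj_neq ak.
by rewrite eq_sym; apply: adj_neq kb.
Qed.

End MMatrix.

(** * Regularity of the coloring *)

Section RegularityFromBinomials.
Variables (R : realType) (V : finType) (C : eqType) (G : cgraph V C).
Local Notation X := (@inverse_space R V C G).
Local Notation L := (@concentration_space R V C G).
Hypothesis binI : binomial_ideal (@graph_ideal R V C G).

Lemma binomial_vertex_regular : vertex_regular G.
Proof.
apply/vertex_regularP=> x y xy c.
have := weighted_degree_inv binI (s := fun=> 1) (fun d => (d == c)%:R) _ xy.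
have cnt v : \sum_(w | G v w) (ecol G [set v; w] == c)%:R ^+ 2 * 1 =
    #|[pred z | G v z && (ecol G [set v; z] == c)]|%:R :> R.
  rewrite -sum1_card natr_sum [LHS]big_mkcond [RHS]big_mkcond; apply: eq_bigr => w _.
  by rewrite inE; case: (G v w); case: (_ == c); rewrite //= ?expr1n ?expr0n ?mulr1 ?mul0r.
rewrite !cnt => /(_ (fun=> oner_neq0 _))/eqP; rewrite eqr_nat => /eqP; exact.
Qed.

Lemma binomial_triangle_counts : triangle_counts_regular G.
Proof.
move=> i j k l ij kl cE c d z.
pose Q (t : C -> R) v w := \sum_(y | G v y && G w y)
     t (ecol G [set v; y]) * t (ecol G [set w; y]) * (vcol G y == z)%:R.
(* The weight [s] has to be nowhere zero, so the indicator of [z] is obtained as the difference of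
   [1 + (x == z)] and [1]. *)
have QE t : Q t i j = Q t k l.
  have T1 := triangle_sum_inv binI (s := fun=> 1) t (fun=> oner_neq0 _) ij kl cE.
  have s0 x : 1 + (x == z)%:R != 0 :> R by rewrite -(natrD _ 1) pnatr_eq0.
  have := triangle_sum_inv binI (s := fun x => 1 + (x == z)%:R) t s0 ij kl cE.
  move: T1 => /=; set S1 := \sum_(_ | _) _; set S2 := \sum_(_ | _) _ => T1.
  have split v w : \sum_(y | G v y && G w y)
     t (ecol G [set v; y]) * t (ecol G [set w; y]) * (1 + (vcol G y == z)%:R) =
     \sum_(y | G v y && G w y) t (ecol G [set v; y]) * t (ecol G [set w; y]) * 1 + Q t v w.
    by rewrite /Q -big_split; apply: eq_bigr => y _; rewrite mulrDr.
  by rewrite !split -/S1 -/S2 T1 => /addrI.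
pose ind (e : C) := fun x : C => (x == e)%:R : R.
have [cd|cd] := eqVneq c d.
  have cnt v w : Q (ind c) v w = #|apexes G v w c d z|%:R.
    rewrite -sum1_card natr_sum /Q [LHS]big_mkcond [RHS]big_mkcond /=.
    apply: eq_bigr => y _; rewrite unfold_in /apexes /= /ind -cd.
    case: (G v y); case: (G w y) => //=.
    have -> : perm_eq [:: ecol G [set v; y]; ecol G [set w; y]] [:: c; c] =
       (ecol G [set v; y] == c) && (ecol G [set w; y] == c).
      by apply/perm2P/andP=> [[] [-> ->] //|[/eqP-> /eqP->]]; left.
    by case: (_ == c); case: (_ == c); case: (_ == z); rewrite /= ?(mul0r, mulr0, mulr1).
  by apply/eqP; rewrite -(eqr_nat R) -!cnt QE.
(* Polarization: the quadratic form [Q] is turned into a count of triangles with sides of the two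
   different colors. *)
have cnt v w : Q (fun x => ind c x + ind d x) v w - Q (ind c) v w - Q (ind d) v w =
    #|apexes G v w c d z|%:R.
  rewrite -sum1_card natr_sum /Q -!sumrB [LHS]big_mkcond [RHS]big_mkcond /=.
  apply: eq_bigr => y _; rewrite unfold_in /apexes /= /ind.
  case: (G v y); case: (G w y) => //=.
  set e := ecol G [set v; y]; set f := ecol G [set w; y].
  have -> : perm_eq [:: e; f] [:: c; d] =
     (e == c) && (f == d) || (e == d) && (f == c).
    apply/perm2P/orP => [[] [-> ->]|[] /andP[/eqP-> /eqP->]]; rewrite ?eqxx; by [left|right].
  case: (eqVneq e c) => [->|_]; case: (eqVneq f c) => [->|_];
    rewrite ?(negPf cd) ?[d == c]eq_sym ?(negPf cd);
    case: (_ == z); rewrite /= ?(mul0r, mulr0, mulr1, addr0, add0r, subr0, subrr, sub0r, oppr0) //;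
    try (by case: (_ == d); rewrite /= ?(mul0r, mulr0, mulr1, addr0, add0r, subr0, subrr));
    by case: (_ == d); case: (_ == d);
      rewrite /= ?(mul0r, mulr0, mulr1, addr0, add0r, subr0, subrr).
by apply/eqP; rewrite -(eqr_nat R) -!cnt !QE.
Qed.

Section Laplacian.
Variable u : C -> R.
Hypothesis u_gt0 : forall c, 0 < u c.
Hypothesis conG : connected_graph G.

Let w v := u (vcol G v).

(** The diagonal is chosen so that the kernel is spanned by the vector [w], which depends on vertex
    colors only. *)
Definition laplacian : 'M[R]_#|V| :=
  dmx (fun v => (\sum_(y | G v y) w y) / w v) - amx G (fun=> 1).

Lemma concentration_laplacian : L laplacian.
Proof.
apply: concentrationD.
  apply: concentration_dmx => i j ij; rewrite /w ij; congr (_ / _).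
  have u0 c : u c != 0 by rewrite gt_eqF.
  have E v : \sum_(y | G v y) w y = \sum_(y | G v y) 1 ^+ 2 * u (vcol G y).
    by apply: eq_bigr => y _; rewrite expr1n mul1r.
  by rewrite !E; apply: (weighted_degree_inv binI (fun=> 1) u0 ij).
rewrite -scaleN1r; apply: concentrationZ; exact: concentration_amx.
Qed.

Lemma laplacian_mul (x : V -> R) i :
  \sum_y ent laplacian i y * x y = \sum_(y | G i y) (w y / w i * x i - x y).
Proof.
rewrite sumrB -2!mulr_suml (bigD1 i) //= ent_add ent_opp ent_dmx eqxx ent_amx adj_irr.
rewrite mulr1n subr0; congr (_ + _); rewrite -sumrN big_mkcond [RHS]big_mkcond.
apply: eq_bigr => y _; rewrite ent_add ent_opp ent_dmx ent_amx eq_sym.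
have [->|_] := eqVneq i y; first by rewrite adj_irr.
by case: (G i y); rewrite /= add0r ?mulN1r ?oppr0 ?mul0r.
Qed.

Lemma laplacian_kernel (x : V -> R) :
  (forall i, \sum_(y | G i y) (w y / w i * x i - x y) = 0) ->
  forall i j, x i / w i = x j / w j.
Proof.
move=> Lx i j; pose z v := x v / w v.
have w0 v : 0 < w v by exact: u_gt0.
have zE v : \sum_(y | G v y) w y * (z v - z y) = 0.
  rewrite -[RHS](Lx v); apply: eq_bigr => y _; rewrite /z.
  by field; rewrite !gt_eqF.
case: (@arg_maxP _ _ V i predT z isT) => m _ zm.
suff zmE v : z v = z m by rewrite -!/(z _) !zmE.
have /connectP[p] := connected_setT conG m v.
suff: forall a, z a = z m -> path G a p -> v = last a p -> z v = z m by apply.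
elim: p => [|b p IHp] a za /=; first by move=> _ ->.
case/andP=> ab; apply: IHp; have := zE a.
have ge0 y : G a y -> 0 <= w y * (z a - z y).
  by move=> _; apply: mulr_ge0; [exact: ltW | rewrite subr_ge0 za; exact: zm].
move/eqP; rewrite psumr_eq0 // => /allP/(_ b); rewrite mem_index_enum ab => /(_ isT).
by rewrite mulf_eq0 gt_eqF //= subr_eq0 za => /eqP ->.
Qed.

(** The Laplacian is singular, so the adjugate is reached by specializing the adjugate of
    ['X + laplacian] at 0. *)
Lemma adj_laplacian_in_X : X (\adj laplacian).
Proof.
pose K : 'M[{poly R}]_#|V| := char_poly_mx (- laplacian).
have := @adj_family R V C G K _ _ 0; rewrite horner_adj horner_shift.
have -> : 0%:M + laplacian = laplacian by rewrite -scalemx1 scale0r add0r.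
apply; first by rewrite monic_neq0 // char_poly_monic.
move=> e; rewrite horner_shift; apply: concentrationD; first exact: concentration1.
exact: concentration_laplacian.
Qed.

(* The rank-one perturbation at [v] makes the Laplacian invertible. *)
Lemma adj_laplacian_diag v : ent (\adj laplacian) v v != 0.
Proof.
have w_gt0 y : 0 < w y by exact: u_gt0.
pose M : 'M[R]_#|V| := laplacian + mxV (fun i j => ((i == v) && (j == v))%:R).
have detM : \det M = \det laplacian + ent (\adj laplacian) v v.
  rewrite !(expand_det_row _ (enum_rank v)) /ent mxE.
  have cofE j : cofactor M (enum_rank v) j = cofactor laplacian (enum_rank v) j.
    rewrite /cofactor; congr (_ * \det _); apply/matrixP=> a b.
    rewrite !mxE -[enum_rank v]/(_) [X in _ + X](_ : _ = 0) ?addr0 //.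
    by rewrite -(inj_eq enum_rank_inj) enum_valK eq_sym (negPf (neq_lift _ _)).
  rewrite (eq_bigr (fun j => laplacian (enum_rank v) j * cofactor laplacian (enum_rank v) j +
     (j == enum_rank v)%:R * cofactor laplacian (enum_rank v) j)) => [|j _].
    rewrite big_split /=; congr (_ + _); rewrite (bigD1 (enum_rank v)) //= eqxx mul1r.
    by rewrite big1 ?addr0 // => j /negPf->; rewrite mul0r.
  rewrite cofE -mulrDl; congr (_ * _); rewrite [LHS]mxE; congr (_ + _).
  by rewrite mxE enum_rankK eqxx -(inj_eq enum_rank_inj) enum_valK.
have detL : \det laplacian = 0.
  apply: (@det_eq0_ent _ _ _ w v); last by rewrite gt_eqF.
  by move=> i; rewrite laplacian_mul big1 // => y _; rewrite mulfVK ?subrr // gt_eqF.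
suff : \det M != 0 by rewrite detM detL add0r.
apply: det_neq0_ent => x Mx.
have ME i : \sum_y ent laplacian i y * x y = - ((i == v)%:R * x v).
  apply/eqP; rewrite -addr_eq0 -[X in _ == X](Mx i) eq_sym; apply/eqP.
  under eq_bigr do rewrite ent_add ent_mxV mulrDl.
  rewrite big_split /=; congr (_ + _); rewrite (bigD1 v) //= eqxx andbT.
  by rewrite big1 ?addr0 // => y /negPf->; rewrite andbF mul0r.
have symL : forall i j, ent laplacian i j = ent laplacian j i.
  by have [/sym_entP] := concentration_laplacian.
have wL j : \sum_i w i * ent laplacian i j = 0.
  under eq_bigr do rewrite mulrC symL.
  by rewrite laplacian_mul big1 // => y _; rewrite mulfVK ?subrr // gt_eqF.
have xv : x v = 0.
  have : \sum_i w i * \sum_y ent laplacian i y * x y = 0.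
    under eq_bigr do rewrite mulr_sumr.
    rewrite exchange_big big1 // => y _ /=.
    by under eq_bigr do rewrite mulrA; rewrite -mulr_suml wL mul0r.
  under eq_bigr do rewrite ME.
  rewrite (bigD1 v) //= eqxx mul1r big1 => [|i /negPf->]; last by rewrite mul0r oppr0 mulr0.
  by move/eqP; rewrite addr0 mulrN oppr_eq0 mulf_eq0 gt_eqF //= => /eqP.
move=> y; have kerx i : \sum_(z | G i z) (w z / w i * x i - x z) = 0.
  by rewrite -laplacian_mul ME xv mulr0 oppr0.
have /eqP := laplacian_kernel kerx y v; rewrite xv mul0r.
by rewrite mulf_eq0 invr_eq0 [w y == 0]gt_eqF ?orbF // => /eqP.
Qed.

(* The adjugate is a multiple of [w w^T], so its edge ratios are [1 / (w_i w_j)]. *)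
Lemma adj_laplacian_ratio i j k l : G i j -> G k l ->
  ecol G [set i; j] = ecol G [set k; l] -> w i * w j = w k * w l.
Proof.
move=> ij kl cE; have w_gt0 y : 0 < w y by exact: u_gt0.
set N := \adj laplacian; have XN : X N := adj_laplacian_in_X.
have := edge_ratio_inv binI XN adj_laplacian_diag ij kl cE.
have N0 := adj_laplacian_diag; rewrite -/N in N0.
have symN := inverse_space_sym XN.
have colN a b c : ent N a c / w a = ent N b c / w b.
  apply: (laplacian_kernel (x := fun a => ent N a c)) => v.
  rewrite -laplacian_mul -ent_mul mul_mx_adj ent_scalar.
  have -> : \det laplacian = 0; last by rewrite mul0rn.
  apply: (@det_eq0_ent _ _ _ w i); last by rewrite gt_eqF.
  by move=> b'; rewrite laplacian_mul big1 // => y _; rewrite mulfVK ?subrr // gt_eqF.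
have NE a b : ent N a b = ent N i i / w i ^+ 2 * w a * w b.
  have wn y : w y != 0 by rewrite gt_eqF.
  have Ea : ent N a b = ent N i b / w i * w a by rewrite -(colN a i b) divfK.
  have Eb : ent N i b = ent N i i / w i * w b.
    by rewrite [LHS]symN -(colN b i i) divfK.
  by rewrite Ea Eb expr2 invfM; ring.
have wn y : w y != 0 by rewrite gt_eqF.
have c0 : ent N i i / w i ^+ 2 != 0.
  by rewrite mulf_neq0 ?invr_eq0 ?expf_neq0 ?N0 ?wn.
move: (ent N i i / w i ^+ 2) c0 NE => c c0 NE.
rewrite !NE => /eqP; rewrite eqr_div ?mulf_neq0 ?wn // => /eqP E.
have : c ^+ 3 * w i * w j * w k * w l * (w i * w j) =
       c ^+ 3 * w i * w j * w k * w l * (w k * w l).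
  by transitivity (c * w k * w l * (c * w i * w i * (c * w j * w j)));
     [ring | rewrite -E; ring].
by apply: mulfI; rewrite !mulf_neq0 ?expf_neq0 ?wn.
Qed.

End Laplacian.

Lemma binomial_edge_regular : connected_graph G -> edge_regular G.
Proof.
move=> conG; apply/edge_regularP=> i j k l ij kl cE; apply/allP=> z _ /=.
(* The product of the weights at the two ends of an edge is then 2 to the number of ends of color
   [z]. *)
pose u c : R := if c == z then 2 else 1.
have u0 c : 0 < u c by rewrite /u; case: ifP; rewrite ?ltr0n.
have := adj_laplacian_ratio u0 conG ij kl cE.
rewrite /u !addn0; case: (vcol G i == z); case: (vcol G j == z);
 case: (vcol G k == z); case: (vcol G l == z) => //= /eqP;
 by rewrite ?mulr1 ?mul1r -?natrM ?(eqr_nat _ _ 1) ?eqr_nat // eq_sym ?eqr_nat ?(eqr_nat _ _ 1).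
Qed.

Lemma binomial_regular_block : connected_graph G ->
  triangle_regular G /\ block_graph G.
Proof.
move=> conG; split; last first.
  exact: geodesic_cut_block conG (binomial_geodesic_cut binI).
have regE := binomial_edge_regular conG; split=> //.
  exact: binomial_vertex_regular.
by apply/(edge_triangle_regularP regE); exact: binomial_triangle_counts.
Qed.

End RegularityFromBinomials.

(** * Geodesics and path products *)

Section Geodesics.
Variables (V : finType) (C : eqType) (G : cgraph V C).

Definition turn_ok (u v : V) := (u != v) && ~~ G u v.

(* Under [geodesic_cut] these locally shortest walks are the geodesics. *)
Fixpoint lgeo (u : V) (p : seq V) : bool :=
  if p is v :: p' then
    [&& G u v, (if p' is w :: _ then turn_ok u w else true) & lgeo v p']
  else true.

Lemma turn_ok_sym u v : turn_ok u v = turn_ok v u.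
Proof. by rewrite /turn_ok eq_sym adj_sym. Qed.

Lemma lgeo_path u p : lgeo u p -> path G u p.
Proof. by elim: p u => //= v p IHp u /and3P[-> _ /IHp]. Qed.

Lemma shortest_tail x y v p :
  shortest_path G x y (v :: p) -> G x v /\ shortest_path G v y p.
Proof.
case=> -[/= /andP[xv vp] py] minp; split=> //; split=> // q [vq qy].
by have := minp (v :: q); rewrite /is_walk /= xv vq => /(_ (conj isT qy)).
Qed.

Lemma shortest_lgeo x y p : shortest_path G x y p -> lgeo x p.
Proof.
elim: p x => //= v p IHp x sp; have [xv sv] := shortest_tail sp.
rewrite xv (IHp _ sv) andbT /=; case: p {IHp sv} sp => // w p sp.
by have [_ [xw nxw _]] := shortest_cons2 sp; apply/andP.
Qed.

Hypothesis cutG : geodesic_cut G.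

Lemma avoid_path k u p : k \notin u :: p -> path G u p ->
  connect (avoid G k) u (last u p).
Proof.
elim: p u => [|v p IHp] u /=; first by rewrite connect0.
rewrite !inE !negb_or => /and3P[ku kv kp] /andP[uv vp].
apply: (@connect_trans _ _ v); first by apply: avoid1; rewrite // eq_sym.
by apply: IHp => //; rewrite inE negb_or kv.
Qed.

(** The vertex [v] after [u] separates [u] from the next vertex. By induction the rest of the walk
    does not return to [v], so [v] separates [u] from all of it and [u] does not recur. *)
Lemma lgeo_sep_uniq u p : lgeo u p -> uniq (u :: p) /\
  (forall v w q, p = v :: w :: q -> ~~ connect (avoid G v) u (last w q)).
Proof.
elim: p u => [|v p IHp] u; first by [].
case: p IHp => [|w p] IHp; first by rewrite /= !andbT inE => uv; rewrite (adj_neq uv).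
move=> /= /and3P[uv /andP[uw nuw] vp]; have [uniqv _] := IHp v vp.
have nc : ~~ connect (avoid G v) u w.
  by apply: cutG => //; case/and3P: vp.
have wl q : path G w q -> v \notin w :: q -> ~~ connect (avoid G v) u (last w q).
  move=> wq vq; apply: contra nc => cu; apply: connect_trans cu _.
  by rewrite connect_avoid_sym; apply: avoid_path.
have wp : path G w p by case/and3P: vp => _ _ /lgeo_path.
have vwp : v \notin w :: p by move: uniqv; rewrite /= => /andP[].
split; last by move=> _ _ _ [<- <- <-]; apply: wl.
rewrite /= -/(uniq (v :: w :: p)) in uniqv *; rewrite uniqv andbT.
rewrite !inE negb_or (adj_neq uv) negb_or uw /=; apply/negP=> up.
case/splitPr: up wp vwp uniqv {vp} => p1 p2.
rewrite cat_path /= => /and3P[wp1 lu _] vwp _.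
have := wl (rcons p1 u); rewrite last_rcons connect0.
rewrite rcons_path wp1 lu => /(_ isT) H; apply: (negP (H _)) => //;
  move: vwp; rewrite !inE mem_cat mem_rcons !inE !negb_or.
by case/and3P=> -> -> /= /andP[-> _].
Qed.

Lemma lgeo_through u v w p q : lgeo u (v :: w :: p) -> path G u q ->
  last u q = last w p -> exists q1 q2, [/\ q = q1 ++ v :: q2, path G v q2 & last v q2 = last w p].
Proof.
move=> geo uq lq; have [_ sep] := lgeo_sep_uniq geo.
have nsep := sep v w p erefl.
have : v \in u :: q.
  by apply: contraNT nsep => vq; rewrite -lq; apply: avoid_path.
have uv : G u v by case/andP: geo.
rewrite inE eq_sym (negPf (adj_neq uv)) /=.
move=> vq; case/splitPr: vq uq lq => q1 q2.
rewrite cat_path last_cat /= => /and3P[_ _ vq2] lq.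
by exists q1, q2.
Qed.

Lemma lgeo_shortest u p : lgeo u p -> shortest_path G u (last u p) p.
Proof.
elim: p u => [|v p IHp] u geo; first by split.
split; first by split; first exact: lgeo_path.
move=> q [uq lq]; case: p IHp geo lq => [|w p] IHp geo lq.
  case: q uq lq => //= _ uv; case/andP: geo => /adj_neq.
  by rewrite uv eqxx.
have [q1 [q2 [-> vq2 lq2]]] := lgeo_through geo uq lq.
have vp : lgeo v (w :: p) by case/and3P: geo.
have [_ minp] := IHp _ vp; have := minp q2 (conj vq2 lq2).
by rewrite size_cat /=; lia.
Qed.

(** Both walks are shortest, hence equally long. The second passes through the vertex after [u] on
    the first, and a later passage would make it too long. *)
Lemma lgeo_inj u p q : lgeo u p -> lgeo u q -> last u p = last u q -> p = q.
Proof.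
elim: p u q => [|v p IHp] u q up uq lpq.
  have [_ /(_ [::])] := lgeo_shortest uq; rewrite /is_walk -lpq.
  by move=> /(_ (conj isT erefl)); case: q {uq lpq}.
have szE : size q = (size p).+1.
  have [[_ _] mp] := lgeo_shortest up; have [[_ _] mq] := lgeo_shortest uq.
  have := mp q (conj (lgeo_path uq) (esym lpq)).
  have := mq (v :: p) (conj (lgeo_path up) lpq).
  by rewrite /=; lia.
case: q uq szE lpq => // v' q uq [szE] lpq.
have vE : v = v'.
  case: p up szE lpq {IHp} => [|w p] up szE lpq.
    by case: q {uq} szE lpq => // _ /=.
  have [q1 [q2 [qE vq2 lq2]]] := lgeo_through up (lgeo_path uq) (esym lpq).
  have vp : lgeo v (w :: p) by case/and3P: up.
  have [_ /(_ q2 (conj vq2 lq2)) /= le] := lgeo_shortest vp.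
  have := congr1 size qE; rewrite size_cat /=; rewrite /= in szE.
  by case: q1 qE => [[]|? ?] //=; lia.
rewrite -vE in uq lpq *; congr (_ :: _).
by apply: (IHp v); [case/and3P: up | case/and3P: uq |].
Qed.

End Geodesics.

Section PathProducts.
Variables (V : finType) (C : eqType) (G : cgraph V C) (T : comNzRingType).
Variable N : V -> V -> T.
Hypothesis symN : forall x y, N x y = N y x.

Definition edge_val (s : {set V}) : T :=
  if [pick xy : V * V | G xy.1 xy.2 && (s == [set xy.1; xy.2])] is Some xy
  then N xy.1 xy.2 else 0.

Lemma set2_eq (a b x y : V) : a != b -> [set a; b] = [set x; y] ->
  (a = x /\ b = y) \/ (a = y /\ b = x).
Proof.
move=> ab E; have := set21 a b; have := set22 a b; rewrite E !inE.
by case/orP=> /eqP bE; case/orP=> /eqP aE; rewrite aE bE ?eqxx // in ab *; [right|left].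
Qed.

Lemma edge_valE x y : G x y -> edge_val [set x; y] = N x y.
Proof.
move=> xy; rewrite /edge_val; case: pickP => [[a b] /= /andP[ab /eqP E]|/(_ (x, y))].
  by case: (set2_eq (adj_neq xy) E) => -[-> ->].
by rewrite /= xy eqxx.
Qed.

Definition ends_val (s : {set V}) : T := \prod_(a in s) N a a.

Lemma ends_valE x y : G x y -> ends_val [set x; y] = N x x * N y y.
Proof.
by move=> xy; rewrite /ends_val big_setU1 ?big_set1 // inE (adj_neq xy).
Qed.

(** Handshake along a walk: each visit of [v] meets two edges, except at the two ends of the walk,
    where the extra terms compensate. So the edges and the ends determine the multiset of
    vertices. *)
Lemma count_path_ends v u p : path G u p ->
  (\sum_(s <- path_edges u p) (v \in s) + (v == u) + (v == last u p) =
   2 * count_mem v (u :: p))%N.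
Proof.
elim: p u => [|w p IHp] u /=; first by rewrite big_nil ![u == v]eq_sym; lia.
case/andP=> uw wp; have := IHp w wp; rewrite /path_edges /= big_cons.
rewrite !inE ![u == v]eq_sym ![w == v]eq_sym.
have : ~~ ((v == u) && (v == w)).
  by apply/negP=> /andP[/eqP vu /eqP vw]; rewrite -vu -vw adj_irr in uw.
by case: (v == u); case: (v == w) => //= _; lia.
Qed.

Hypothesis N_cut : forall i j k, ~~ connect (avoid G k) i j ->
  N i j * N k k = N i k * N k j.

(** Denominator-free form of the product of the edge entries divided by the interior diagonal
    entries: for a nonempty walk, the product of the [ends_val] contains the interior diagonal
    entries twice and those at the two ends once. *)
Lemma path_formula u p : geodesic_cut G -> lgeo G u p ->
  N u (last u p) * \prod_(s <- path_edges u p) ends_val s =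
  \prod_(s <- path_edges u p) edge_val s * \prod_(v <- u :: p) N v v.
Proof.
move=> cutG; elim: p u => [|v p IHp] u geo.
  by rewrite !big_nil big_seq1 mulr1 mul1r.
have vp : lgeo G v p by case/and3P: geo.
have uv : G u v by case/and3P: geo.
rewrite /path_edges /= !big_cons -/(path_edges v p) ends_valE // edge_valE //.
have step : N u (last v p) * N v v = N u v * N v (last v p).
  case: p {IHp vp} geo => [|w p] geo //=; apply: N_cut.
  by have [_ /(_ _ _ _ erefl)] := lgeo_sep_uniq cutG geo.
transitivity (N u u * (N u (last v p) * N v v) * \prod_(s <- path_edges v p) ends_val s).
  by ring.
rewrite step; transitivity (N u u * N u v *
  (N v (last v p) * \prod_(s <- path_edges v p) ends_val s)); first by ring.
rewrite (IHp v vp) big_cons; ring.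
Qed.

End PathProducts.

(** * Color invariance of inverses *)

Section AdjugateColors.
Variables (R : realType) (V : finType) (C : eqType) (G : cgraph V C).
Hypotheses (cutG : geodesic_cut G) (regV : vertex_regular G)
  (regE : edge_regular G) (regT : triangle_counts_regular G).
Variable K : 'M[{poly R}]_#|V|.
Hypotheses (symK : forall i j, ent K i j = ent K j i)
  (K_nonedge : forall i j, i != j -> ~~ G i j -> ent K i j = 0)
  (K_vertex : forall i j, vcol G i = vcol G j -> ent K i i = ent K j j)
  (K_edge : forall i j k l, G i j -> G k l ->
     ecol G [set i; j] = ecol G [set k; l] -> ent K i j = ent K k l)
  (K_at0 : map_mx (horner_eval 0) K = 1%:M).

Let N i j := ent (\adj K) i j.
Let d := \det K.

Lemma adjK_sym i j : N i j = N j i.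
Proof.
have KT : K^T = K by apply/sym_entP.
by rewrite /N -ent_tr trmx_adj KT.
Qed.

Lemma mulK_adj i j : \sum_v ent K i v * N v j = d *+ (i == j).
Proof. by rewrite -ent_mul mul_mx_adj ent_scalar. Qed.

Lemma mul_adjK i j : \sum_v N i v * ent K v j = d *+ (i == j).
Proof. by rewrite -ent_mul mul_adj_mx ent_scalar. Qed.

Lemma adjK_at0 i j : (N i j).[0] = (i == j)%:R.
Proof.
rewrite -[LHS]/(horner_eval 0 (N i j)) -(ent_map (horner_eval 0)) horner_adj.
by rewrite K_at0 adj1 ent_scalar.
Qed.

Lemma detK_at0 : d.[0] = 1.
Proof. by rewrite -[LHS]/(horner_eval 0 d) -det_map_mx K_at0 det1. Qed.

Lemma adjK_diag_neq0 i : N i i != 0.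
Proof.
by apply: (@poly_neq0_horner _ _ 0); rewrite adjK_at0 eqxx oner_neq0.
Qed.

Lemma detK_neq0 : d != 0.
Proof. by apply: (@poly_neq0_horner _ _ 0); rewrite detK_at0 oner_neq0. Qed.

(* Truncating [N_kk N_j - N_kj N_k] to the component of [i] gives a vector whose
   image under [K] is supported at [k]. *)
Lemma adjK_cut i j k : ~~ connect (avoid G k) i j -> N i j * N k k = N i k * N k j.
Proof.
move=> nij; have [ik|ik] := eqVneq i k; first by rewrite ik mulrC.
have [->//|jk] := eqVneq j k.
pose S := [pred a | (a != k) && connect (avoid G k) i a].
pose w a := if S a then N k k * N a j - N k j * N a k else 0.
pose g := \sum_a ent K k a * w a.
have wk : w k = 0 by rewrite /w /= eqxx.
have Kw u : u != k -> \sum_a ent K u a * w a = 0.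
  move=> uk; have [Su|nSu] := boolP (S u); last first.
    rewrite big1 // => a _; rewrite /w; case: ifP => [/andP[ak ca]|_]; last by rewrite mulr0.
    have ua : u != a by apply: contraNneq nSu => ->; apply/andP.
    rewrite K_nonedge ?mul0r //; apply: contra nSu => ua'; apply/andP; split=> //.
    by apply: connect_trans ca (avoid1 ak uk _); rewrite adj_sym.
  transitivity (\sum_a ent K u a * (N k k * N a j - N k j * N a k)).
    apply: eq_bigr => a _; rewrite /w; case: ifP => // /negbT nSa.
    have [->|ak] := eqVneq a k; first by rewrite [N k j * _]mulrC subrr.
    have ua : u != a by apply: contraNneq nSa => <-.
    rewrite K_nonedge ?mul0r //; apply: contra nSa => ua'; apply/andP; split=> //.
    by case/andP: Su => _ cu; apply: connect_trans cu (avoid1 uk ak _).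
  transitivity (N k k * (\sum_a ent K u a * N a j) - N k j * (\sum_a ent K u a * N a k)).
    by rewrite !mulr_sumr -sumrB; apply: eq_bigr => a _; ring.
  rewrite !mulK_adj (negPf uk) [u == j](_ : _ = false) ?mulr0n ?mulr0 ?subrr //.
  by apply: contraNF nij => /eqP <-; case/andP: Su.
have dw a : d * w a = g * N a k.
  transitivity (\sum_u N a u * (\sum_b ent K u b * w b)); last first.
    by rewrite (bigD1 k) //= [X in _ + X]big1 ?addr0 1?mulrC // => u uk; rewrite Kw ?mulr0.
  under eq_bigr do rewrite mulr_sumr.
  rewrite exchange_big /= (bigD1 a) //= [X in _ + X]big1 => [|b ba].
    under eq_bigr do rewrite mulrA.
    by rewrite -mulr_suml mul_adjK eqxx addr0.
  under eq_bigr do rewrite mulrA.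
  by rewrite -mulr_suml mul_adjK eq_sym (negPf ba) mul0r.
have /eqP := dw k; rewrite wk mulr0 eq_sym mulf_eq0 (negPf (adjK_diag_neq0 k)) orbF => /eqP g0.
have /eqP := dw i; rewrite g0 mul0r mulf_eq0 (negPf detK_neq0) /w /= ik connect0 /=.
by rewrite subr_eq0 mulrC [N k j * _]mulrC => /eqP.
Qed.

(** The edge entries of [K] vanish at 0. The factor ['X] split off here is what gains one order in
    the induction of [adjK_congX]. *)
Let kappa i j := ent K i j %/ 'X.

Lemma kappaE i j : G i j -> ent K i j = 'X * kappa i j.
Proof.
move=> ij; rewrite mulrC /kappa divpK //.
have -> : 'X = 'X - 0%:P :> {poly R} by rewrite subr0.
rewrite dvdp_XsubCl /root -[_.[0]]/(horner_eval 0 _) -ent_map K_at0 ent_scalar.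
by rewrite (negPf (adj_neq ij)).
Qed.

Lemma kappa_sym i j : kappa i j = kappa j i.
Proof. by rewrite /kappa symK. Qed.

Lemma kappa_edge i j k l : G i j -> G k l ->
  ecol G [set i; j] = ecol G [set k; l] -> kappa i j = kappa k l.
Proof. by move=> ij kl e; rewrite /kappa (K_edge ij kl e). Qed.

Lemma sum_row (F : V -> {poly R}) i : (forall v, i != v -> ~~ G i v -> F v = 0) ->
  \sum_v F v = F i + \sum_(v | G i v) F v.
Proof.
move=> F0; rewrite (bigD1 i) //=; congr (_ + _).
rewrite big_mkcond [RHS]big_mkcond; apply: eq_bigr => v _.
rewrite eq_sym; have [<-|iv] := eqVneq i v; first by rewrite adj_irr.
by case: ifPn => // /F0 ->.
Qed.

Lemma vertex_eqn j :
  ent K j j * N j j = d - 'X * \sum_(v | G j v) kappa j v * N j v.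
Proof.
have := mulK_adj j j; rewrite eqxx mulr1n => <-.
rewrite (@sum_row _ j) => [|v jv nG]; last by rewrite K_nonedge ?mul0r.
rewrite mulr_sumr [X in _ + X - _](eq_bigr (fun v => 'X * (kappa j v * N j v))).
  by rewrite addrK.
by move=> v jv; rewrite kappaE // mulrA [N v j]adjK_sym.
Qed.

(** Eliminates [K_ii] between the equations of [K N = d] at (i, i) and (i, j). A neighbour [v] of
    [i] that is neither [j] nor adjacent to [j] is separated from [j] by [i], so
    [N_vj N_ii = N_vi N_ij] and its contributions cancel; the triangles over [ij] remain. *)
Lemma edge_eqn_half i j : G i j ->
  d * N i j = 'X * (- (kappa i j * N i i * N j j) + kappa i j * N i j ^+ 2
   + \sum_(v | G i v && G j v) (N i j * (kappa i v * N i v) - N i i * (kappa i v * N v j))).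
Proof.
move=> ij; have ij' := adj_neq ij.
have split (F : V -> {poly R}) : \sum_(v | G i v) F v =
    F j + \sum_(v | G i v && G j v) F v +
    \sum_(v | G i v && ((v != j) && ~~ G j v)) F v.
  rewrite (bigD1 j) //= -addrA; congr (_ + _).
  rewrite (bigID (G j)) /=; congr (_ + _); apply: eq_bigl => v.
    by case jv: (G j v); rewrite ?andbF // eq_sym (adj_neq jv) !andbT.
  by rewrite andbA.
pose Rest := \sum_(v | G i v && ((v != j) && ~~ G j v)) kappa i v * N i v.
have eq1 : ent K i i * N i i = d - 'X * (kappa i j * N i j +
    \sum_(v | G i v && G j v) kappa i v * N i v + Rest).
  by rewrite vertex_eqn split.
have eq2 : 0 = N i i * (ent K i i * N i j) + N i i * ('X * (kappa i j * N j j +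
    \sum_(v | G i v && G j v) kappa i v * N v j)) + N i j * ('X * Rest).
  have cutRest : N i i * \sum_(v | G i v && ((v != j) && ~~ G j v)) kappa i v * N v j =
      N i j * Rest.
    rewrite /Rest !mulr_sumr; apply: eq_bigr => v /and3P[iv vj njv].
    have cut : N v j * N i i = N v i * N i j.
      by apply: adjK_cut; apply: cutG; rewrite // adj_sym.
    transitivity (kappa i v * (N v j * N i i)); first by ring.
    by rewrite cut [N v i]adjK_sym; ring.
  have := mulK_adj i j; rewrite (negPf ij') mulr0n.
  rewrite (@sum_row _ i) => [|v jv nG]; last by rewrite K_nonedge ?mul0r.
  rewrite (eq_bigr (fun v => 'X * (kappa i v * N v j))); last first.
    by move=> v iv; rewrite kappaE // mulrA.
  rewrite -mulr_sumr split => /(congr1 ( *%R (N i i))); rewrite mulr0 => E; rewrite -[LHS]E.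
  rewrite [N i j * ('X * Rest)]mulrCA -cutRest; ring.
have eq3 : N i i * (ent K i i * N i j) = N i j * (d - 'X * (kappa i j * N i j +
    \sum_(v | G i v && G j v) kappa i v * N i v + Rest)).
  by rewrite -eq1; ring.
rewrite eq3 in eq2; rewrite sumrB -!mulr_sumr.
move: (\sum_(v | G i v && G j v) kappa i v * N i v) eq2 => S1.
move: (\sum_(v | G i v && G j v) kappa i v * N v j) => S2 eq2.
apply/eqP; rewrite -subr_eq0; apply/eqP; rewrite [RHS]eq2; ring.
Qed.

(** The sum of [edge_eqn_half] over both orientations: edges of equal color have matching ends only
    up to a swap, so the right-hand side has to be symmetric in [i] and [j]. *)
Lemma edge_eqn i j : G i j ->
  2 * d * N i j = 'X * (2 * (kappa i j * N i j ^+ 2 - kappa i j * (N i i * N j j))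
   + \sum_(v | G i v && G j v)
      (N i j * (kappa i v * N i v + kappa j v * N j v)
       - (N i i * (kappa i v * N v j) + N j j * (kappa j v * N v i)))).
Proof.
move=> ij; have ji : G j i by rewrite adj_sym.
have Ei := edge_eqn_half ij; have Ej := edge_eqn_half ji.
rewrite [N j i]adjK_sym [kappa j i]kappa_sym in Ej.
rewrite (eq_bigl (fun v => G i v && G j v)) in Ej; last by move=> v; rewrite andbC.
have -> : 2 * d * N i j = d * N i j + d * N i j by ring.
rewrite {1}Ei Ej -mulrDr; congr ('X * _).
rewrite [in RHS](eq_bigr (fun v =>
  (N i j * (kappa i v * N i v) - N i i * (kappa i v * N v j)) +
  (N i j * (kappa j v * N j v) - N j j * (kappa j v * N v i)))); last by move=> v _; ring.
rewrite [in RHS]big_split /=; ring.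
Qed.

Let congX n (p q : {poly R}) : Prop := 'X^n %| p - q.

Let congX_refl n p : congX n p p.
Proof. by rewrite /congX subrr dvdp0. Qed.

Let congXD n a b c e : congX n a b -> congX n c e -> congX n (a + c) (b + e).
Proof.
rewrite /congX => ab ce; have -> : a + c - (b + e) = (a - b) + (c - e) by ring.
exact: dvdp_add.
Qed.

Let congXN n a b : congX n a b -> congX n (- a) (- b).
Proof. by rewrite /congX -opprD dvdpNr. Qed.

Let congXM n a b c e : congX n a b -> congX n c e -> congX n (a * c) (b * e).
Proof. exact: dvdXn_mul. Qed.

(* Both families of equations express the entries mod ['X^n.+1] through the
   entries mod ['X^n]. *)
Lemma adjK_congX n :
  (forall i j, vcol G i = vcol G j -> congX n (N i i) (N j j)) /\
  (forall i j k l, G i j -> G k l -> ecol G [set i; j] = ecol G [set k; l] ->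
     congX n (N i j) (N k l)).
Proof.
elim: n => [|n [IHv IHe]]; first by split=> *; rewrite /congX dvd1p.
have dvdX p q : congX n p q -> congX n.+1 ('X * p) ('X * q).
  by rewrite /congX -mulrBr exprS dvdp_mul2l // polyX_eq0.
have edges i j k l : G i j -> G k l -> ecol G [set i; j] = ecol G [set k; l] ->
    congX n.+1 (N i j) (N k l).
  move=> ij kl cE; have dd : (2 * d).[0] != 0.
    by rewrite hornerM detK_at0 mulr1 -[2]/(2%:R) -polyC_natr hornerC pnatr_eq0.
  apply: (dvdXn_cancel dd); rewrite mulrBr -/(congX _ _ _) !edge_eqn //.
  have kE := kappa_edge ij kl cE; have NE := IHe _ _ _ _ ij kl cE.
  apply: dvdX; apply: congXD.
    apply: congXM; first exact: congX_refl.
    rewrite kE; apply: congXD; first by do ?[apply: congXM | exact: congX_refl].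
    apply: congXN; apply: congXM; first exact: congX_refl.
    have /edge_regularP/(_ _ _ _ _ ij kl cE)/perm2P[] := regE.
      by case=> vik vjl; apply: congXM; apply: IHv.
    by case=> vil vjk; rewrite [N i i * _]mulrC; apply: congXM; apply: IHv.
  apply: (sum_apexes (Q := congX n) (F := fun i j v =>
     N i j * (kappa i v * N i v + kappa j v * N j v) -
     (N i i * (kappa i v * N v j) + N j j * (kappa j v * N v i)))
     (congX_refl n 0) (@congXD n) regT ij kl cE).
  move=> y z tij tkl key; have [_ iy jy] := tij; have [_ kz lz] := tkl.
  have [[vik vjl e1 e2]|[vil vjk e1 e2]] := apex_key_match regE tij tkl key.
    have := (kappa_edge iy kz e1, kappa_edge jy lz e2) => -[-> ->].
    have := (IHe _ _ _ _ iy kz e1, IHe _ _ _ _ jy lz e2) => -[Ni Nj].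
    rewrite [N y j]adjK_sym [N z l]adjK_sym [N y i]adjK_sym [N z k]adjK_sym.
    have := (IHv _ _ vik, IHv _ _ vjl) => -[Nii Njj].
    by do ![apply: congXD | apply: congXN | apply: congXM | exact: congX_refl].
  have := (kappa_edge iy lz e1, kappa_edge jy kz e2) => -[-> ->].
  have := (IHe _ _ _ _ iy lz e1, IHe _ _ _ _ jy kz e2) => -[Ni Nj].
  rewrite [N y j]adjK_sym [N z l]adjK_sym [N y i]adjK_sym [N z k]adjK_sym.
  have := (IHv _ _ vil, IHv _ _ vjk) => -[Nii Njj].
  rewrite [kappa l z * _ + _]addrC [N i i * _ + _]addrC.
  by do ![apply: congXD | apply: congXN | apply: congXM | exact: congX_refl].
split=> // i j vij; have Kd : (ent K i i).[0] != 0.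
  rewrite -[_.[0]]/(horner_eval 0 _) -ent_map K_at0 ent_scalar eqxx.
  exact: oner_neq0.
apply: (dvdXn_cancel Kd); rewrite mulrBr {2}(K_vertex vij) -/(congX _ _ _) !vertex_eqn.
apply: congXD; first exact: congX_refl.
apply/congXN/dvdX; apply: (sum_incident (Q := congX n) (F := fun j v => kappa j v * N j v)
  (congX_refl n 0) (@congXD n) regV vij).
move=> y z iy jz e; rewrite (kappa_edge iy jz e).
by apply: congXM; [exact: congX_refl | exact: IHe].
Qed.

Let congX_eq p q : (forall n, congX n p q) -> p = q.
Proof.
move=> pq; apply/eqP; rewrite -subr_eq0; apply: contraT => /negPf pq0.
have := dvdp_leq (negbT pq0) (pq (size (p - q))).
by rewrite size_polyXn ltnn.
Qed.

Lemma adjK_vertex i j : vcol G i = vcol G j -> N i i = N j j.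
Proof. by move=> ij; apply: congX_eq => n; have [Nv _] := adjK_congX n; apply: Nv. Qed.

Lemma adjK_edge i j k l : G i j -> G k l ->
  ecol G [set i; j] = ecol G [set k; l] -> N i j = N k l.
Proof. by move=> ij kl e; apply: congX_eq => n; have [_ Ne] := adjK_congX n; apply: Ne. Qed.

End AdjugateColors.

Section PathColors.
Variables (V : finType) (C : eqType) (G : cgraph V C).

Lemma path_edges_is_edge u p : path G u p ->
  forall s, s \in path_edges u p -> exists x y, G x y /\ s = [set x; y].
Proof.
elim: p u => [|v p IHp] u //= /andP[uv vp] s; rewrite inE => /orP[/eqP->|].
  by exists u, v.
exact: IHp.
Qed.

Definition is_vcol (c : C) := [exists v, vcol G v == c].

Hypothesis disjG : disjoint_colors G.

Lemma ecol_not_vcol x y : G x y -> ~~ is_vcol (ecol G [set x; y]).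
Proof.
move=> xy; apply/existsP=> -[v /eqP]; apply: disjG.
by exists x, y.
Qed.

Lemma is_vcolP v : is_vcol (vcol G v).
Proof. by apply/existsP; exists v. Qed.

(** Disjointness of vertex and edge colors allows the multiset of path colors to be split into its
    two parts. *)
Lemma filter_path_colors u p : path G u p ->
  [seq c <- path_colors G u p | is_vcol c] = map (vcol G) (u :: p) /\
  [seq c <- path_colors G u p | ~~ is_vcol c] = map (ecol G) (path_edges u p).
Proof.
move=> up; have [Hv He] :
    all is_vcol (map (vcol G) (u :: p)) /\ all (predC is_vcol) (map (ecol G) (path_edges u p)).
  split; apply/allP=> c /mapP[s s_in ->]; first exact: is_vcolP.
  have [x [y [xy ->]]] := path_edges_is_edge up s_in; exact: ecol_not_vcol.
rewrite /path_colors !filter_cat; split.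
  rewrite (all_filterP Hv) -[RHS]cats0; congr (_ ++ _).
  by apply/eqP; rewrite -size_eq0 size_filter -leqn0 leqNgt -has_count -all_predC.
rewrite -[RHS]cat0s; congr (_ ++ _); last exact/all_filterP.
apply/eqP; rewrite -size_eq0 size_filter -leqn0 leqNgt -has_count -all_predC.
by apply: sub_all Hv => c /= ->.
Qed.

Lemma perm_path_colors u p w q : path G u p -> path G w q ->
  perm_eq (path_colors G u p) (path_colors G w q) ->
  perm_eq (map (vcol G) (u :: p)) (map (vcol G) (w :: q)) /\
  perm_eq (map (ecol G) (path_edges u p)) (map (ecol G) (path_edges w q)).
Proof.
move=> up wq pE; have [pv pe] := filter_path_colors up.
have [qv qe] := filter_path_colors wq.
by rewrite -pv -qv -pe -qe !perm_filter.
Qed.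

(** Rewrites a product over edges as a product over colors, where [perm_eq] of color lists can be
    applied. *)
Lemma prod_edge_colors (T : comNzRingType) (F : {set V} -> T) :
  (forall i j k l, G i j -> G k l -> ecol G [set i; j] = ecol G [set k; l] ->
     F [set i; j] = F [set k; l]) ->
  exists f : C -> T, forall u p, path G u p ->
    \prod_(s <- path_edges u p) F s = \prod_(c <- map (ecol G) (path_edges u p)) f c.
Proof.
move=> FE; pose f c := if [pick xy : V * V | G xy.1 xy.2 && (ecol G [set xy.1; xy.2] == c)]
  is Some xy then F [set xy.1; xy.2] else 0.
exists f => u p up; rewrite big_map; apply: eq_big_seq => s s_in.
have [x [y [xy ->]]] := path_edges_is_edge up s_in; rewrite /f.
case: pickP => [[a b] /= /andP[ab /eqP cE]|/(_ (x, y))]; last by rewrite /= xy eqxx.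
by apply: FE.
Qed.

Lemma prod_vertex_colors (T : comNzRingType) (F : V -> T) :
  (forall i j, vcol G i = vcol G j -> F i = F j) ->
  exists f : C -> T, forall s : seq V,
    \prod_(v <- s) F v = \prod_(c <- map (vcol G) s) f c.
Proof.
move=> FE; pose f c := if [pick v | vcol G v == c] is Some v then F v else 0.
exists f => s; rewrite big_map; apply: eq_bigr => v _; rewrite /f.
by case: pickP => [w /eqP /FE //|/(_ v)]; rewrite eqxx.
Qed.

End PathColors.

Lemma double_count (s1 s2 s3 s4 a b c e x1 x2 x3 x4 : nat) :
  (s1 + a + b = 2 * x1 -> s2 + c + e = 2 * x2 -> s3 + a + c = 2 * x3 ->
   s4 + b + e = 2 * x4 -> s1 + s2 = s3 + s4 -> x1 + x2 = x3 + x4)%N.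
Proof. lia. Qed.

(** * The linear and quadratic binomials lie in the ideal *)

Section BinomialsVanish.
Variables (R : realType) (V : finType) (C : eqType) (G : cgraph V C).
Hypotheses (cutG : geodesic_cut G) (regV : vertex_regular G)
  (regE : edge_regular G) (regT : triangle_counts_regular G)
  (disjG : disjoint_colors G).
Local Notation L := (@concentration_space R V C G).

Definition unit_family (K0 : 'M[R]_#|V|) : 'M[{poly R}]_#|V| :=
  1%:M + 'X *: map_mx polyC K0.

Section Family.
Variable K0 : 'M[R]_#|V|.
Hypothesis LK0 : L K0.
Let K := unit_family K0.

Lemma unit_family_entries :
  [/\ forall i j, ent K i j = ent K j i,
      forall i j, i != j -> ~~ G i j -> ent K i j = 0,
      forall i j, vcol G i = vcol G j -> ent K i i = ent K j j &
      forall i j k l, G i j -> G k l ->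
        ecol G [set i; j] = ecol G [set k; l] -> ent K i j = ent K k l].
Proof.
have KE i j : ent K i j = (i == j)%:R + 'X * (ent K0 i j)%:P.
  by rewrite /K ent_add ent_scalar ent_scale ent_map.
case: LK0 => /sym_entP symK K_0 Kv Ke; split.
- by move=> i j; rewrite !KE eq_sym symK.
- by move=> i j ij nij; rewrite KE (negPf ij) [ent _ _ _]K_0 // mulr0 addr0.
- by move=> i j ij; rewrite !KE !eqxx [ent _ i i](Kv _ _ ij).
- move=> i j k l ij kl cE; rewrite !KE (negPf (adj_neq ij)) (negPf (adj_neq kl)).
  by rewrite [ent _ i j](Ke _ _ _ _ ij kl cE).
Qed.

Lemma horner_unit_family e : map_mx (horner_eval e) K = 1%:M + e *: K0.
Proof.
apply/entP=> i j; rewrite ent_map /K !ent_add !ent_scalar !ent_scale ent_map.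
by rewrite /horner_eval hornerD hornerM hornerX hornerC hornerMn hornerC.
Qed.

Lemma unit_family_at0 : map_mx (horner_eval 0) K = 1%:M.
Proof. by rewrite horner_unit_family scale0r addr0. Qed.

Let N i j := ent (\adj K) i j.

Lemma adj_family_path_formula u p : lgeo G u p ->
  N u (last u p) * \prod_(s <- path_edges u p) ends_val N s =
  \prod_(s <- path_edges u p) edge_val G N s * \prod_(v <- u :: p) N v v.
Proof.
have [symK K_0 _ _] := unit_family_entries.
apply: path_formula => //; first exact: adjK_sym.
move=> i j k; apply: adjK_cut => //; exact: unit_family_at0.
Qed.

Lemma ends_prod_neq0 u p : \prod_(s <- path_edges u p) ends_val N s != 0.
Proof.
rewrite prodf_seq_neq0; apply/allP=> s _ /=; apply/prodf_neq0 => v _.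
by apply: adjK_diag_neq0; apply: unit_family_at0.
Qed.

Lemma adj_family_linear i j k l : same_path_colors G i j k l -> N i j = N k l.
Proof.
have [symK K_0 Kv Ke] := unit_family_entries; have K_1 := unit_family_at0.
have Nv : forall a b, vcol G a = vcol G b -> N a a = N b b :=
  adjK_vertex cutG regV regE regT symK K_0 Kv Ke K_1.
have Ne : forall a b c d, G a b -> G c d ->
    ecol G [set a; b] = ecol G [set c; d] -> N a b = N c d :=
  adjK_edge cutG regV regE regT symK K_0 Kv Ke K_1.
case=> p [q [sp sq pE]]; have [[ip pj] _] := sp; have [[kq ql] _] := sq.
have [pv pe] := perm_path_colors disjG ip kq pE.
have [fe feE] : exists f : C -> {poly R}, forall u p, path G u p ->
    \prod_(s <- path_edges u p) edge_val G N s = \prod_(c <- map (ecol G) (path_edges u p)) f c.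
  apply: prod_edge_colors => a b c d ab cd cE.
  by rewrite !edge_valE //; [apply: Ne | exact: adjK_sym | exact: adjK_sym].
have [fd fdE] : exists f : C -> {poly R}, forall u p, path G u p ->
    \prod_(s <- path_edges u p) ends_val N s = \prod_(c <- map (ecol G) (path_edges u p)) f c.
  apply: prod_edge_colors => a b c d ab cd cE; rewrite !(ends_valE _ ab, ends_valE _ cd).
  have /edge_regularP/(_ _ _ _ _ ab cd cE)/perm2P[] := regE => -[e1 e2].
    by rewrite (Nv _ _ e1) (Nv _ _ e2).
  by rewrite (Nv _ _ e1) (Nv _ _ e2) mulrC.
have [fv fvE] := @prod_vertex_colors _ _ G _ (fun v => N v v) Nv.
have := adj_family_path_formula (shortest_lgeo sp).
have := adj_family_path_formula (shortest_lgeo sq).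
have Y0 := ends_prod_neq0 k q; move: Y0.
rewrite pj ql !feE // !fdE // !fvE (perm_big _ pe) (perm_big _ pv) /=.
by rewrite !(perm_big _ pe) => Y0 <- /(mulIf Y0).
Qed.

(** Multiplies the path formulas of the four geodesics: the edge products agree by hypothesis, and
    the vertex products agree because edges and ends determine the vertices. *)
Lemma adj_family_quadratic i j k l : same_path_edges G i j k l ->
  N i j * N k l = N i k * N j l.
Proof.
case=> pij [pkl [pik [pjl [sij skl sik sjl pE]]]].
have [[[gij ij] _] [[gkl kl] _]] := (sij, skl).
have [[[gik ik] _] [[gjl jl] _]] := (sik, sjl).
have Fij := adj_family_path_formula (shortest_lgeo sij).
have Fkl := adj_family_path_formula (shortest_lgeo skl).
have Fik := adj_family_path_formula (shortest_lgeo sik).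
have Fjl := adj_family_path_formula (shortest_lgeo sjl).
rewrite ?ij ?kl ?ik ?jl in Fij Fkl Fik Fjl.
have pV : perm_eq ((i :: pij) ++ (k :: pkl)) ((i :: pik) ++ (j :: pjl)).
  apply/allP=> v _; apply/eqP; rewrite !count_cat.
  have Eij := count_path_ends v gij; have Ekl := count_path_ends v gkl.
  have Eik := count_path_ends v gik; have Ejl := count_path_ends v gjl.
  have SE : (\sum_(s <- path_edges i pij) (v \in s) + \sum_(s <- path_edges k pkl) (v \in s) =
      \sum_(s <- path_edges i pik) (v \in s) + \sum_(s <- path_edges j pjl) (v \in s))%N.
    by rewrite -!big_cat (perm_big _ pE).
  rewrite ij in Eij; rewrite kl in Ekl; rewrite ik in Eik; rewrite jl in Ejl.
  exact: (double_count Eij Ekl Eik Ejl SE).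
have prodE (F : {set V} -> {poly R}) :
    \prod_(s <- path_edges i pij) F s * \prod_(s <- path_edges k pkl) F s =
    \prod_(s <- path_edges i pik) F s * \prod_(s <- path_edges j pjl) F s.
  by rewrite -!big_cat (perm_big _ pE).
have prodV : \prod_(v <- i :: pij) N v v * \prod_(v <- k :: pkl) N v v =
    \prod_(v <- i :: pik) N v v * \prod_(v <- j :: pjl) N v v.
  by rewrite -!big_cat (perm_big _ pV).
apply: (mulIf (mulf_neq0 (ends_prod_neq0 i pij) (ends_prod_neq0 k pkl))).
rewrite [in RHS]prodE mulrACA Fij Fkl [RHS]mulrACA Fik Fjl.
by rewrite mulrACA prodE prodV mulrACA.
Qed.

End Family.

(* From [1 + e K0] to [K0]: replace [e] by [1/t], clear denominators by homogeneity
   and set [t = 0]. *)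
Lemma homogeneous_relation (rel : 'M[R]_#|V| -> R)
    (relP : 'M[{poly R}]_#|V| -> {poly R}) m :
  (forall M e, (relP M).[e] = rel (map_mx (horner_eval e) M)) ->
  (forall a M, rel (a *: M) = a ^+ m * rel M) ->
  (forall K0, L K0 -> relP (\adj (unit_family K0)) = 0) ->
  forall A, inverses G A -> rel A = 0.
Proof.
move=> relE relZ rel0 _ [K0 [LK0 Ku ->]].
suff adj0 : rel (\adj K0) = 0.
  by rewrite /invmx Ku relZ adj0 mulr0.
pose P : 'M[{poly R}]_#|V| := char_poly_mx (- K0).
have P0 : relP (\adj P) = 0.
  apply: (@poly_fun0_generic _ _ 'X); first by rewrite polyX_eq0.
  move=> t; rewrite hornerX => t0; rewrite relE horner_adj horner_shift.
  have -> : t%:M + K0 = t *: (1%:M + t^-1 *: K0).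
    by rewrite scalerDr scalerA mulfV // scale1r scalemx1.
  rewrite adjZ relZ -horner_unit_family -horner_adj -relE rel0 //.
  by rewrite horner0 mulr0.
have := relE (\adj P) 0; rewrite P0 horner0 horner_adj horner_shift.
by rewrite -scalemx1 scale0r add0r.
Qed.

Lemma linear_binomials_in_ideal i j k l : same_path_colors G i j k l ->
  graph_ideal G (@sigma R V i j - sigma R k l).
Proof.
move=> sc; apply/graph_idealP=> A invA.
rewrite eval_atB !eval_at_sigma ?(inverses_sym invA) //.
apply: (@homogeneous_relation (fun M => ent M i j - ent M k l)
  (fun M => ent M i j - ent M k l) 1 _ _ _ A invA).
- by move=> M e; rewrite hornerD hornerN !ent_map.
- by move=> a M; rewrite !ent_scale; ring.
- by move=> K0 LK0; rewrite (adj_family_linear LK0 sc) subrr.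
Qed.

Lemma quadratic_binomials_in_ideal i j k l : same_path_edges G i j k l ->
  graph_ideal G (sigma R i j * sigma R k l - sigma R i k * sigma R j l).
Proof.
move=> se; apply/graph_idealP=> A invA.
rewrite eval_atB !eval_atM !eval_at_sigma ?(inverses_sym invA) //.
apply: (@homogeneous_relation (fun M => ent M i j * ent M k l - ent M i k * ent M j l)
  (fun M => ent M i j * ent M k l - ent M i k * ent M j l) 2 _ _ _ A invA).
- by move=> M e; rewrite hornerD hornerN !hornerM !ent_map.
- by move=> a M; rewrite !ent_scale; ring.
- by move=> K0 LK0; rewrite (adj_family_quadratic LK0 se) subrr.
Qed.

End BinomialsVanish.

(** * Local structure of regular block graphs *)

Section LocalRegularity.
Variables (V : finType) (C : eqType) (G : cgraph V C).
Hypotheses (cutG : geodesic_cut G) (regV : vertex_regular G)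
  (regE : edge_regular G) (regT : triangle_counts_regular G).

Lemma nbr_color u v u' v' : G u v -> G u' v' -> vcol G u = vcol G u' ->
  ecol G [set u; v] = ecol G [set u'; v'] -> vcol G v = vcol G v'.
Proof.
move=> uv u'v' uu' cE; have /edge_regularP/(_ _ _ _ _ uv u'v' cE)/perm2P := regE.
by rewrite uu' => -[[_ ->]|[-> ->]].
Qed.

Definition color_degree c u := #|[pred y | G u y && (ecol G [set u; y] == c)]|.

Lemma color_degree_inv c u u' : vcol G u = vcol G u' -> color_degree c u = color_degree c u'.
Proof. by move=> uu'; have /vertex_regularP := regV; apply. Qed.

Lemma mono_degree_inv x u u' : vcol G u = vcol G u' ->
  #|[set y | G u y && (vcol G y == x)]| = #|[set y | G u' y && (vcol G y == x)]|.
Proof.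
move=> uu'; have cE v : #|[set y | G v y && (vcol G y == x)]| =
  (\sum_(y | G v y) (vcol G y == x))%N.
  rewrite -sum1_card [LHS]big_mkcond [RHS]big_mkcond; apply: eq_bigr => y _.
  by rewrite inE; case: (G v y); case: (_ == x).
rewrite !cE; apply: (sum_incident (Q := @eq nat) (F := fun v y => (vcol G y == x) : nat)) => //.
  by move=> a b c d -> ->.
by move=> y z uy u'z e; rewrite (nbr_color uy u'z uu' e).
Qed.

Let branch k b := [set z | connect (avoid G k) b z].

(* Otherwise choose [a - k - b] with the smallest branch at [b]: then all
   neighbours of [b] of color [x] are neighbours of [k], which has one more,
   namely [a]. *)
Lemma mono_adj_trans x a k b :
  vcol G a = x -> vcol G k = x -> vcol G b = x ->
  G a k -> G k b -> a != b -> G a b.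
Proof.
have [n] := ubnP #|branch k b|; elim: n a k b => // n IHn a k b; rewrite ltnS => leUn.
move=> ax kx bx ak kb ab; apply/negPn/negP => nab.
pose Nx v := [set y | G v y && (vcol G y == x)].
have nbr u : u \in Nx b -> u != k -> G k u.
  rewrite inE => /andP[bu /eqP ux] uk; apply/negPn/negP => nku.
  have ku : k != u by rewrite eq_sym.
  have ncu : ~~ connect (avoid G b) k u by apply: cutG.
  suff lt_branch : (#|branch b u| < n)%N.
    by have := IHn k b u lt_branch kx bx ux kb bu ku; rewrite (negPf nku).
  apply: leq_trans leUn; apply: proper_card; apply/properP; split.
    have walk p w : w != k -> connect (avoid G b) u w -> path (avoid G b) w p ->
        connect (avoid G k) w (last w p).
      elim: p w => [|v p IHp] w wk cw /=; first by rewrite connect0.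
      case/andP=> wv vp; have cv := connect_trans cw (connect1 wv).
      have vk : v != k.
        by apply: contraNneq ncu => <-; rewrite connect_avoid_sym.
      apply: connect_trans (IHp v vk cv vp); apply: avoid1 => //.
      by case/and3P: wv.
    apply/subsetP=> z; rewrite !inE => /connectP[p up ->].
    have bk : b != k by rewrite eq_sym (adj_neq kb).
    apply: connect_trans (avoid1 bk uk bu) (walk p u uk _ up).
    exact: connect0.
  exists b; rewrite !inE ?connect0 //; apply/negP => /connectP[p].
  case/lastP: p => [|p v] /=; first by move=> _ E; rewrite -E adj_irr in bu.
  by rewrite rcons_path last_rcons => /andP[_ /and3P[_ + _]] E; rewrite E eqxx.
have kNb : k \in Nx b by rewrite inE adj_sym kb kx eqxx.
have bNk : b \in Nx k by rewrite inE kb bx eqxx.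
have sub : a |: (Nx b :\ k) \subset Nx k :\ b.
  apply/subsetP=> u; rewrite !inE => /orP[/eqP->|/andP[uk /andP[bu ux]]].
    by rewrite ab adj_sym ak ax eqxx.
  rewrite nbr ?inE ?bu ?ux //= andbT eq_sym; exact: adj_neq bu.
have := subset_leq_card sub.
have := mono_degree_inv x (etrans bx (esym kx)); rewrite -/(Nx b) -/(Nx k).
rewrite cardsU1 !inE (negPf (adj_neq ak)) [G b a]adj_sym (negPf nab) /= (cardsD1 k (Nx b)) kNb.
by rewrite (cardsD1 b (Nx k)) bNk; lia.
Qed.

(* The vertices counted lie in the block of the edge [uv]. *)
Definition block_degree c u v :=
  #|[pred y | [&& G u y, (y == v) || G v y & ecol G [set u; y] == c]]|.

Lemma block_degreeE c u v : G u v ->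
  block_degree c u v =
  ((ecol G [set u; v] == c) + \sum_(y | G u y && G v y) (ecol G [set u; y] == c))%N.
Proof.
move=> uv; rewrite /block_degree (cardD1 v) !inE uv eqxx /=; congr (_ + _)%N.
rewrite -sum1_card [LHS]big_mkcond [RHS]big_mkcond; apply: eq_bigr => y _.
rewrite !inE; have [->|_] := eqVneq y v; first by rewrite adj_irr andbF.
by case: (G u y); case: (G v y); case: (_ == c).
Qed.

(** As the ends of [uv] differ in color, a matching of triangles over [uv] and [u'v'] cannot swap
    the ends. *)
Lemma block_degree_inv2 c u v u' v' : G u v -> G u' v' ->
  vcol G u = vcol G u' -> ecol G [set u; v] = ecol G [set u'; v'] ->
  vcol G u != vcol G v -> block_degree c u v = block_degree c u' v'.
Proof.
move=> uv u'v' uu' cE uxv; rewrite !block_degreeE // cE; congr (_ + _)%N.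
apply: (sum_apexes (Q := @eq nat) (F := fun u v y => (ecol G [set u; y] == c) : nat)
  _ _ regT uv u'v' cE) => // [a b d e -> -> //|y z t1 t2 key].
have [[_ _ -> _] //|[_ vu' _ _]] := apex_key_match regE t1 t2 key.
by rewrite uu' vu' eqxx in uxv.
Qed.

(** Adding the two ends makes the count insensitive to a swap in the matching of triangles. *)
Lemma block_degree_sum_inv c u v u' v' : G u v -> G u' v' ->
  ecol G [set u; v] = ecol G [set u'; v'] ->
  (block_degree c u v + block_degree c v u =
   block_degree c u' v' + block_degree c v' u')%N.
Proof.
move=> uv u'v' cE; have vu : G v u by rewrite adj_sym.
have v'u' : G v' u' by rewrite adj_sym.
have E a b : G a b -> G b a -> (block_degree c a b + block_degree c b a =
   2 * (ecol G [set a; b] == c) +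
   \sum_(y | G a y && G b y) ((ecol G [set a; y] == c) + (ecol G [set b; y] == c)))%N.
  move=> ab ba; rewrite !block_degreeE // big_split /= [[set b; a]]setUC.
  rewrite [X in (_ + (_ + X))%N](eq_bigl (fun y => G a y && G b y));
    last by move=> y; rewrite andbC.
  lia.
rewrite !E // cE; congr (_ + _)%N.
apply: (sum_apexes (Q := @eq nat)
  (F := fun u v y => ((ecol G [set u; y] == c) + (ecol G [set v; y] == c))%N)
  _ _ regT uv u'v' cE) => // [a b d e -> -> //|y z t1 t2 key].
have [[_ _ -> -> //]|[_ _ -> ->]] := apex_key_match regE t1 t2 key.
exact: addnC.
Qed.

Lemma block_degree_le c u v : (block_degree c u v <= color_degree c u)%N.
Proof.
apply: subset_leq_card; apply/subsetP=> y; rewrite !inE.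
by case/and3P=> -> _ ->.
Qed.

(** Suppose the inequality fails. Then [u] has an edge of color [c] to some [z] in the block of
    [uv], and [v], having the same [c]-degree, has one to some [z'] outside it. If [z'] has the
    color of [u], then [mono_adj_trans] along z', v, u makes [z'] adjacent to [u]. Otherwise the
    block of [vz'] contains a vertex [w] adjacent to [u], and [u] and [z'] have the adjacent common
    neighbours [v] and [w]. *)
Lemma block_degree_mono_le c u v : G u v -> vcol G u = vcol G v ->
  (block_degree c u v <= block_degree c v u)%N.
Proof.
move=> uv uxv; rewrite leqNgt; apply/negP => lt_vu.
have /card_gt0P[z] : (0 < block_degree c u v)%N by apply: leq_trans lt_vu.
rewrite inE => /and3P[uz zv /eqP cz].
have lt_deg : (block_degree c v u < color_degree c v)%N.
  by apply: leq_trans lt_vu _; rewrite -(color_degree_inv c uxv) block_degree_le.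
have /subsetPn[z'] : ~~ ([pred y | G v y && (ecol G [set v; y] == c)]
    \subset [pred y | [&& G v y, (y == u) || G u y & ecol G [set v; y] == c]]).
  by apply: contraL lt_deg => /subset_leq_card; rewrite -leqNgt.
rewrite !inE => /andP[vz' cz']; rewrite vz' cz' andbT negb_or /= => /andP[z'u nuz'].
move/eqP: cz' => cz'.
have zz' : vcol G z = vcol G z' by apply: nbr_color uz vz' uxv _; rewrite cz.
have vu : G v u by rewrite adj_sym.
have [xz|xz] := eqVneq (vcol G u) (vcol G z).
  have := @mono_adj_trans (vcol G u) z' v u; rewrite -zz' -xz uxv.
  by move=> /(_ erefl erefl erefl); rewrite adj_sym vz' vu z'u => /(_ isT isT isT);
    rewrite adj_sym (negPf nuz').
have vz : G v z.
  case/orP: zv => // /eqP zv; by rewrite zv uxv eqxx in xz.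
(* At the edge [uz], the vertex [v] is counted for the color of [uv]; the edge [vz'] has the same
   colors, so some [w] is counted there. *)
have degE := block_degree_inv2 (ecol G [set u; v]) uz vz' uxv (etrans cz (esym cz')) xz.
have : (0 < block_degree (ecol G [set u; v]) v z')%N.
  rewrite -degE; apply/card_gt0P; exists v; rewrite inE uv eqxx andbT /=.
  by rewrite [G z v]adj_sym vz orbT.
case/card_gt0P=> w; rewrite inE => /and3P[vw wz' /eqP cw].
have xw : vcol G w = vcol G u.
  by have := nbr_color vw vu erefl; rewrite [[set v; u]]setUC; apply.
have wz'N : w != z' by apply: contraNneq xz => wz'E; rewrite zz' -wz'E xw.
have z'w : G z' w by case/orP: wz' => // /eqP E; rewrite E eqxx in wz'N.
have wu : w != u by apply: contraNneq nuz' => <-; rewrite adj_sym.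
have uw : G w u by apply: (@mono_adj_trans (vcol G u) w v u); rewrite // adj_sym.
case/negP: nuz'; apply: (@cut_common_nbrs _ _ G u z' v w) => //;
  rewrite 1?adj_sym // eq_sym //.
Qed.

(** If the ends have the same color, [block_degree_mono_le] in both directions shows that each block
    degree is half of the invariant sum. *)
Lemma block_degree_inv c u v u' v' : G u v -> G u' v' ->
  vcol G u = vcol G u' -> ecol G [set u; v] = ecol G [set u'; v'] ->
  block_degree c u v = block_degree c u' v'.
Proof.
move=> uv u'v' uu' cE; have [xv|] := eqVneq (vcol G u) (vcol G v); last first.
  exact: block_degree_inv2.
have u'x : vcol G u' = vcol G v' by rewrite -uu' xv; exact: nbr_color cE.
have symm a b : G a b -> vcol G a = vcol G b -> block_degree c a b = block_degree c b a.
  move=> ab e; apply/eqP; rewrite eqn_leq !block_degree_mono_le //.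
  by rewrite adj_sym.
have := block_degree_sum_inv c uv u'v' cE.
rewrite (symm v u) 1?adj_sym // (symm v' u') 1?adj_sym //.
by lia.
Qed.

End LocalRegularity.

(** * Stubs: continuing a geodesic by a prescribed color *)

Section Words.
Variables (V : finType) (C : eqType) (G : cgraph V C).
Hypotheses (cutG : geodesic_cut G) (regV : vertex_regular G)
  (regE : edge_regular G) (regT : triangle_counts_regular G)
  (disjG : disjoint_colors G).

Definition same_block u a b := [&& G u a, G u b & (b == a) || G a b].

Lemma same_block_sym u a b : same_block u a b = same_block u b a.
Proof. by rewrite /same_block eq_sym [G a b]adj_sym andbCA. Qed.

Lemma same_block_trans u a b c :
  same_block u a b -> same_block u b c -> same_block u a c.
Proof.
move=> /and3P[ua ub ab] /and3P[_ uc bc]; apply/and3P; split=> //.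
case/orP: ab => [/eqP<- //|ab]; case/orP: bc => [/eqP-> |bc].
  by rewrite ab orbT.
have [//|ca] := eqVneq c a; apply: (cut_common_nbr_trans cutG ua ub uc) => //.
by rewrite eq_sym.
Qed.

Lemma turn_okE u a b : G u a -> G u b -> turn_ok G a b = ~~ same_block u a b.
Proof. by move=> ua ub; rewrite /same_block ua ub /turn_ok negb_or eq_sym. Qed.

(* The stub of a path at a vertex is the color of its next edge there, or [None]
   if the path ends. *)
Definition is_stub u (o : option V) (k : option C) : bool :=
  match o, k with
  | Some a, Some c => G u a && (ecol G [set u; a] == c)
  | None, None => true
  | _, _ => false
  end.

Definition has_stub (x : C) (k : option C) : bool :=
  if k is Some c then [exists u, exists a, (vcol G u == x) && is_stub u (Some a) k]
  else true.

Definition meet_block (x : C) (k l : option C) : bool :=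
  [exists u, exists a, exists b, [&& vcol G u == x, is_stub u (Some a) k,
    is_stub u (Some b) l & same_block u a b]].

Definition diff_block (x : C) (k l : option C) : bool :=
  [exists u, exists a, exists b, [&& vcol G u == x, is_stub u (Some a) k,
    is_stub u (Some b) l & ~~ same_block u a b]].

(* All edges of color [k] and [l] at vertices of color [x] lie in one block. *)
Definition incompatible (x : C) (k l : option C) : bool :=
  [&& isSome k, isSome l, has_stub x k, has_stub x l & ~~ diff_block x k l].

Definition okturn (o o' : option V) : bool :=
  if (o, o') is (Some a, Some b) then turn_ok G a b else true.

Lemma stub_lift x k u : has_stub x k -> vcol G u = x -> exists o, is_stub u o k.
Proof.
case: k => [c|] /=; last by exists None.
case/existsP=> v /existsP[a /and3P[/eqP vx va vc]] ux.
have : (0 < color_degree G c v)%N by apply/card_gt0P; exists a; rewrite inE va vc.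
rewrite (color_degree_inv regV c (etrans vx (esym ux))) => /card_gt0P[b].
by rewrite inE => ub; exists (Some b).
Qed.

(** The block degree in color [l] is positive at one edge of color [k] at a vertex of color [x],
    hence at every such edge. *)
Lemma meet_lift x k l u a : meet_block x k l -> vcol G u = x ->
  is_stub u (Some a) k -> exists2 b, is_stub u (Some b) l & same_block u a b.
Proof.
case: k => [c|]; case: l => [d|] // /existsP[u0 /existsP[a0 /existsP[b0]]];
  last by rewrite /= !andbF.
case/and4P=> /eqP u0x /andP[ua0 /eqP ca0] /andP[ub0 cb0] /and3P[_ _ ab0] ux /andP[ua /eqP ca].
have : (0 < block_degree G d u0 a0)%N.
  by apply/card_gt0P; exists b0; rewrite inE ub0 ab0.
rewrite (block_degree_inv cutG regV regE regT d ua0 ua); last first.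
- by rewrite ca ca0.
- by rewrite u0x.
case/card_gt0P=> b; rewrite inE => /and3P[ub ab cb]; exists b; first exact/andP.
exact/and3P.
Qed.

(** There is an edge of color [l] outside the block exactly when the block degree is smaller than
    the color degree, and both numbers depend on colors only. *)
Lemma diff_lift x k l u a : diff_block x k l -> vcol G u = x ->
  is_stub u (Some a) k -> exists2 b, is_stub u (Some b) l & ~~ same_block u a b.
Proof.
case: k => [c|]; case: l => [d|] // /existsP[u0 /existsP[a0 /existsP[b0]]];
  last by rewrite /= !andbF.
case/and4P=> /eqP u0x /andP[ua0 /eqP ca0] /andP[ub0 cb0] nab0 ux /andP[ua /eqP ca].
have lt0 : (block_degree G d u0 a0 < color_degree G d u0)%N.
  apply: proper_card; apply/properP; split.
    by apply/subsetP=> y; rewrite !inE => /and3P[-> _ ->].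
  exists b0; rewrite inE ub0 ?cb0 ?andbT //.
  by move: nab0; rewrite /same_block ua0 ub0.
have lt : (block_degree G d u a < color_degree G d u)%N.
  rewrite -(block_degree_inv cutG regV regE regT d ua0 ua) ?ca ?ca0 ?u0x //.
  by rewrite -(color_degree_inv regV d (etrans u0x (esym ux))).
have /subsetPn[b] : ~~ ([pred y | G u y && (ecol G [set u; y] == d)]
    \subset [pred y | [&& G u y, (y == a) || G a y & ecol G [set u; y] == d]]).
  by apply: contraL lt => /subset_leq_card; rewrite -leqNgt.
rewrite !inE => /andP[ub cb]; rewrite ub cb andbT /= => nab.
exists b; first exact/andP.
by rewrite /same_block ua ub.
Qed.

Lemma incompatible_sym x k l : incompatible x k l = incompatible x l k.
Proof.
suff imp k' l' : incompatible x k' l' -> incompatible x l' k'.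
  by apply/idP/idP; apply: imp.
rewrite /incompatible => /and5P[-> -> -> -> ndiff]; rewrite !andTb.
apply: contra ndiff => /existsP[u /existsP[a /existsP[b /and4P[ux sa sb nab]]]].
apply/existsP; exists u; apply/existsP; exists b; apply/existsP; exists a.
by rewrite ux sa sb same_block_sym.
Qed.

(** [stub_lift] supplies an edge of color [l] at the vertex considered, and it has to lie in the
    block of both other edges. *)
Lemma incompatible_trans x k l m :
  incompatible x k l -> incompatible x l m -> incompatible x k m.
Proof.
move=> /and5P[k1 l1 sk sl nkl] /and5P[_ m1 _ sm nlm].
rewrite /incompatible k1 m1 sk sm !andTb; apply/negP.
case/existsP=> u /existsP[a /existsP[b /and4P[/eqP ux sa sb /negP[]]]].
have [[c|] sc] := stub_lift sl ux; last by case: l l1 sc {sl nkl nlm}.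
apply: (@same_block_trans _ _ c); apply: contraT => nab.
  case/negP: nkl; apply/existsP; exists u; apply/existsP; exists a.
  by apply/existsP; exists c; rewrite ux eqxx sa sc.
case/negP: nlm; apply/existsP; exists u; apply/existsP; exists c.
by apply/existsP; exists b; rewrite ux eqxx sc sb.
Qed.

Lemma okturn_sym o o' : okturn o o' = okturn o' o.
Proof. by case: o => [a|]; case: o' => [b|] //=; apply: turn_ok_sym. Qed.

Lemma okturnN u o o' k l : is_stub u o k -> is_stub u o' l -> okturn o o' ->
  ~~ incompatible (vcol G u) k l.
Proof.
case: k => [c|]; case: l => [d|]; rewrite /incompatible //=.
case: o => [a|] //; case: o' => [b|] //= sa sb tab; apply/and3P => -[_ _ /negP[]].
apply/existsP; exists u; apply/existsP; exists a; apply/existsP; exists b.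
rewrite eqxx /= sa sb /= -(@turn_okE u) //; [by case/andP: sa | by case/andP: sb].
Qed.

Lemma compatible_lift x k l u o : has_stub x l -> ~~ incompatible x k l ->
  vcol G u = x -> is_stub u o k -> exists2 o', is_stub u o' l & okturn o o'.
Proof.
case: o k => [a|] [c|] //; case: l => [d|] sl nkl ux sa; try by exists None.
  have sk : has_stub x (Some c).
    by apply/existsP; exists u; apply/existsP; exists a; rewrite ux eqxx.
  have diff : diff_block x (Some c) (Some d).
    by move: nkl; rewrite /incompatible sk sl /= negbK.
  have [b sb nab] := diff_lift diff ux sa; exists (Some b) => //.
  by rewrite /okturn (@turn_okE u) //; [case/andP: sa | case/andP: sb].
by have [o so] := stub_lift sl ux; exists o.
Qed.

Lemma okturn_block u a b o k : is_stub u (Some a) k -> same_block u a b ->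
  forall l, is_stub u o l -> okturn o (Some a) = okturn o (Some b).
Proof.
move=> sa sab l; case: o => [c|] //; case: l => // d /andP[uc _] /=.
have [ua ub _] := and3P sab; rewrite /okturn !(@turn_okE u) //; congr (~~ _).
apply/idP/idP => sc; apply: same_block_trans sc _ => //.
by rewrite same_block_sym.
Qed.

Lemma okturn_meetN u o o' k l : is_stub u o k -> is_stub u o' l ->
  ~~ meet_block (vcol G u) k l -> okturn o o'.
Proof.
case: o k => [a|] [c|] //; case: o' l => [b|] [d|] // sa sb; apply: contraR; rewrite /okturn => nt.
apply/existsP; exists u; apply/existsP; exists a; apply/existsP; exists b.
rewrite eqxx sa sb; move: nt; rewrite (@turn_okE u) ?negbK //;
  [by case/andP: sa | by case/andP: sb].
Qed.

Lemma meet_blockP x k l u a b : vcol G u = x -> is_stub u (Some a) k ->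
  is_stub u (Some b) l -> same_block u a b -> meet_block x k l.
Proof.
move=> ux sa sb sab; apply/existsP; exists u; apply/existsP; exists a.
by apply/existsP; exists b; rewrite ux eqxx sa sb.
Qed.

Lemma meet_block_sym x k l : meet_block x k l -> meet_block x l k.
Proof.
case/existsP=> u /existsP[a /existsP[b /and4P[/eqP ux sa sb sab]]].
by apply: (meet_blockP ux sb sa); rewrite same_block_sym.
Qed.

Lemma meet_block_trans x k l m :
  meet_block x k l -> meet_block x l m -> meet_block x k m.
Proof.
case/existsP=> u /existsP[a /existsP[b /and4P[/eqP ux sa sb sab]]] lm.
have [c sc sbc] := meet_lift lm ux sb.
exact: (meet_blockP ux sa sc (same_block_trans sab sbc)).
Qed.

Lemma meet_stub x k l : meet_block x k l -> isSome k /\ isSome l.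
Proof.
by case/existsP=> u /existsP[a /existsP[b /and4P[_]]]; case: k; case: l.
Qed.

(* Of the four constraints only those between [{a, c}] and [{b, d}] matter, so
   [d] is placed in the block of [b], and [c] in the block of [a], whenever the
   colors allow it. *)
Lemma four_stubs x kA kB kC kD u : vcol G u = x ->
  has_stub x kA -> has_stub x kB -> has_stub x kC -> has_stub x kD ->
  ~~ incompatible x kA kB -> ~~ incompatible x kC kD ->
  ~~ incompatible x kA kD -> ~~ incompatible x kC kB ->
  exists a b c d,
    [/\ is_stub u a kA, is_stub u b kB, is_stub u c kC & is_stub u d kD] /\
    [/\ okturn a b, okturn c d, okturn a d & okturn c b].
Proof.
move=> ux sA sB sC sD nAB nCD nAD nCB.
have [a ua] := stub_lift sA ux.
have [b ub tab] := compatible_lift sB nAB ux ua.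
have nBC : ~~ incompatible x kB kC by rewrite incompatible_sym.
have nDC : ~~ incompatible x kD kC by rewrite incompatible_sym.
have [d [ud tad db]] : exists d, [/\ is_stub u d kD, okturn a d &
    meet_block x kB kD -> exists b0 d0, [/\ b = Some b0, d = Some d0 & same_block u b0 d0]].
  have [mBD|] := boolP (meet_block x kB kD); last first.
    by have [d ud tad] := compatible_lift sD nAD ux ua; exists d.
  case: b ub tab => [b|] ub tab; last by case: kB ub mBD {sB nAB nCB nBC} => // _ /meet_stub[].
  have [d ud sbd] := meet_lift mBD ux ub; exists (Some d); split=> //.
    by rewrite -(okturn_block ub sbd ua).
  by exists b, d.
suff [c [uc tcb tcd]] : exists c, [/\ is_stub u c kC, okturn c b & okturn c d].
  by exists a, b, c, d.
have [mAC|nmAC] := boolP (meet_block x kA kC).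
  case: a ua tab tad => [a|] ua tab tad; last first.
    by case: kA ua mAC {sA nAB nAD} => // _ /meet_stub[].
  have [c uc sac] := meet_lift mAC ux ua; exists (Some c); split=> //.
    by rewrite okturn_sym -(okturn_block ua sac ub) okturn_sym.
  by rewrite okturn_sym -(okturn_block ua sac ud) okturn_sym.
have [mBD|nmBD] := boolP (meet_block x kB kD).
  have [c uc tbc] := compatible_lift sC nBC ux ub; exists c.
  have [b0 [d0 [bE dE sbd]]] := db mBD; rewrite bE in ub tbc *.
  by rewrite dE -(okturn_block ub sbd uc) okturn_sym.
(* If the colors of [c] and [d] can meet in a block, those of [c] and [b] cannot, since then [b] and
   [d] could meet as well. *)
have [mCD|nmCD] := boolP (meet_block x kC kD).
  have [c uc tdc] := compatible_lift sC nDC ux ud; exists c.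
  split=> //; last by rewrite okturn_sym.
  apply: okturn_meetN uc ub _; rewrite ux; apply: contra nmBD => mCB.
  exact: meet_block_trans (meet_block_sym mCB) mCD.
have [c uc tbc] := compatible_lift sC nBC ux ub; exists c.
split=> //; first by rewrite okturn_sym.
by apply: okturn_meetN uc ud _; rewrite ux.
Qed.

End Words.

(** * Words of geodesics *)

Section RealizedWords.
Variables (V : finType) (C : eqType) (G : cgraph V C).
Hypotheses (cutG : geodesic_cut G) (regV : vertex_regular G)
  (regE : edge_regular G) (regT : triangle_counts_regular G)
  (disjG : disjoint_colors G).

Fixpoint word (u : V) (p : seq V) : seq C :=
  vcol G u :: (if p is v :: p' then ecol G [set u; v] :: word v p' else [::]).

Definition real (w : seq C) : Prop := exists u p, lgeo G u p /\ word u p = w.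

Lemma perm_word u p : perm_eq (word u p) (path_colors G u p).
Proof.
elim: p u => [|v p IHp] u //=; rewrite /path_colors /= perm_cons.
by rewrite perm_sym -cat_cons perm_catC cat_cons perm_cons perm_catC perm_sym.
Qed.

Lemma size_word u p : size (word u p) = (size p).*2.+1.
Proof. by elim: p u => //= v p IHp u; rewrite IHp doubleS. Qed.

Definition olast (T : Type) (s : seq T) : option T := last None (map Some s).

Lemma olast_rev (T : Type) (s : seq T) : olast (rev s) = ohead s.
Proof. by case: s => // x s; rewrite /olast rev_cons map_rcons last_rcons. Qed.

Lemma ohead_rev (T : Type) (s : seq T) : ohead (rev s) = olast s.
Proof. by rewrite -[s in RHS]revK olast_rev. Qed.

Definition hturn (p q : seq V) : bool := okturn G (ohead p) (ohead q).

Lemma lgeo_cons u v p : lgeo G u (v :: p) = [&& G u v, hturn [:: u] p & lgeo G v p].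
Proof. by case: p. Qed.

Lemma hturn_sym p q : hturn p q = hturn q p.
Proof. exact: okturn_sym. Qed.

Lemma hturn0 p : hturn p [::].
Proof. by case: p. Qed.

(** The induction moves the base point from [m] to the next vertex of [p], so [q] grows by one edge
    at each step. *)
Lemma join_arms m p q : lgeo G m p -> lgeo G m q -> hturn p q ->
  lgeo G (last m p) (rev (belast m p) ++ q) /\
  word (last m p) (rev (belast m p) ++ q) = rev (behead (word m p)) ++ word m q.
Proof.
elim: p m q => [|a p IHp] m q //; rewrite lgeo_cons => /and3P[ma tmp ap] mq taq.
have am : G a m by rewrite adj_sym.
have amq : lgeo G a (m :: q) by rewrite lgeo_cons am mq andbT; case: q mq taq.
have tp : hturn p (m :: q) by rewrite hturn_sym; case: (p) tmp.
have [geo wE] := IHp a (m :: q) ap amq tp.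
rewrite [last _ _]/= [belast _ _]/= rev_cons -cats1 -catA /=; split=> //.
rewrite wE /= [[set a; m]]setUC rev_cons.
have -> : word a p = vcol G a :: behead (word a p) by case: (p).
by rewrite /= rev_cons -!cats1 -!catA.
Qed.

Lemma word_cons u p : word u p = vcol G u :: behead (word u p).
Proof. by case: p. Qed.

Lemma reverse_path u p : lgeo G u p ->
  lgeo G (last u p) (rev (belast u p)) /\
  word (last u p) (rev (belast u p)) = rev (word u p).
Proof.
move=> up; have [] := join_arms (q := [::]) up isT (hturn0 p).
by rewrite cats0 => -> ->; rewrite [in RHS]word_cons rev_cons cats1.
Qed.

Lemma real_rev w : real w -> real (rev w).
Proof.
case=> u [p [up <-]]; have [? ?] := reverse_path up.
by exists (last u p), (rev (belast u p)).
Qed.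

Lemma lgeo_cat u p q : lgeo G u (p ++ q) ->
  [/\ lgeo G u p, lgeo G (last u p) q & hturn (rev (belast u p)) q].
Proof.
elim: p u => [|a p IHp] u; first by rewrite /hturn /okturn.
rewrite cat_cons lgeo_cons => /and3P[ua tp /IHp[ap pq hpq]]; split=> //.
  by rewrite lgeo_cons ua ap andbT; case: (p) tp.
rewrite [belast _ _]/= rev_cons; case: p hpq tp {IHp ap pq} => [|b p] //=.
by rewrite rev_cons; case: (rev _).
Qed.

(** By disjointness of vertex and edge colors, the letter [x] sits at a vertex, where the path can
    be cut. *)
Lemma word_split u p w1 x w2 : is_vcol G x -> lgeo G u p -> word u p = w1 ++ x :: w2 ->
  exists p1 p2, [/\ p = p1 ++ p2, word u p1 = rcons w1 x & word (last u p1) p2 = x :: w2].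
Proof.
move=> vx; elim: p u w1 => [|a p IHp] u w1.
  case: w1 => [|y w1] _ /=; last by case: w1.
  by case=> <- <-; exists [::], [::].
rewrite lgeo_cons => /and3P[ua _ ap] /=; case: w1 => [|y w1] /=.
  by case=> <- <-; exists [::], (a :: p).
case=> <-; case: w1 => [|z w1] /=.
  case=> cx _; have := ecol_not_vcol disjG ua.
  by rewrite cx vx.
case=> <- /(IHp _ _ ap)[p1 [p2 [-> w1E w2E]]].
by exists (a :: p1), p2; rewrite /= w1E.
Qed.

Lemma real_split w1 x w2 : is_vcol G x -> real (w1 ++ x :: w2) ->
  exists m p q, [/\ vcol G m = x, word m p = x :: rev w1 & word m q = x :: w2] /\
    [/\ lgeo G m p, lgeo G m q & hturn p q].
Proof.
move=> vx [u [r [ur rE]]]; have [p1 [p2 [rE' w1E w2E]]] := word_split vx ur rE.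
rewrite rE' in ur; have [up1 mp2 tp] := lgeo_cat ur.
have [mp1 w1E'] := reverse_path up1.
exists (last u p1), (rev (belast u p1)), p2; split; split=> //.
  by have := w2E; rewrite word_cons => -[].
by rewrite w1E' w1E rev_rcons.
Qed.

Lemma real_join m p q w1 x w2 : vcol G m = x ->
  word m p = x :: rev w1 -> word m q = x :: w2 ->
  lgeo G m p -> lgeo G m q -> hturn p q -> real (w1 ++ x :: w2).
Proof.
move=> mx pE qE mp mq tpq; have [geo wE] := join_arms mp mq tpq.
exists (last m p), (rev (belast m p) ++ q); split=> //.
by rewrite wE pE qE /= revK.
Qed.

Lemma arm_stub m p x w : lgeo G m p -> word m p = x :: w -> is_stub G m (ohead p) (ohead w).
Proof.
case: p => [|a p]; first by move=> _ [_ <-].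
by rewrite lgeo_cons => /and3P[ma _ _] [_ <-] /=; rewrite ma eqxx.
Qed.

(** Transports a geodesic vertex by vertex: [diff_lift] supplies the next edge of the right color
    outside the block of the edge just traversed. *)
Lemma lift_arm u a q u' b : lgeo G u (a :: q) -> vcol G u' = vcol G u ->
  G u' b -> ecol G [set u'; b] = ecol G [set u; a] ->
  exists2 q', lgeo G u' (b :: q') & word u' (b :: q') = word u (a :: q).
Proof.
elim: q u a u' b => [|c q IHq] u a u' b; rewrite lgeo_cons => /and3P[ua tq aq] uu' ub' cE.
  by exists [::]; rewrite /= ?ub' // uu' cE (nbr_color regE ub' ua uu' cE).
have ba : vcol G b = vcol G a := nbr_color regE ub' ua uu' cE.
have au : G a u by rewrite adj_sym.
have bu' : G b u' by rewrite adj_sym.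
have ac : G a c by case/andP: aq.
have diff : diff_block G (vcol G a) (Some (ecol G [set a; u])) (Some (ecol G [set a; c])).
  apply/existsP; exists a; apply/existsP; exists u; apply/existsP; exists c.
  by rewrite /= au ac !eqxx /= -(turn_okE au ac).
have su' : is_stub G b (Some u') (Some (ecol G [set a; u])).
  by rewrite /= bu' [[set b; u']]setUC cE [[set u; a]]setUC eqxx.
have [c' /andP[bc' /eqP cE'] nbl] := diff_lift cutG regV regE regT diff ba su'.
have [q' bq' wE] := IHq a c b c' aq ba bc' cE'.
exists (c' :: q').
  by rewrite lgeo_cons ub' bq' andbT /hturn /okturn /= (turn_okE bu' bc').
by rewrite [LHS]/= -/(word b (c' :: q')) wE uu' cE.
Qed.

Lemma lift_arm_stub m p m' o x w : lgeo G m p -> word m p = x :: w ->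
  vcol G m' = x -> is_stub G m' o (ohead w) ->
  exists p', [/\ lgeo G m' p', word m' p' = x :: w & ohead p' = o].
Proof.
case: p => [|a p] mp /= [mx <-] m'x.
  by case: o => // _; exists [::]; rewrite /= m'x.
case: o => // b /andP[mb /eqP cE].
have [q mq wE] := lift_arm mp (etrans m'x (esym mx)) mb cE.
by exists (b :: q); rewrite wE /= mx.
Qed.

Lemma vcol_has_stub m p x w : lgeo G m p -> word m p = x :: w -> has_stub G x (ohead w).
Proof.
case: w => // c w mp pE; have := arm_stub mp pE; case: p mp pE => // a p mp [mx _ _] st.
by apply/existsP; exists m; apply/existsP; exists a; rewrite mx eqxx.
Qed.

Lemma real_compatible w1 x w2 : is_vcol G x -> real (w1 ++ x :: w2) ->
  ~~ incompatible G x (olast w1) (ohead w2).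
Proof.
move=> vx /(real_split vx)[m [p [q [[mx pE qE] [mp mq tpq]]]]].
have := okturnN (arm_stub mp pE) (arm_stub mq qE) tpq.
by rewrite mx ohead_rev.
Qed.

(** Whether two realized arms fit together at [x] depends only on the letters next to [x]; the
    second arm is transported to the base point of the first. *)
Lemma real_recombine w1 x w2 w3 w4 : is_vcol G x ->
  real (w1 ++ x :: w2) -> real (w3 ++ x :: w4) ->
  ~~ incompatible G x (olast w1) (ohead w4) -> real (w1 ++ x :: w4).
Proof.
move=> vx /(real_split vx)[m [p [_ [[mx pE _] [mp _ _]]]]].
move=> /(real_split vx)[m' [_ [q [[mx' _ qE] [_ mq _]]]]] comp.
have sq := vcol_has_stub mq qE.
have sp := arm_stub mp pE; rewrite ohead_rev in sp.
have [o so tpo] := compatible_lift cutG regV regE regT sq comp mx sp.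
have [q' [mq' qE' oE]] := lift_arm_stub mq qE mx so.
apply: (real_join mx pE qE' mp mq').
by rewrite /hturn oE.
Qed.

Definition four_arms w1 x w2 w3 w4 := exists m a b c d,
  [/\ vcol G m = x, lgeo G m a, lgeo G m b, lgeo G m c & lgeo G m d] /\
  [/\ word m a = x :: rev w1, word m b = x :: w2,
      word m c = x :: rev w3 & word m d = x :: w4] /\
  [/\ hturn a b, hturn c d, hturn a d & hturn c b].

(** All four arms are realized at one vertex, so that exchanging two of them keeps the multiset of
    edges and becomes a quadratic binomial. *)
Lemma real_four_arms w1 x w2 w3 w4 : is_vcol G x ->
  real (w1 ++ x :: w2) -> real (w3 ++ x :: w4) ->
  ~~ incompatible G x (olast w1) (ohead w4) ->
  ~~ incompatible G x (olast w3) (ohead w2) -> four_arms w1 x w2 w3 w4.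
Proof.
move=> vx r12 r34 n14 n32.
have n12 := real_compatible vx r12; have n34 := real_compatible vx r34.
have [m [p [q [[mx pE qE] [mp mq tpq]]]]] := real_split vx r12.
have [m' [p' [q' [[mx' pE' qE'] [mp' mq' tpq']]]]] := real_split vx r34.
have [a [b [c [d [[sa sb sc sd] [tab tcd tad tcb]]]]]] :=
  four_stubs cutG regV regE regT mx (vcol_has_stub mp pE) (vcol_has_stub mq qE)
    (vcol_has_stub mp' pE') (vcol_has_stub mq' qE')
    (etrans (congr1 (fun k => ~~ incompatible G x k _) (ohead_rev w1)) n12)
    (etrans (congr1 (fun k => ~~ incompatible G x k _) (ohead_rev w3)) n34)
    (etrans (congr1 (fun k => ~~ incompatible G x k _) (ohead_rev w1)) n14)
    (etrans (congr1 (fun k => ~~ incompatible G x k _) (ohead_rev w3)) n32).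
have [pa [ma aE oa]] := lift_arm_stub mp pE mx sa.
have [pb [mb bE ob]] := lift_arm_stub mq qE mx sb.
have [pc [mc cE oc]] := lift_arm_stub mp' pE' mx sc.
have [pd [md dE od]] := lift_arm_stub mq' qE' mx sd.
by exists m, pa, pb, pc, pd; split=> //; split=> //; rewrite /hturn oa ob oc od.
Qed.

Lemma real_word_size w : real w -> (size w <= #|V|.*2)%N.
Proof.
case=> u [p [up <-]]; rewrite size_word.
have [uniqp _] := lgeo_sep_uniq cutG up.
have := card_uniqP uniqp; rewrite /= => cE.
have : (#|u :: p| <= #|V|)%N by exact: max_card.
by rewrite cE -leq_double doubleS; apply: leq_trans.
Qed.

Lemma real_suffix w1 x w2 : is_vcol G x -> real (w1 ++ x :: w2) -> real (x :: w2).
Proof.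
move=> vx /(real_split vx)[m [_ [q [[_ _ qE] [_ mq _]]]]].
by exists m, q.
Qed.

Lemma real_prefix w1 x w2 : is_vcol G x -> real (w1 ++ x :: w2) -> real (w1 ++ [:: x]).
Proof.
move=> vx /real_rev; rewrite rev_cat rev_cons cat_rcons => /(real_suffix vx) /real_rev.
by rewrite rev_cons revK cats1.
Qed.

Lemma real_next w1 x y w2 : is_vcol G x -> real (w1 ++ x :: y :: w2) ->
  exists u v w3, [/\ G u v, vcol G u = x, ecol G [set u; v] = y & w2 = vcol G v :: w3].
Proof.
move=> vx /(real_split vx)[m [_ [[|a q] [[mx _ //= qE] [_ mq _]]]]].
have [_ cE wE] := qE; exists m, a, (behead (word a q)).
by split=> //; [case/andP: mq | rewrite -wE; exact: word_cons].
Qed.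

(* A closed word could be traversed again and again, giving geodesics longer
   than the number of vertices. *)
Lemma no_closed_word x m1 : is_vcol G x -> real (x :: m1 ++ [:: x]) ->
  incompatible G x (ohead m1) (olast m1).
Proof.
move=> vx rw; have [y [m2 m1E]] : exists y m2, m1 = y :: m2.
  case: m1 rw => [|y m2] rw; last by exists y, m2.
  have [u [v [_ [uv _ cE _]]]] := @real_next [::] x x [::] vx rw.
  by have := ecol_not_vcol disjG uv; rewrite cE vx.
rewrite incompatible_sym; apply/negPn/negP => comp.
have loop n : exists w, [/\ real (w ++ [:: x]), (n <= size w)%N & olast w = olast m1].
  elim: n => [|n [w [rw' sw lw]]].
    by exists (x :: m1); split; rewrite // m1E.
  exists (w ++ x :: m1); split.
  - rewrite -catA /=; apply: (@real_recombine _ _ [::] [::]) => //.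
    by rewrite lw; move: comp; rewrite m1E.
  - by rewrite size_cat /=; lia.
  by rewrite /olast map_cat last_cat /= m1E.
have [w [/real_word_size + le _]] := loop (#|V|.*2).
by rewrite size_cat /= addn1 ltnNge le.
Qed.

End RealizedWords.

(** * Equivalence of words *)

Lemma third_arith (a b m n : nat) :
  (a <= 2 * m -> 2 * n <= b -> a = b -> 1 + m = n -> False)%N.
Proof. lia. Qed.

Lemma perm_exchange (T : eqType) (a b c d : T) (A2 L A W U : seq T) :
  perm_eq U ((L ++ [:: a; b] ++ A2) ++ W) ->
  perm_eq (a :: b :: A2 ++ (L ++ [:: c; d] ++ A) ++ W) (d :: c :: A ++ U).
Proof.
move=> pU; apply/permP => f; have := permP pU f.
by rewrite /= !count_cat /= ?count_cat /=; lia.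
Qed.

Lemma perm_reverse_loop (T : eqType) (a b c d : T) (O O' R2 U : seq T) :
  perm_eq O' O ->
  perm_eq (a :: b :: (O' ++ [:: c; d] ++ R2) ++ U) (c :: d :: (O ++ [:: b; a] ++ R2) ++ U).
Proof.
move=> pO; apply/permP => f; have := permP pO f.
by rewrite /= !count_cat /= ?count_cat /=; lia.
Qed.

Section ThirdPair.
Variables (K : eqType) (inc : rel K).
Hypotheses (inc_sym : ssrbool.symmetric inc) (inc_trans : transitive inc).

Lemma count_fst_class (R : seq (K * K)) (P : pred K) :
  perm_eq (map fst R) (map snd R) ->
  (\sum_(kl <- R) (P kl.1 + P kl.2) = 2 * count P (map fst R))%N.
Proof.
move=> symR; rewrite big_split /= mul2n -addnn; congr (_ + _)%N.
  rewrite count_map -sum1_count [RHS]big_mkcond; apply: eq_bigr => kl _ /=.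
  by case: (P kl.1).
rewrite (permP symR) count_map -sum1_count [RHS]big_mkcond; apply: eq_bigr => kl _ /=.
by case: (P kl.2).
Qed.

(* If the only pairs containing [beta] have a partner [bs] incompatible with
   [alphas], then by counting stubs incompatible with [bs] some pair contains
   none of these. *)
Lemma third_pair (R1 R2 : seq (K * K)) alpha alphas beta :
  perm_eq (map fst R1) (map snd R1) -> perm_eq (map fst R2) (map snd R2) ->
  (forall k l, (k, l) \in R1 -> (l, k) \in R1) ->
  (forall k l, (k, l) \in R1 -> ~~ inc k l) ->
  (forall k l, (k, l) \in R2 -> ~~ inc k l) ->
  ~~ inc alpha alphas -> ~~ inc alpha beta -> alphas != beta ->
  perm_eq (alphas :: map fst R1) (beta :: map fst R2) ->
  exists bs, (bs, beta) \in R1 /\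
    (~~ inc alphas bs \/
     exists g d, [/\ (d, g) \in R1, ~~ inc alpha g, ~~ inc alphas d,
       ~~ inc g bs & (bs, beta) \notin [:: (d, g); (g, d)]]).
Proof.
move=> s1 s2 symR1 c1 c2 caas cab neq pE.
have : beta \in map fst R1.
  have := perm_mem pE beta; rewrite !inE eqxx /= eq_sym (negPf neq) /=.
  by move=> ->.
case/mapP=> -[b bs] /symR1 bR /= bE; rewrite -bE in bR; exists bs; split=> //.
have [inc_ab|] := boolP (inc alphas bs); [right|by left].
have inc_ba : inc bs alphas by rewrite inc_sym.
have inc_bb : inc bs bs := inc_trans inc_ba inc_ab.
pose tau k := inc k bs.
have [/hasP[[g d] gd /= /andP[ng nd]]|] :=
    boolP (has (fun kl => ~~ tau kl.1 && ~~ tau kl.2) R1).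
  have fin g' d' : (g', d') \in R1 -> ~~ tau g' -> ~~ tau d' -> ~~ inc alpha g' ->
      exists g d, [/\ (d, g) \in R1, ~~ inc alpha g, ~~ inc alphas d,
       ~~ inc g bs & (bs, beta) \notin [:: (d, g); (g, d)]].
    move=> gd' ng' nd' cag; exists g', d'; split=> //; first exact: symR1.
      by apply: contra nd'; rewrite inc_sym => /inc_trans; apply.
    rewrite !inE !xpair_eqE !negb_or; apply/andP; split; apply/negP.
      by case/andP=> /eqP E _; rewrite /tau -E inc_bb in nd'.
    by case/andP=> /eqP E _; rewrite /tau -E inc_bb in ng'.
  have [ag|] := boolP (inc alpha g); last exact: (fin g d gd ng nd).
  apply: (fin d g (symR1 _ _ gd) nd ng).
  apply: contra (c1 _ _ gd) => ad; apply: inc_trans ad.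
  by rewrite inc_sym.
(* Otherwise every pair of [R1] has a stub incompatible with [bs], while no pair of [R2] has two.
   But [alphas] is such a stub and [beta] is not, so [R2] contains one more of them than [R1], in
   equally many pairs. *)
rewrite -all_predC => /allP all1; exfalso.
have le1 : (size R1 <= 2 * count tau (map fst R1))%N.
  rewrite -count_fst_class // -sum1_size big_seq [X in (_ <= X)%N]big_seq.
  apply: leq_sum => kl /all1; rewrite /= negb_and !negbK.
  by case: (tau kl.1); case: (tau kl.2).
have le2 : (2 * count tau (map fst R2) <= size R2)%N.
  rewrite -count_fst_class // -sum1_size big_seq [X in (_ <= X)%N]big_seq.
  apply: leq_sum => -[k l] /c2 /= nkl.
  have : ~~ (tau k && tau l).
    by apply: contra nkl => /andP[kb lb]; apply: inc_trans kb _; rewrite inc_sym.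
  by case: (tau k); case: (tau l).
have := permP pE tau; have := perm_size pE; rewrite /= !size_map => -[szE].
have -> : tau alphas by [].
have -> : tau beta = false by apply: contraNF (c1 _ _ bR); rewrite /tau inc_sym.
by rewrite add0n => cntE; exact: third_arith le1 le2 szE cntE.
Qed.

End ThirdPair.

Lemma olast_cat (T : eqType) (s1 : seq T) y s2 : s2 != [::] ->
  olast (s1 ++ y :: s2) = olast s2.
Proof. by case: s2 => // z s2 _; rewrite /olast map_cat last_cat. Qed.

Section Occurrences.
Variables (C : eqType) (x : C).

(* Pairs of stubs at the letters [x] of a word, in both orders; [p] and [n] are
   the letters before and after the word. *)
Fixpoint occs (p : option C) (w : seq C) (n : option C) : seq (option C * option C) :=
  if w is y :: t then
    (if y == x then [:: (p, head n (map Some t)); (head n (map Some t), p)] else [::])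
    ++ occs (Some y) t n
  else [::].

Lemma occs_cat p w1 w2 n : occs p (w1 ++ w2) n =
  occs p w1 (head n (map Some w2)) ++ occs (last p (map Some w1)) w2 n.
Proof.
elim: w1 p => [|y t IHw] p //=; rewrite IHw -!catA; congr (_ ++ (_ ++ _)).
by case: t {IHw}.
Qed.

Lemma head_ohead (T : Type) (s : seq T) : head None (map Some s) = ohead s.
Proof. by case: s. Qed.

Lemma occs_split w1 w2 : occs None (w1 ++ x :: w2) None =
  occs None w1 (Some x) ++ [:: (olast w1, ohead w2); (ohead w2, olast w1)] ++
  occs (Some x) w2 None.
Proof. by rewrite occs_cat /= eqxx head_ohead. Qed.

Lemma occs_rev p w n : perm_eq (occs p (rev w) n) (occs n w p).
Proof.
elim: w p n => [|y t IHw] p n //; rewrite rev_cons -cats1 occs_cat /= cats0 perm_catC.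
apply: perm_cat; last exact: IHw.
have -> : last p (map Some (rev t)) = head p (map Some t).
  by case: t {IHw} => [|z t] //=; rewrite rev_cons map_rcons last_rcons.
by case: (y == x) => //; apply/permP => a /=; rewrite addnCA.
Qed.

Lemma occs_sym p w n k l : (k, l) \in occs p w n -> (l, k) \in occs p w n.
Proof.
elim: w p => [|y t IHw] p //=; rewrite !mem_cat => /orP[|/IHw ->]; last by rewrite orbT.
case: (y == x) => //; rewrite !inE !xpair_eqE => /orP[] /andP[/eqP-> /eqP->];
  by rewrite !eqxx ?orbT.
Qed.

Lemma occs_fst_snd p w n : perm_eq (map fst (occs p w n)) (map snd (occs p w n)).
Proof.
elim: w p => [|y t IHw] p //=; rewrite !map_cat perm_cat //.
by case: (y == x) => //=; apply/permP => a /=; rewrite addnCA.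
Qed.

Lemma occsP p w n k l : (k, l) \in occs p w n -> exists w1 w2, w = w1 ++ x :: w2 /\
  let ends := (last p (map Some w1), head n (map Some w2)) in
  ((k, l) = ends \/ (l, k) = ends).
Proof.
elim: w p => [|y t IHw] p //=; rewrite mem_cat => /orP[|/IHw[w1 [w2 [-> E]]]].
  case: eqP => // ->; rewrite !inE => /orP[] /eqP[-> ->];
    exists [::], t; split=> //=; by [left|right].
by exists (y :: w1), w2.
Qed.

End Occurrences.

(** * Exchange of arms for an abstract congruence [cg] of generators [sw w] *)

Section WordEquivalence.
Variables (V : finType) (C : eqType) (G : cgraph V C).
Hypotheses (cutG : geodesic_cut G) (regV : vertex_regular G)
  (regE : edge_regular G) (regT : triangle_counts_regular G)
  (disjG : disjoint_colors G).
Variables (T : comNzRingType) (sw : seq C -> T) (cg : T -> T -> Prop).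
Hypotheses (cg_refl : forall a, cg a a) (cg_sym : forall a b, cg a b -> cg b a)
  (cg_trans : forall a b c, cg a b -> cg b c -> cg a c)
  (cg_mul : forall a b c d, cg a b -> cg c d -> cg (a * c) (b * d)).
Local Notation real := (real G).
Local Notation inc := (incompatible G).
Hypothesis sw_perm : forall w w', real w -> real w' -> perm_eq w w' -> cg (sw w) (sw w').
Hypothesis sw_swap : forall x w1 w2 w3 w4, is_vcol G x ->
  real (w1 ++ x :: w2) -> real (w3 ++ x :: w4) ->
  ~~ inc x (olast w1) (ohead w4) -> ~~ inc x (olast w3) (ohead w2) ->
  cg (sw (w1 ++ x :: w2) * sw (w3 ++ x :: w4)) (sw (w1 ++ x :: w4) * sw (w3 ++ x :: w2)).

Definition all_real (ws : seq (seq C)) : Prop := forall w, w \in ws -> real w.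

Definition eqv (ws ws' : seq (seq C)) : Prop :=
  [/\ all_real ws', perm_eq (flatten ws) (flatten ws') &
      cg (\prod_(w <- ws) sw w) (\prod_(w <- ws') sw w)].

Lemma all_real_cons w ws : all_real (w :: ws) <-> real w /\ all_real ws.
Proof.
split=> [rws|[rw rws] v]; last by rewrite inE => /orP[/eqP-> //|/rws].
by split=> [|v v_in]; apply: rws; rewrite inE ?eqxx // v_in orbT.
Qed.

Lemma eqv_refl ws : all_real ws -> eqv ws ws.
Proof. by split. Qed.

Lemma eqv_trans ws1 ws2 ws3 : eqv ws1 ws2 -> eqv ws2 ws3 -> eqv ws1 ws3.
Proof.
move=> [_ p12 c12] [r3 p23 c23]; split=> //; first exact: perm_trans p12 p23.
exact: cg_trans c12 c23.
Qed.

Lemma eqv_perm ws ws' : all_real ws -> perm_eq ws ws' -> eqv ws ws'.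
Proof.
move=> rws p; split; first by move=> w; rewrite -(perm_mem p); apply: rws.
  exact: perm_flatten.
by rewrite (perm_big _ p); apply: cg_refl.
Qed.

Lemma eqv_word w w' ws : all_real (w :: ws) -> real w' -> perm_eq w w' ->
  eqv (w :: ws) (w' :: ws).
Proof.
move=> /all_real_cons[rw rws] rw' p; split; first exact/all_real_cons.
  by rewrite /= perm_cat2r.
by rewrite !big_cons; apply: cg_mul => //; apply: sw_perm.
Qed.

Lemma eqv_swap x w1 w2 w3 w4 ws : is_vcol G x ->
  all_real ((w1 ++ x :: w2) :: (w3 ++ x :: w4) :: ws) ->
  ~~ inc x (olast w1) (ohead w4) -> ~~ inc x (olast w3) (ohead w2) ->
  eqv ((w1 ++ x :: w2) :: (w3 ++ x :: w4) :: ws)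
      ((w1 ++ x :: w4) :: (w3 ++ x :: w2) :: ws).
Proof.
move=> vx /all_real_cons[r12 /all_real_cons[r34 rws]] c14 c32; split.
- have recomb := real_recombine cutG regV regE regT disjG vx.
  by apply/all_real_cons; split; [|apply/all_real_cons; split] => //;
    [apply: recomb r12 r34 c14 | apply: recomb r34 r12 c32].
- apply/permP=> a; rewrite /= !count_cat /=; lia.
- rewrite !big_cons !mulrA; apply: cg_mul => //; exact: sw_swap.
Qed.

Definition all_occs (x : C) (ws : seq (seq C)) :=
  flatten [seq occs x None w None | w <- ws].

Lemma perm_all_occs x ws ws' : perm_eq ws ws' -> perm_eq (all_occs x ws) (all_occs x ws').
Proof. by move=> p; apply/perm_flatten/perm_map. Qed.

(** The pairs of stubs still free to be changed: those in the first word behind its prefix ending in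
    [x], and those in the other words. *)
Definition tail_occs x p2 ws := occs x (Some x) p2 None ++ all_occs x ws.

(* Repairing the stubs at [x]: a pair [(k, l)] gives its stub [l] to the first
   word and takes the stub there in exchange. *)
Lemma repair_step x q1 p2 ws k l : is_vcol G x ->
  all_real ((q1 ++ x :: p2) :: ws) -> (k, l) \in tail_occs x p2 ws ->
  ~~ inc x (olast q1) l -> ~~ inc x (ohead p2) k ->
  exists p2' ws', [/\ eqv ((q1 ++ x :: p2) :: ws) ((q1 ++ x :: p2') :: ws'),
    ohead p2' = l &
    perm_eq ((k, l) :: (l, k) :: tail_occs x p2' ws')
      ((ohead p2, k) :: (k, ohead p2) :: tail_occs x p2 ws)].
Proof.
move=> vx rws; have /all_real_cons[rp _] := rws.
have recomb := real_recombine cutG regV regE regT disjG vx.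
rewrite mem_cat => /orP[|/flattenP[_ /mapP[w w_in ->]]] /occsP[w1 [w2 [wE E]]] cl ck; last first.
  (* The pair lies in another word, which is reversed if necessary so that [l] follows [x]; then the
     tails are exchanged. *)
  have {E} [w1' [w2' [pw kE lE]]] : exists w1' w2',
      [/\ w = w1' ++ x :: w2' \/ rev w = w1' ++ x :: w2', olast w1' = k & ohead w2' = l].
    case: E => -[E1 E2]; rewrite ?E1 ?E2 ?head_ohead.
      by exists w1, w2; split; [left| |].
    exists (rev w2), (rev w1); split; [right| |]; rewrite ?olast_rev ?ohead_rev //.
    by rewrite wE rev_cat rev_cons cat_rcons.
  have rw : real w by apply: rws; rewrite inE w_in orbT.
  have rw' : real (w1' ++ x :: w2').
    by case: pw => <- //; apply: real_rev.
  have pw' : perm_eq w (w1' ++ x :: w2').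
    by case: pw => <-; rewrite // perm_sym perm_rev.
  have po : perm_eq (occs x None w None) (occs x None (w1' ++ x :: w2') None).
    by case: pw => <- //; rewrite perm_sym occs_rev.
  have pws := perm_to_rem w_in; set wr := rem w ws in pws.
  exists w2', ((w1' ++ x :: p2) :: wr); split=> //.
    have e1 : eqv ((q1 ++ x :: p2) :: ws) (w :: (q1 ++ x :: p2) :: wr).
      apply: eqv_perm => //; rewrite -[w :: _]cat1s -[_ :: wr]cat1s perm_sym perm_catCA.
      by rewrite perm_cons perm_sym.
    have [r1 _ _] := e1.
    have e2 := eqv_word r1 rw' pw'; have [r2 _ _] := e2.
    apply: eqv_trans e1 (eqv_trans e2 _).
    have e3 : eqv ((w1' ++ x :: w2') :: (q1 ++ x :: p2) :: wr)
        ((q1 ++ x :: p2) :: (w1' ++ x :: w2') :: wr).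
      by apply: eqv_perm => //; apply/permP=> a /=; rewrite addnCA.
    have [r3 _ _] := e3; apply: eqv_trans e3 (eqv_swap vx r3 _ _).
      by rewrite lE.
    by rewrite kE incompatible_sym.
  have pocc : perm_eq (all_occs x ws) (occs x None (w1' ++ x :: w2') None ++ all_occs x wr).
    apply: perm_trans (perm_all_occs x pws) _.
    by rewrite /all_occs /= perm_cat2r.
  have -> : tail_occs x w2' ((w1' ++ x :: p2) :: wr) =
      occs x (Some x) w2' None ++ occs x None (w1' ++ x :: p2) None ++ all_occs x wr by [].
  rewrite occs_split kE; rewrite occs_split kE lE in pocc.
  exact: perm_exchange.
(* The pair lies in [p2] itself, so [w1] stands between two letters [x] and its end letters are
   incompatible by [no_closed_word]. This forces [l] to be the last letter of [w1], and reversing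
   [w1] brings it to the front. *)
have loop : inc x (ohead w1) (olast w1).
  apply: (no_closed_word cutG regV regE regT disjG vx).
  move: rp; rewrite wE => /(real_suffix disjG vx); rewrite -cat_cons.
  exact: real_prefix.
have w1n : w1 != [::] by case: (w1) loop => //; rewrite /incompatible.
have hp2 : ohead p2 = ohead w1 by rewrite wE; case: (w1) w1n.
have lw1 : last (Some x) (map Some w1) = olast w1 by case: (w1) w1n.
rewrite lw1 head_ohead in E.
have {E} [kE lE] : ohead w2 = k /\ olast w1 = l.
  case: E => -[E1 E2]; first by rewrite hp2 E1 loop in ck.
  by split.
exists (rev w1 ++ x :: w2), ws; split.
- apply: eqv_word => //; last first.
    by rewrite wE perm_cat2l perm_cons perm_cat2r perm_sym perm_rev.
  have rx : real (q1 ++ x :: (rev w1 ++ [:: x])).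
    have r1 : real ((q1 ++ x :: w1) ++ x :: w2) by rewrite -catA /= -wE.
    have r2 := real_prefix disjG vx r1.
    have r3 : real ([::] ++ x :: (rev w1 ++ [:: x])).
      have revE : rev (x :: w1 ++ [:: x]) = x :: rev w1 ++ [:: x].
        by rewrite rev_cons rev_cat /= cats1.
      rewrite /= -revE; apply: real_rev; apply: (real_suffix disjG vx (w1 := q1)).
      by move: r2; rewrite -catA.
    apply: recomb rp r3 _.
    suff -> : ohead (rev w1 ++ [:: x]) = l by [].
    by rewrite -lE -ohead_rev; case: (rev w1) (size_rev w1) => //; case: (w1) w1n.
  have rx' : real ((q1 ++ x :: rev w1) ++ [:: x]) by rewrite -catA.
  have rp' : real ((q1 ++ x :: w1) ++ x :: w2) by rewrite -catA /= -wE.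
  have := recomb _ _ _ _ rx' rp'; rewrite -catA /=; apply.
  rewrite olast_cat ?olast_rev -?hp2 ?kE //.
  by rewrite -size_eq0 size_rev size_eq0.
- by rewrite -lE -ohead_rev; case: (rev w1) (size_rev w1) => //; case: (w1) w1n.
rewrite /tail_occs [in occs x (Some x) p2 None]wE !occs_cat /= !eqxx lw1 !head_ohead.
have -> : last (Some x) (map Some (rev w1)) = ohead p2.
  by rewrite hp2 -olast_rev; case/lastP: (w1) w1n => // s y _; rewrite rev_rcons.
rewrite lE kE; apply: perm_reverse_loop; exact: occs_rev.
Qed.

Lemma tail_occs_compatible x q1 p2 ws k l : is_vcol G x ->
  all_real ((q1 ++ x :: p2) :: ws) -> (k, l) \in tail_occs x p2 ws -> ~~ inc x k l.
Proof.
move=> vx /all_real_cons[rp rws].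
have occ_real w k' l' : real w -> (k', l') \in occs x None w None -> ~~ inc x k' l'.
  move=> rw /occsP[w1 [w2 [wE E]]]; rewrite wE in rw.
  have := real_compatible disjG vx rw; rewrite head_ohead in E.
  by case: E => -[-> ->] //; rewrite incompatible_sym.
rewrite mem_cat => /orP[kl|/flattenP[_ /mapP[w /rws rw ->]]]; last exact: occ_real.
by apply: (occ_real _ _ _ rp); rewrite occs_split !mem_cat kl !orbT.
Qed.

(** The number of ends of color [x] of an edge of color [c], independent of the edge by edge
    regularity; 0 if no edge has color [c]. *)
Definition edge_ends (x c : C) : nat :=
  if [pick uv : V * V | G uv.1 uv.2 && (ecol G [set uv.1; uv.2] == c)] is Some uv
  then (vcol G uv.1 == x) + (vcol G uv.2 == x) else 0.

Lemma edge_endsE x u v : G u v ->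
  edge_ends x (ecol G [set u; v]) = ((vcol G u == x) + (vcol G v == x))%N.
Proof.
move=> uv; rewrite /edge_ends; case: pickP => [[a b] /= /andP[ab /eqP cE]|/(_ (u, v))].
  have /edge_regularP/(_ _ _ _ _ ab uv cE)/perm2P[] := regE => -[-> ->] //.
  exact: addnC.
by rewrite /= uv eqxx.
Qed.

Lemma edge_ends_vcol x c : is_vcol G c -> edge_ends x c = 0%N.
Proof.
move=> vc; rewrite /edge_ends; case: pickP => // -[a b] /= /andP[ab /eqP cE].
by have := ecol_not_vcol disjG ab; rewrite cE vc.
Qed.

Lemma occs_word x q u v p : is_vcol G x -> G u v ->
  occs x q (word G u (v :: p)) None =
  (if vcol G u == x then [:: (q, Some (ecol G [set u; v])); (Some (ecol G [set u; v]), q)]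
   else [::]) ++ occs x (Some (ecol G [set u; v])) (word G v p) None.
Proof.
move=> vx uv /=; case: (ecol G [set u; v] =P x) => // cx.
by have := ecol_not_vcol disjG uv; rewrite cx vx.
Qed.

(** Each edge of color [c] contributes one stub at each of its ends of color [x]; the first summand
    accounts for the letter [q] before the word. *)
Lemma count_edge_stubs x c q u p : is_vcol G x -> lgeo G u p ->
  count_mem (Some c) (map fst (occs x q (word G u p) None)) =
  (((q == Some c) && (vcol G u == x)) + edge_ends x c * count_mem c (word G u p))%N.
Proof.
move=> vx; elim: p u q => [|v p IHp] u q.
  move=> _ /=; have [ux|ux] := eqVneq (vcol G u) x; rewrite /= ?andbT ?andbF !addn0;
  by have [<-|_] := eqVneq (vcol G u) c; rewrite ?muln0 ?addn0 // muln1 edge_ends_vcol ?addn0 //;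
    exact: is_vcolP.
rewrite lgeo_cons => /and3P[uv _ vp]; rewrite occs_word // map_cat count_cat IHp //.
rewrite [word G u _]/= -/(word G v p) /=.
have zero : (edge_ends x c * (vcol G u == c) = 0)%N.
  by case: eqP => [<-|_]; rewrite ?muln0 // edge_ends_vcol // is_vcolP.
rewrite !mulnDr zero add0n.
have eE : (edge_ends x c * (ecol G [set u; v] == c) =
   ((vcol G u == x) && (ecol G [set u; v] == c)) + ((ecol G [set u; v] == c) && (vcol G v == x)))%N.
  case: eqP => [<-|_]; last by rewrite muln0 andbF.
  by rewrite edge_endsE // muln1 andbT.
rewrite eE; case: (vcol G u == x) => /=; rewrite ?andbT ?andbF ?addn0 ?add0n //.
by rewrite -[Some _ == Some c]/(ecol G [set u; v] == c) !addnA.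
Qed.

(** Every letter [x] has two stubs, each of which is either an end of the path or belongs to an
    edge. *)
Lemma count_end_stubs x q u p : is_vcol G x -> lgeo G u p ->
  (count_mem None (map fst (occs x q (word G u p) None))
   + \sum_(c <- word G u p) edge_ends x c + ((vcol G u == x) && (q != None)) =
  2 * count_mem x (word G u p))%N.
Proof.
move=> vx; elim: p u q => [|v p IHp] u q.
  move=> _ /=; rewrite big_seq1 edge_ends_vcol ?is_vcolP //.
  by case: (vcol G u == x) => //=; case: q.
rewrite lgeo_cons => /and3P[uv _ vp]; rewrite occs_word // map_cat count_cat.
have := IHp v (Some (ecol G [set u; v])) vp; rewrite [word G u _]/= -/(word G v p).
rewrite !big_cons edge_endsE // edge_ends_vcol ?is_vcolP // andbT /=.
have -> : (ecol G [set u; v] == x) = false.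
  by apply: contraTF vx => /eqP <-; exact: ecol_not_vcol.
by case: (vcol G u == x); case: (vcol G v == x); case: q => [c|] /=; lia.
Qed.

(** The two preceding counts involve only the content, so the stubs at [x] are determined by it;
    this is the hypothesis on stubs in [third_pair]. *)
Lemma perm_stubs x ws ws' : is_vcol G x -> all_real ws -> all_real ws' ->
  perm_eq (flatten ws) (flatten ws') ->
  perm_eq (map fst (all_occs x ws)) (map fst (all_occs x ws')).
Proof.
move=> vx rws rws' p.
have cntE a vs : count a (map fst (all_occs x vs)) =
    (\sum_(w <- vs) count a (map fst (occs x None w None)))%N.
  by rewrite map_flatten count_flatten sumnE !big_map.
have cntF a vs : count a (flatten vs) = (\sum_(w <- vs) count a w)%N.
  by rewrite count_flatten sumnE big_map.
apply/allP=> -[c|] _ /=; apply/eqP.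
  have E vs : all_real vs -> count_mem (Some c) (map fst (all_occs x vs)) =
      (edge_ends x c * count_mem c (flatten vs))%N.
    move=> rvs; rewrite cntE cntF big_distrr /=; apply: eq_big_seq => w /rvs[u [r [ur <-]]].
    by rewrite count_edge_stubs.
  by rewrite !E // (permP p).
have E vs : all_real vs -> (count_mem None (map fst (all_occs x vs)) +
    \sum_(c <- flatten vs) edge_ends x c = 2 * count_mem x (flatten vs))%N.
  move=> rvs; rewrite cntE cntF big_distrr /= big_flatten /= -big_split /=.
  apply: eq_big_seq => w /rvs[u [r [ur <-]]].
  by rewrite -(count_end_stubs None vx ur) andbF addn0.
by have := E _ rws; rewrite (perm_big _ p) (permP p) -(E _ rws') => /addIn.
Qed.

Lemma tail_occs_sym x p2 ws k l :
  (k, l) \in tail_occs x p2 ws -> (l, k) \in tail_occs x p2 ws.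
Proof.
rewrite !mem_cat => /orP[/occs_sym ->//|/flattenP[_ /mapP[w w_in ->] /occs_sym kl]].
by apply/orP; right; apply/flattenP; exists (occs x None w None) => //; apply: map_f.
Qed.

Lemma tail_occs_fst_snd x p2 ws :
  perm_eq (map fst (tail_occs x p2 ws)) (map snd (tail_occs x p2 ws)).
Proof.
rewrite !map_cat perm_cat ?occs_fst_snd // /all_occs.
by elim: ws => //= w ws IHws; rewrite !map_cat perm_cat ?occs_fst_snd.
Qed.

(** [third_pair] supplies either a pair that can be repaired at once or a preparatory repair after
    which it can. *)
Lemma stub_step x q1 p2 ws q2 ws2 : is_vcol G x ->
  all_real ((q1 ++ x :: p2) :: ws) -> all_real ((q1 ++ x :: q2) :: ws2) ->
  perm_eq (flatten ((q1 ++ x :: p2) :: ws)) (flatten ((q1 ++ x :: q2) :: ws2)) ->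
  exists p2' ws', eqv ((q1 ++ x :: p2) :: ws) ((q1 ++ x :: p2') :: ws') /\
    ohead p2' = ohead q2.
Proof.
move=> vx rp rq pE; have [eq_h|neq_h] := eqVneq (ohead p2) (ohead q2).
  by exists p2, ws; split=> //; apply: eqv_refl.
have comp w w2 vs : all_real ((w ++ x :: w2) :: vs) -> ~~ inc x (olast w) (ohead w2).
  by move=> /all_real_cons[r _]; apply: real_compatible r.
have := perm_stubs vx rp rq pE; rewrite /all_occs /= !occs_split !map_cat /= -!catA.
rewrite perm_cat2l /= perm_cons -!map_cat => pS.
have pS' : perm_eq (ohead p2 :: map fst (tail_occs x p2 ws))
    (ohead q2 :: map fst (tail_occs x q2 ws2)).
  by rewrite /tail_occs !map_cat -!map_cat.
have inc_sym : ssrbool.symmetric (inc x) by move=> k l; rewrite incompatible_sym.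
have inc_trans : transitive (inc x) by move=> l k m; apply: incompatible_trans.
have [bs [bR]] := third_pair inc_sym inc_trans
  (tail_occs_fst_snd x p2 ws) (tail_occs_fst_snd x q2 ws2)
  (@tail_occs_sym x p2 ws) (fun k l => @tail_occs_compatible x q1 p2 ws k l vx rp)
  (fun k l => @tail_occs_compatible x q1 q2 ws2 k l vx rq)
  (comp _ _ _ rp) (comp _ _ _ rq) neq_h pS'.
case=> [cs|[g [d [dg cg_ cd cgb nbs]]]].
  have [p2' [ws' [e hE _]]] := repair_step vx rp bR (comp _ _ _ rq) cs.
  by exists p2', ws'.
have [p3 [ws3 [e3 h3 pR]]] := repair_step vx rp dg cg_ cd.
have bR3 : (bs, ohead q2) \in tail_occs x p3 ws3.
  have := perm_mem pR (bs, ohead q2); rewrite [in RHS]inE [in RHS]inE bR !orbT.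
  by move: nbs; rewrite !inE negb_or => /andP[/negPf-> /negPf->].
have [r3 _ _] := e3; rewrite -h3 in cgb.
have [p4 [ws4 [e4 h4 _]]] := repair_step vx r3 bR3 (comp _ _ _ rq) cgb.
by exists p4, ws4; split=> //; apply: eqv_trans e3 e4.
Qed.

(** Once the edge letter after [x] is right, the following vertex letter is right by edge
    regularity, so each step lengthens the common prefix by two letters. *)
Lemma pull_suffix x q1 p2 ws q2 ws2 : is_vcol G x ->
  all_real ((q1 ++ x :: p2) :: ws) -> all_real ((q1 ++ x :: q2) :: ws2) ->
  perm_eq (flatten ((q1 ++ x :: p2) :: ws)) (flatten ((q1 ++ x :: q2) :: ws2)) ->
  exists ws', eqv ((q1 ++ x :: p2) :: ws) ((q1 ++ x :: q2) :: ws').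
Proof.
have [n] := ubnP (size q2); elim: n x q1 p2 ws q2 => // n IHn x q1 p2 ws q2.
rewrite ltnS => leq2 vx rp rq pE.
have [p3 [ws3 [e3 h3]]] := stub_step vx rp rq pE.
have [r3 f3 _] := e3.
have [rp3 _] := (all_real_cons _ _).1 r3; have [rq' _] := (all_real_cons _ _).1 rq.
case: q2 leq2 rq pE h3 rq' => [|c q2] leq2 rq pE h3 rq'.
  by case: p3 h3 e3 {r3 f3 rp3} => // _ e3; exists ws3.
case: p3 h3 e3 r3 f3 rp3 => // _ p3 [->] e3 r3 f3 rp3.
have [u [v [q4 [uv ux cE q2E]]]] := real_next disjG vx rq'.
have [u' [v' [p4 [uv' ux' cE' p3E]]]] := real_next disjG vx rp3.
have vv : vcol G v' = vcol G v.
  by apply: (nbr_color regE uv' uv); rewrite ?ux ?ux' ?cE ?cE'.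
rewrite q2E in leq2 rq pE *; rewrite p3E vv in e3 r3 f3.
have catE w t : q1 ++ x :: c :: w :: t = (q1 ++ [:: x; c]) ++ w :: t by rewrite -catA.
have [|||||ws' e'] := IHn (vcol G v) (q1 ++ [:: x; c]) p4 ws3 q4.
- by apply: leq_trans leq2 => /=.
- exact: is_vcolP.
- by rewrite -catE.
- by rewrite -catE.
- by rewrite -!catE; apply: perm_trans pE; rewrite perm_sym.
by exists ws'; apply: eqv_trans e3 _; rewrite !catE.
Qed.

Lemma real_cons w : real w -> exists x t, w = x :: t /\ is_vcol G x.
Proof.
case=> u [p [_ <-]]; exists (vcol G u), (behead (word G u p)).
by rewrite -word_cons is_vcolP.
Qed.

Lemma pull ws Q ws2 : all_real ws -> all_real (Q :: ws2) ->
  perm_eq (flatten ws) (flatten (Q :: ws2)) -> exists ws', eqv ws (Q :: ws').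
Proof.
move=> rws rq pE; have [rQ _] := (all_real_cons _ _).1 rq.
have [x [q2 [QE vx]]] := real_cons rQ; rewrite {Q rQ}QE in rq pE *.
(* The stub [None] at [x] occurs in the target, hence in [ws]: some word there begins or ends with
   [x]. *)
have : None \in map fst (all_occs x ws).
  by rewrite (perm_mem (perm_stubs vx rws rq pE)) /all_occs /= eqxx.
case/mapP=> -[k l] /flattenP[_ /mapP[w w_in ->] kl] /= kE; rewrite -{k}kE in kl.
have [p2 [pw rp]] : exists p2, perm_eq w (x :: p2) /\ real (x :: p2).
  have rw := rws _ w_in.
  have [w1 [w2 [wE /= [[E _]|[_ E]]]]] := occsP kl.
    by exists w2; case: w1 wE E => [/= wE _|y w1 _];
      [rewrite -wE|case/lastP: w1 => [|w1 z] //=; rewrite map_rcons last_rcons].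
  exists (rev w1); case: w2 wE E => // wE _.
  have revE : rev w = x :: rev w1 by rewrite wE rev_cat.
  by rewrite -revE perm_sym perm_rev; split=> //; apply: real_rev.
have e1 := eqv_perm rws (perm_to_rem w_in); have [r1 _ _] := e1.
have e2 := eqv_word r1 rp pw; have e12 := eqv_trans e1 e2; have [r2 f2 _] := e12.
have [ws' e'] := pull_suffix (q1 := [::]) vx r2 rq
  (perm_trans (introT idP (etrans (perm_sym _ _) f2)) pE).
by exists ws'; apply: eqv_trans e12 e'.
Qed.

Lemma word_equivalence ws ws' : all_real ws -> all_real ws' ->
  perm_eq (flatten ws) (flatten ws') ->
  cg (\prod_(w <- ws) sw w) (\prod_(w <- ws') sw w).
Proof.
elim: ws' ws => [|Q ws' IHws] ws rws rws' pE.
  case: ws rws pE => [|w ws] rws pE //.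
  have [x [t [wE _]]] := real_cons ((all_real_cons _ _).1 rws).1.
  by have := perm_size pE; rewrite wE.
have [ws2 [r2 f2 c2]] := pull rws rws' pE.
apply: cg_trans c2 _; rewrite !big_cons; apply: cg_mul => //.
apply: IHws; rewrite ?((all_real_cons _ _).1 r2).2 //.
- by have [] := (all_real_cons _ _).1 r2.
- by have [] := (all_real_cons _ _).1 rws'.
by have := perm_trans (introT idP (etrans (perm_sym _ _) f2)) pE; rewrite /= perm_cat2l.
Qed.

End WordEquivalence.

(** * Monomials of the same content are congruent *)

Section IdealCongruence.
Variables (R : realType) (V : finType) (S : sigma_ring R V -> Prop).
Local Notation J := (ideal_gen S).

Lemma ideal_gen_in p : S p -> J p.
Proof.
by move=> Sp; exists 1%N, (fun=> 1), (fun=> p); split=> //; rewrite big_ord1 mul1r.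
Qed.

Lemma ideal_gen0 : J 0.
Proof. by exists 0%N, (fun=> 0), (fun=> 0); split=> [[]//|]; rewrite big_ord0. Qed.

Lemma ideal_genD p q : J p -> J q -> J (p + q).
Proof.
case=> n [a [g [gS ->]]] [m [b [h [hS ->]]]].
exists (n + m)%N, (fun k => match fintype.split k with inl i => a i | inr j => b j end),
  (fun k => match fintype.split k with inl i => g i | inr j => h j end); split.
  by move=> k; case: fintype.split.
rewrite big_split_ord /=; congr (_ + _); apply: eq_bigr => k _.
  by rewrite (unsplitK (inl k : 'I_n + 'I_m)).
by rewrite (unsplitK (inr k : 'I_n + 'I_m)).
Qed.

Lemma ideal_genMl a p : J p -> J (a * p).
Proof.
case=> n [b [g [gS ->]]]; exists n, (fun k => a * b k), g; split=> //.
by rewrite mulr_sumr; apply: eq_bigr => k _; rewrite mulrA.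
Qed.

Lemma ideal_gen_sum (I : Type) (r : seq I) (P : pred I) (F : I -> sigma_ring R V) :
  (forall i, P i -> J (F i)) -> J (\sum_(i <- r | P i) F i).
Proof. by move=> JF; apply: big_ind => //; [exact: ideal_gen0 | exact: ideal_genD]. Qed.

Definition cong p q : Prop := J (p - q).

Lemma cong_refl p : cong p p.
Proof. by rewrite /cong subrr; apply: ideal_gen0. Qed.

Lemma cong_sym p q : cong p q -> cong q p.
Proof. by move=> /(ideal_genMl (-1)); rewrite mulN1r opprB. Qed.

Lemma cong_trans p q r : cong p q -> cong q r -> cong p r.
Proof. by move=> pq qr; have := ideal_genD pq qr; rewrite addrA subrK. Qed.

Lemma cong_mul p q r s : cong p q -> cong r s -> cong (p * r) (q * s).
Proof.
move=> pq rs; rewrite /cong; have -> : p * r - q * s = r * (p - q) + q * (r - s) by ring.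
by apply: ideal_genD; apply: ideal_genMl.
Qed.

End IdealCongruence.

Section MonomialCongruence.
Variables (R : realType) (V : finType) (C : eqType) (G : cgraph V C).
Hypotheses (conG : connected_graph G) (cutG : geodesic_cut G) (regV : vertex_regular G)
  (regE : edge_regular G) (regT : triangle_counts_regular G)
  (disjG : disjoint_colors G).
Local Notation S := (fun p : sigma_ring R V =>
  linear_binomials G p \/ quadratic_binomials G p).
Local Notation cg := (cong S).

Lemma geodesic_exists u v : exists p, lgeo G u p && (last u p == v).
Proof.
have [p sp] := shortest_path_exists (connected_setT conG u v).
by exists p; rewrite (shortest_lgeo sp); case: sp => -[_ ->]; rewrite eqxx.
Qed.

Definition geodesic u v : seq V := xchoose (geodesic_exists u v).

Lemma geodesicP u v : lgeo G u (geodesic u v) /\ last u (geodesic u v) = v.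
Proof. by have /andP[? /eqP] := xchooseP (geodesic_exists u v). Qed.

Definition pair_word u v : seq C := word G u (geodesic u v).

Lemma pair_wordE u p : lgeo G u p -> pair_word u (last u p) = word G u p.
Proof.
have [up lp] := geodesicP u (last u p).
by move=> up'; rewrite /pair_word (lgeo_inj cutG up up' lp).
Qed.

(** All pairs of vertices with the same word give congruent variables modulo the linear binomials,
    so one of them is chosen to make the generator a function of the word. *)
Definition word_gen (w : seq C) : sigma_ring R V :=
  if [pick uv | pair_word uv.1 uv.2 == w] is Some uv then sigma R uv.1 uv.2 else 0.

Lemma linear_cong u p v q : lgeo G u p -> lgeo G v q ->
  perm_eq (word G u p) (word G v q) -> cg (sigma R u (last u p)) (sigma R v (last v q)).
Proof.
move=> up vq pE; apply: ideal_gen_in; left.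
exists u, (last u p), v, (last v q); split=> //.
exists p, q; split; try exact: lgeo_shortest.
apply: perm_trans (perm_trans pE (perm_word G v q)).
by rewrite perm_sym perm_word.
Qed.

Lemma word_genE u p : lgeo G u p -> cg (word_gen (word G u p)) (sigma R u (last u p)).
Proof.
move=> up; rewrite /word_gen; case: pickP => [[a b] /= /eqP wE|/(_ (u, last u p))].
  have [ab lb] := geodesicP a b; rewrite -{1}lb; apply: linear_cong => //.
  by rewrite -wE.
by rewrite /= pair_wordE // eqxx.
Qed.

Lemma word_gen_perm w w' : real G w -> real G w' -> perm_eq w w' ->
  cg (word_gen w) (word_gen w').
Proof.
case=> u [p [up <-]] [v [q [vq <-]]] pE.
apply: cong_trans (word_genE up) (cong_trans (linear_cong up vq pE) _).
exact: cong_sym (word_genE vq).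
Qed.

Lemma last_arms (m : V) p q : last (last m p) (rev (belast m p) ++ q) = last m q.
Proof. by rewrite last_cat; case: p => //= y s; rewrite rev_cons last_rcons. Qed.

Lemma perm_edges_arms (m : V) p q :
  perm_eq (path_edges (last m p) (rev (belast m p) ++ q)) (path_edges m p ++ path_edges m q).
Proof.
elim: p m q => [|a p IHp] m q //=; rewrite rev_cons -cats1 -catA /=.
rewrite (permPl (IHp a (m :: q))) /path_edges /= [[set a; m]]setUC.
by rewrite -[_ :: _ ++ _]/([:: _] ++ _) -[_ :: pairmap _ m q]/([:: _] ++ _) perm_catCA.
Qed.

Lemma word_gen_swap x w1 w2 w3 w4 : is_vcol G x ->
  real G (w1 ++ x :: w2) -> real G (w3 ++ x :: w4) ->
  ~~ incompatible G x (olast w1) (ohead w4) -> ~~ incompatible G x (olast w3) (ohead w2) ->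
  cg (word_gen (w1 ++ x :: w2) * word_gen (w3 ++ x :: w4))
     (word_gen (w1 ++ x :: w4) * word_gen (w3 ++ x :: w2)).
Proof.
move=> vx r12 r34 n14 n32.
have [m [a [b [c [d [[mx ma mb mc md] [[aE bE cE dE] [tab tcd tad tcb]]]]]]]] :=
  real_four_arms cutG regV regE regT disjG vx r12 r34 n14 n32.
have genE p q w w' : lgeo G m p -> lgeo G m q -> hturn G p q ->
    word G m p = x :: rev w -> word G m q = x :: w' ->
    cg (word_gen (w ++ x :: w')) (sigma R (last m p) (last m q)).
  move=> mp mq tpq pE qE; have [geo wE] := join_arms mp mq tpq.
  rewrite -[w in w ++ _]revK -[rev w]/(behead (x :: rev w)) -pE -qE -wE.
  rewrite -(last_arms m p q).
  exact: word_genE.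
apply: cong_trans (cong_mul (genE _ _ _ _ ma mb tab aE bE) (genE _ _ _ _ mc md tcd cE dE)) _.
apply: cong_trans (cong_sym (cong_mul (genE _ _ _ _ ma md tad aE dE)
  (genE _ _ _ _ mc mb tcb cE bE))).
(* Brings the indices into the pattern of [quadratic_binomials], with the ends of [a], [b], [d], [c]
   as i, j, k, l. *)
rewrite [sigma R (last m c) (last m d)]sigmaC [sigma R (last m c) _]sigmaC.
apply: ideal_gen_in; right.
exists (last m a), (last m b), (last m d), (last m c); split=> //.
have sp p q : lgeo G m p -> lgeo G m q -> hturn G p q ->
    shortest_path G (last m p) (last m q) (rev (belast m p) ++ q).
  move=> mp mq tpq; have [geo _] := join_arms mp mq tpq.
  rewrite -(last_arms m p q).
  exact: lgeo_shortest.
have tdc : hturn G d c by rewrite hturn_sym.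
have tbc : hturn G b c by rewrite hturn_sym.
exists (rev (belast m a) ++ b), (rev (belast m d) ++ c), (rev (belast m a) ++ d),
  (rev (belast m b) ++ c); split; try exact: sp.
rewrite (permPl (perm_cat (perm_edges_arms _ _ _) (perm_edges_arms _ _ _))).
rewrite (permPr (perm_cat (perm_edges_arms _ _ _) (perm_edges_arms _ _ _))).
by rewrite perm_catACA.
Qed.

Definition var_word (s : 'I_#|spair V|) : seq C :=
  pair_word (val (enum_val s)).1 (val (enum_val s)).2.

Definition monomial_words (m : 'X_{1..#|spair V|}) : seq (seq C) :=
  flatten [seq nseq (m s) (var_word s) | s <- enum 'I_#|spair V|].

Definition content m : seq C := flatten (monomial_words m).

Lemma spair_ofE (s : spair V) : spair_of (val s).1 (val s).2 = s.
Proof.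
case: s => -[i j] /= ij; apply: val_inj; rewrite /spair_of; case: leqP => //= h.
by rewrite leqNgt h in ij.
Qed.

Lemma var_sigma (s : 'I_#|spair V|) :
  'X_s = sigma R (val (enum_val s)).1 (val (enum_val s)).2.
Proof. by rewrite /sigma spair_ofE enum_valK. Qed.

Lemma monomial_wordsE m : cg (\prod_(w <- monomial_words m) word_gen w) 'X_[m].
Proof.
rewrite mpolyXE_id /monomial_words big_flatten big_map big_enum /=.
elim/big_rec2: _ => [|s y1 y2 _ IH]; first exact: cong_refl.
apply: cong_mul IH; elim: (m s) => [|k IHk]; first by rewrite big_nil expr0; exact: cong_refl.
rewrite /= big_cons exprS; apply: cong_mul IHk; rewrite var_sigma.
set u := _.1; set v := _.2; have [uv lv] := geodesicP u v.
by have := word_genE uv; rewrite lv.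
Qed.

Lemma content_cong m m' : perm_eq (content m) (content m') -> cg 'X_[m] 'X_[m'].
Proof.
move=> pE; apply: cong_trans (cong_sym (monomial_wordsE m)) _.
apply: cong_trans (monomial_wordsE m').
have rW k : all_real G (monomial_words k).
  move=> w /flattenP[_ /mapP[s _ ->]] /nseqP[-> _].
  have [uv _] := geodesicP (val (enum_val s)).1 (val (enum_val s)).2.
  by do 2!eexists; split; first exact: uv.
apply: (word_equivalence cutG regV regE regT disjG) => //.
- exact: cong_refl.
- exact: cong_trans.
- exact: cong_mul.
- exact: word_gen_perm.
- exact: word_gen_swap.
Qed.

End MonomialCongruence.

(** * Separating the contents *)

Section Monic0.
Variable R : fieldType.

Definition mono (n : nat) (p : {poly R}) : Prop := exists g, p = 'X^n * g /\ g.[0] = 1.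

Lemma mono0 p : p.[0] = 1 -> mono 0 p.
Proof. by exists p; rewrite expr0 mul1r. Qed.

Lemma mono_mul m n p q : mono m p -> mono n q -> mono (m + n) (p * q).
Proof.
move=> [g [-> g0]] [h [-> h0]]; exists (g * h); rewrite hornerM g0 h0 mulr1; split=> //.
by rewrite exprD mulrACA.
Qed.

Lemma mono_Xn n : mono n 'X^n.
Proof. by exists 1; rewrite mulr1 hornerC. Qed.

Lemma mono_exp n k p : mono n p -> mono (k * n) (p ^+ k).
Proof.
move=> np; elim: k => [|k IHk]; first by apply: mono0; rewrite hornerC.
by rewrite exprS mulSn; apply: mono_mul.
Qed.

Lemma mono_prod (I : eqType) (r : seq I) (w : I -> nat) (F : I -> {poly R}) :
  (forall i, i \in r -> mono (w i) (F i)) -> mono (\sum_(i <- r) w i) (\prod_(i <- r) F i).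
Proof.
elim: r => [|i r IHr] Fr; first by rewrite !big_nil; apply: mono0; rewrite hornerC.
rewrite !big_cons; apply: mono_mul; first by apply: Fr; rewrite inE eqxx.
by apply: IHr => j jr; apply: Fr; rewrite inE jr orbT.
Qed.

Lemma mono_cancel n p q : q.[0] = 1 -> mono n (p * q) -> mono n p.
Proof.
move=> q0 [g [E g0]]; have /dvdpP[h hE] : 'X^n %| p.
  by apply: (@dvdXn_cancel _ _ q); rewrite ?q0 ?oner_neq0 // mulrC E dvdp_mulIl.
exists h; split; first by rewrite mulrC.
have : 'X^n * (h * q) = 'X^n * g by rewrite -E hE; ring.
by move/(mulfI (monic_neq0 (monicXn _ _)))=> hg; rewrite -g0 -hg hornerM q0 mulr1.
Qed.

Lemma mono_coef n p k : mono n p -> (k <= n)%N -> p`_k = (k == n)%:R.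
Proof.
move=> [g [-> g0]] kn; rewrite coefXnM; case: ltngtP kn => // -> _.
by rewrite subnn -horner_coef0.
Qed.

End Monic0.

Section MonomialFamily.
Variables (R : realType) (V : finType) (C : eqType) (G : cgraph V C).
Hypotheses (cutG : geodesic_cut G) (regE : edge_regular G).
Variables (n : nat) (a b : C -> nat).
Hypotheses (n_gt0 : (0 < n)%N)
  (b_range : forall i j, G i j -> (n <= b (ecol G [set i; j]) < n.*2)%N).

(** The minus sign makes the edge entries of the inverse start with a positive power of ['X] of
    coefficient 1. *)
Let K : 'M[{poly R}]_#|V| := mxV (fun i j =>
  if i == j then 1 else if G i j then - 'X^(b (ecol G [set i; j])) else 0).

Let KE i j : ent K i j =
  if i == j then 1 else if G i j then - 'X^(b (ecol G [set i; j])) else 0.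
Proof. exact: ent_mxV. Qed.

Let symK i j : ent K i j = ent K j i.
Proof. by rewrite !KE eq_sym adj_sym setUC. Qed.

Let K_nonedge i j : i != j -> ~~ G i j -> ent K i j = 0.
Proof. by rewrite KE => /negPf-> /negPf->. Qed.

Let b_gt0 i j : G i j -> (0 < b (ecol G [set i; j]))%N.
Proof. by move=> /b_range/andP[/(leq_trans n_gt0)]. Qed.

Let K_at0 : map_mx (horner_eval 0) K = 1%:M.
Proof.
apply/entP=> i j; rewrite ent_map KE ent_scalar /horner_eval.
case: eqP => _; first by rewrite hornerC.
case: ifP => [ij|_]; last by rewrite hornerC.
by rewrite hornerN hornerXn expr0n gtn_eqF ?b_gt0 // oppr0.
Qed.

Let N i j := ent (\adj K) i j.

Let N_row i j : i != j -> N i j = - \sum_(v | v != i) ent K i v * N v j.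
Proof.
move=> ij; have := mulK_adj K i j; rewrite (negPf ij) mulr0n (bigD1 i) //=.
by rewrite KE eqxx mul1r => /eqP; rewrite addr_eq0 => /eqP.
Qed.

Let K_dvd i v : v != i -> 'X^n %| ent K i v.
Proof.
rewrite KE eq_sym => /negPf->; case: ifP => [iv|_]; last exact: dvdp0.
by rewrite dvdpNr dvdp_exp2l //; have /andP[] := b_range iv.
Qed.

Let dvdp_sum (I : finType) (P : pred I) (F : I -> {poly R}) q :
  (forall i, P i -> q %| F i) -> q %| \sum_(i | P i) F i.
Proof. by move=> qF; apply: (big_ind (fun p => q %| p)); [exact: dvdp0 | exact: dvdp_add |]. Qed.

Let N_dvd i j : i != j -> 'X^n %| N i j.
Proof.
by move=> ij; rewrite N_row // dvdpNr; apply: dvdp_sum => v vi; rewrite dvdp_mulr ?K_dvd.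
Qed.

Let N_diag0 i : (N i i).[0] = 1.
Proof. by have := adjK_at0 K_at0 i i; rewrite eqxx. Qed.

(** Contributions through a third vertex have order at least [2n], which exceeds every edge exponent
    by [b_range], so the direct edge dominates. *)
Let N_edge i j : G i j -> mono (b (ecol G [set i; j])) (N i j).
Proof.
move=> ij; have nij := adj_neq ij; have /andP[_ b_lt] := b_range ij.
have ji : j != i by rewrite eq_sym.
rewrite N_row // (bigD1 j) //= KE (negPf nij) ij; set S := \sum_(_ | _) _.
have /dvdpP[r rE] : 'X^((b (ecol G [set i; j])).+1) %| S.
  apply: dvdp_sum => v /andP[vi vj]; apply: (@dvdp_trans _ ('X^n * 'X^n)).
    by rewrite -exprD addnn dvdp_exp2l.
  by apply: dvdp_mul; [apply: K_dvd | apply: N_dvd].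
exists (N j j - 'X * r); rewrite rE exprS; split; first by ring.
by rewrite hornerD hornerN hornerM hornerX mul0r subr0.
Qed.

Let N_path u p : lgeo G u p ->
  mono (\sum_(s <- path_edges u p) b (ecol G s)) (N u (last u p)).
Proof.
move=> up; have symN : forall x y, N x y = N y x by exact: adjK_sym.
have hor0 (I : eqType) (r : seq I) (F : I -> {poly R}) :
    (forall i, i \in r -> (F i).[0] = 1) -> (\prod_(i <- r) F i).[0] = 1.
  move=> F0; rewrite -[LHS]/(horner_eval 0 _) rmorph_prod /= big_seq big1 //.
have := @path_formula _ _ G _ N symN _ u p cutG up.
move=> /(_ (fun i j k => @adjK_cut R V C G K K_nonedge K_at0 i j k)) E.
apply: (@mono_cancel _ _ _ (\prod_(s <- path_edges u p) ends_val N s)).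
  apply: hor0 => s _; rewrite /ends_val -[LHS]/(horner_eval 0 _) rmorph_prod /=.
  by rewrite big1 // => v _; apply: N_diag0.
rewrite E -[X in mono X]addn0; apply: mono_mul.
  apply: mono_prod => s /(path_edges_is_edge (lgeo_path up))[x [y [xy ->]]].
  by rewrite edge_valE //; apply: N_edge.
by apply: mono0; apply: hor0 => v _; apply: N_diag0.
Qed.

(** The adjugate alone records only the edges of a geodesic; rescaling rows and columns also records
    the colors of its two ends. *)
Definition monomial_family : 'M[{poly R}]_#|V| :=
  mxV (fun i j => 'X^(a (vcol G i) + a (vcol G j)) * N i j).

Lemma monomial_family_path u p : lgeo G u p ->
  mono (a (vcol G u) + a (vcol G (last u p)) + \sum_(s <- path_edges u p) b (ecol G s))
       (ent monomial_family u (last u p)).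
Proof. by move=> up; rewrite ent_mxV; apply: mono_mul (mono_Xn _ _) (N_path up). Qed.

Lemma monomial_family_vanish (p : sigma_ring R V) e : graph_ideal G p ->
  e != 0 -> (\det K).[e] != 0 -> eval_at (map_mx (horner_eval e) monomial_family) p = 0.
Proof.
move=> /graph_idealP Ip e0 d0; apply: Ip; pose u i := e ^+ a (vcol G i).
have u0 i : u i != 0 by rewrite expf_neq0.
(* The inverse of the rescaled adjugate is [K] with rows and columns divided by [u], over the
   determinant. It lies in L_G because edge regularity makes the product of [u] over the ends of an
   edge a function of the edge color. *)
pose f i j := (\det K).[e]^-1 * ((u i)^-1 * (u j)^-1) * (ent K i j).[e].
have [K' K'E] : exists K', forall i j, ent K' i j = f i j.
  by exists (mxV f) => i j; rewrite ent_mxV.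
have KS : K' *m map_mx (horner_eval e) monomial_family = 1%:M.
  apply/entP=> i j; rewrite ent_mul ent_scalar.
  transitivity ((\det K).[e]^-1 * ((u i)^-1 * u j) * (\sum_v ent K i v * N v j).[e]).
    rewrite [X in _ = _ * X]horner_sum mulr_sumr; apply: eq_bigr => v _; rewrite K'E /f ent_map.
    rewrite [ent monomial_family v j]ent_mxV.
    rewrite /horner_eval [X in _ = _ * X]hornerM [('X^_ * N v j).[e]]hornerM
      hornerXn exprD -/(u v) -/(u j).
    transitivity ((\det K).[e]^-1 * ((u i)^-1 * u j) *
      ((ent K i v).[e] * (N v j).[e]) * ((u v)^-1 * u v)).
      by ring.
    by rewrite mulVf // mulr1.
  rewrite mulK_adj hornerMn; have [<-|_] := eqVneq i j; last by rewrite !mulr0n mulr0.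
  by rewrite !mulr1n mulVf // mulr1 mulVf.
have [Ku Su] := mulmx1_unit KS.
exists K'; split=> //; last first.
  by rewrite -[RHS]mulmx1 -KS mulmxA mulVmx // mul1mx.
split.
- by apply/sym_entP=> i j; rewrite !K'E /f symK [(u i)^-1 * _]mulrC.
- by move=> i j ij nij; rewrite -[entry _ _ _]/(ent K' i j) K'E /f K_nonedge // horner0 mulr0.
- by move=> i j ij; rewrite -![entry _ _ _]/(ent K' _ _) !K'E /f !KE !eqxx /u ij.
move=> i j k l ij kl cE; rewrite -![entry _ _ _]/(ent K' _ _) !K'E /f !KE.
rewrite (negPf (adj_neq ij)) (negPf (adj_neq kl)) ij kl cE.
have /edge_regularP/(_ _ _ _ _ ij kl cE)/perm2P[] := regE => -[e1 e2]; rewrite /u e1 e2 //.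
by congr (_ * _ * _); exact: mulrC.
Qed.

Lemma monomial_family_relation (s : seq 'X_{1..#|spair V|}) (c : 'X_{1..#|spair V|} -> R) :
  graph_ideal G (\sum_(m <- s) c m *: 'X_[m]) ->
  \sum_(m <- s) (c m)%:P * \prod_t
    ent monomial_family (val (enum_val t)).1 (val (enum_val t)).2 ^+ m t = 0.
Proof.
move=> Ip; have q0 : 'X * \det K != 0.
  by rewrite mulf_neq0 ?polyX_eq0 // (detK_neq0 K_at0).
apply: (poly_fun0_generic q0) => e; rewrite hornerM hornerX mulf_eq0 negb_or.
case/andP=> e0 d0; rewrite -[RHS](monomial_family_vanish Ip e0 d0).
rewrite horner_sum /eval_at raddf_sum /=; apply: eq_bigr => m _.
rewrite mevalZ mevalX hornerM hornerC -[(\prod_t _).[e]]/(horner_eval e _) rmorph_prod.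
congr (_ * _); apply: eq_bigr => t _; rewrite rmorphXn /=.
by rewrite -[entry _ _ _]/(ent _ _ _) ent_map.
Qed.

End MonomialFamily.

(** Comparison of digits in base [M], starting with the lowest; the last summands stand for all
    higher digits. *)
Lemma base_digits (T : eqType) (cols : seq T) (f g : T -> nat) (M e e' : nat) : uniq cols ->
  (forall c, f c < M)%N -> (forall c, g c < M)%N ->
  (\sum_(c <- cols) f c * M ^ index c cols + M ^ size cols * e =
   \sum_(c <- cols) g c * M ^ index c cols + M ^ size cols * e')%N ->
  forall c, c \in cols -> f c = g c.
Proof.
move=> uc fM gM; elim: cols uc => [|x t IHt] //= /andP[xt ut].
have shift (h : T -> nat) k : (\sum_(c <- x :: t) h c * M ^ index c (x :: t) + M ^ (size t).+1 * k =
    h x + M * (\sum_(c <- t) h c * M ^ index c t + M ^ size t * k))%N.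
  rewrite big_cons /= eqxx expn0 muln1 -addnA mulnDr mulnA -expnS; congr (_ + (_ + _))%N.
  rewrite big_distrr /=; apply: eq_big_seq => c ct.
  rewrite ifN; last by apply: contraNneq xt => ->.
  by rewrite expnS mulnCA.
rewrite !shift => E c; have M0 : (0 < M)%N := leq_ltn_trans (leq0n _) (fM x).
have fx : f x = g x.
  by have := congr1 (modn^~ M) E; rewrite /= ![(_ + M * _)%N]addnC ![(M * _)%N]mulnC
    !modnMDl !modn_small.
rewrite inE => /orP[/eqP-> //|]; apply: IHt => //.
by move/eqP: E; rewrite fx eqn_add2l eqn_pmul2l // => /eqP.
Qed.

Lemma sum_count_mem (T : eqType) (cols s : seq T) (F : T -> nat) : uniq cols ->
  {subset s <= cols} ->
  (\sum_(c <- s) F c = \sum_(c <- cols) count_mem c s * F c)%N.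
Proof.
move=> uc; elim: s => [|x s IHs] sc; first by rewrite big_nil big1.
rewrite big_cons IHs => [|y ys]; last by apply: sc; rewrite inE ys orbT.
under [RHS]eq_bigr do rewrite /= mulnDl; rewrite big_split /=; congr (_ + _)%N.
have xc : x \in cols by apply: sc; rewrite inE eqxx.
rewrite (bigD1_seq x) //= eqxx mul1n big1_seq ?addn0 // => c /andP[cx _].
by rewrite eq_sym (negPf cx).
Qed.

(** * Recovering the content from a weight *)

Section Skeleton.
Variables (V : finType) (C : eqType) (G : cgraph V C).
Hypotheses (conG : connected_graph G) (regE : edge_regular G) (disjG : disjoint_colors G).

(** The colors that the exponents in [monomial_family_path] can see. *)
Definition skeleton u p : seq C :=
  [:: vcol G u; vcol G (last u p)] ++ map (ecol G) (path_edges u p).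

Lemma count_word_edges c u p : ~~ is_vcol G c ->
  count_mem c (word G u p) = count_mem c (skeleton u p).
Proof.
move=> vc; have nv v : (vcol G v == c) = false.
  by apply: contraNF vc => /eqP <-; apply: is_vcolP.
rewrite /skeleton /= !nv /= !add0n; elim: p u => [|v p IHp] u /=; first by rewrite nv.
by rewrite nv IHp.
Qed.

(** Handshake: interior vertices are counted twice by the edges, the two end vertices once by the
    edges and once by the skeleton itself. *)
Lemma count_word_vertices x u p : is_vcol G x -> path G u p ->
  (2 * count_mem x (word G u p) =
   count_mem x (skeleton u p) + \sum_(c <- skeleton u p) edge_ends G x c)%N.
Proof.
move=> vx up; rewrite /skeleton count_cat big_cat /= !big_cons big_nil.
rewrite !(edge_ends_vcol disjG) ?is_vcolP //.
have -> : count_mem x (map (ecol G) (path_edges u p)) = 0%N.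
  apply/count_memPn/mapP=> -[s /(path_edges_is_edge up)[a [b [ab ->]]] xE].
  by have := ecol_not_vcol disjG ab; rewrite -xE vx.
elim: p u up => [|v p IHp] u /=; first by rewrite big_nil; lia.
case/andP=> uv vp; rewrite big_cons (edge_endsE regE) //.
have := IHp v vp; have -> : (ecol G [set u; v] == x) = false.
  by apply: contraTF vx => /eqP <-; exact: ecol_not_vcol.
by case: (vcol G u == x); case: (vcol G v == x) => /=; lia.
Qed.

Definition colors : seq C :=
  undup (map (vcol G) (enum V) ++ [seq ecol G [set x; y] | x <- enum V, y <- enum V]).

Lemma vcol_colors v : vcol G v \in colors.
Proof. by rewrite mem_undup mem_cat map_f ?mem_enum. Qed.

Lemma ecol_colors x y : ecol G [set x; y] \in colors.
Proof.
rewrite mem_undup mem_cat; apply/orP; right.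
by apply/allpairsP; exists (x, y); rewrite !mem_enum.
Qed.

Lemma skeleton_colors u p : path G u p -> {subset skeleton u p <= colors}.
Proof.
move=> up c; rewrite !inE => /or3P[/eqP->|/eqP->|]; rewrite ?vcol_colors //.
by case/mapP=> s /(path_edges_is_edge up)[x [y [_ ->]]] ->; apply: ecol_colors.
Qed.

Let var_pair (s : 'I_#|spair V|) : V * V := val (enum_val s).

Definition var_skeleton (s : 'I_#|spair V|) : seq C :=
  skeleton (var_pair s).1 (geodesic conG (var_pair s).1 (var_pair s).2).

Definition monomial_skeleton (m : 'X_{1..#|spair V|}) : seq C :=
  flatten [seq flatten (nseq (m s) (var_skeleton s)) | s <- enum 'I_#|spair V|].

Lemma sum_monomial_skeleton m (F : C -> nat) :
  (\sum_(c <- monomial_skeleton m) F c = \sum_s m s * \sum_(c <- var_skeleton s) F c)%N.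
Proof.
rewrite /monomial_skeleton big_flatten big_map big_enum /=; apply: eq_bigr => s _.
rewrite big_flatten /= big_nseq_cond /=.
by elim: (m s) => //= k ->; rewrite mulSn.
Qed.

Lemma sum_content m (F : C -> nat) :
  (\sum_(c <- content conG m) F c = \sum_s m s * \sum_(c <- var_word conG s) F c)%N.
Proof.
rewrite /content /monomial_words !big_flatten big_map big_enum /=; apply: eq_bigr => s _.
by rewrite big_nseq_cond /=; elim: (m s) => //= k ->; rewrite mulSn.
Qed.

Lemma count_mem_sum (T : eqType) (c : T) s : count_mem c s = (\sum_(x <- s) (x == c))%N.
Proof. by elim: s => [|x s IHs] /=; rewrite ?big_nil // big_cons IHs. Qed.

Lemma perm_content m m' : perm_eq (monomial_skeleton m) (monomial_skeleton m') ->
  perm_eq (content conG m) (content conG m').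
Proof.
move=> pE; apply/allP=> c _; apply/eqP => /=.
rewrite !count_mem_sum !sum_content.
have [vc|nvc] := boolP (is_vcol G c); last first.
  have E (k : 'X_{1..#|spair V|}) : (\sum_s k s * \sum_(x <- var_word conG s) (x == c) =
      \sum_(x <- monomial_skeleton k) (x == c))%N.
    rewrite sum_monomial_skeleton; apply: eq_bigr => s _.
    by rewrite -!count_mem_sum count_word_edges.
  by rewrite !E (perm_big _ pE).
apply/eqP; rewrite -(@eqn_pmul2l 2) //; apply/eqP.
have E (k : 'X_{1..#|spair V|}) : (2 * \sum_s k s * \sum_(x <- var_word conG s) (x == c) =
    \sum_(x <- monomial_skeleton k) ((x == c) + edge_ends G c x))%N.
  rewrite sum_monomial_skeleton big_distrr /=; apply: eq_bigr => s _.
  rewrite mulnCA -count_mem_sum count_word_vertices //; last first.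
    by have [geo _] := geodesicP conG (var_pair s).1 (var_pair s).2; apply: lgeo_path geo.
  by rewrite big_split /= -count_mem_sum.
by rewrite !E (perm_big _ pE).
Qed.

Lemma monomial_skeleton_colors m : {subset monomial_skeleton m <= colors}.
Proof.
move=> c /flattenP[_ /mapP[s _ ->]] /flattenP[_ /nseqP[-> _]]; apply: skeleton_colors.
by have [geo _] := geodesicP conG (var_pair s).1 (var_pair s).2; apply: lgeo_path geo.
Qed.

Section Weights.
Variable M : nat.

Definition vweight c := (M ^ index c colors)%N.
(** The offset puts all edge weights into an interval from [n] to [2n], as [b_range] requires, with
    [n = M ^ size colors]. *)
Definition eweight c := (M ^ size colors + M ^ index c colors)%N.
Definition weight c := if is_vcol G c then vweight c else eweight c.
Definition monomial_weight m := (\sum_(c <- monomial_skeleton m) weight c)%N.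

(** The numbers of occurrences of the colors are the lowest digits of the weight in base [M]; the
    offset in [eweight] affects higher digits only. *)
Lemma monomial_weight_inj m m' :
  (size (monomial_skeleton m) < M)%N -> (size (monomial_skeleton m') < M)%N ->
  monomial_weight m = monomial_weight m' ->
  perm_eq (monomial_skeleton m) (monomial_skeleton m').
Proof.
move=> mM mM' wE.
have E (k : 'X_{1..#|spair V|}) : (monomial_weight k =
  \sum_(c <- colors) count_mem c (monomial_skeleton k) * M ^ index c colors
    + M ^ size colors * count (predC (is_vcol G)) (monomial_skeleton k))%N.
  rewrite -sum_count_mem; [|exact: undup_uniq|exact: monomial_skeleton_colors].
  rewrite -sum1_count big_distrr /= [X in (_ + X)%N]big_mkcond -big_split /=.
  apply: eq_bigr => c _; rewrite /weight /vweight /eweight.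
  by case: (is_vcol G c); rewrite /= ?addn0 // muln1 addnC.
rewrite !E in wE.
have lt (k : 'X_{1..#|spair V|}) c :
  (size (monomial_skeleton k) < M -> count_mem c (monomial_skeleton k) < M)%N.
  exact/leq_ltn_trans/count_size.
have cntE := base_digits (undup_uniq _) (fun c => lt _ c mM) (fun c => lt _ c mM') wE.
apply/allP=> c; rewrite mem_cat => c_in; apply/eqP/cntE.
by case/orP: c_in => /monomial_skeleton_colors.
Qed.

End Weights.

End Skeleton.

(** * Generation of the ideal by the binomials *)

Section Generation.
Variables (R : realType) (V : finType) (C : eqType) (G : cgraph V C).
Hypotheses (conG : connected_graph G) (cutG : geodesic_cut G) (regV : vertex_regular G)
  (regE : edge_regular G) (regT : triangle_counts_regular G)
  (disjG : disjoint_colors G).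
Local Notation S := (fun p : sigma_ring R V =>
  linear_binomials G p \/ quadratic_binomials G p).
Local Notation I := (@graph_ideal R V C G).
Implicit Types m : 'X_{1..#|spair V|}.

Lemma binomials_in_ideal p : ideal_gen S p -> I p.
Proof.
case=> n [a [g [gS ->]]] A XA; rewrite /eval_at raddf_sum /= big1 // => k _.
rewrite mevalM -[X in _ * X]/(eval_at A (g k)).
suff -> : eval_at A (g k) = 0 by rewrite mulr0.
case: (gS k) => -[i [j [k' [l [sp ->]]]]].
  exact: (linear_binomials_in_ideal cutG regV regE regT disjG sp XA).
exact: (quadratic_binomials_in_ideal cutG sp XA).
Qed.

Section Bounded.
Variable M : nat.
Hypothesis M_gt1 : (1 < M)%N.
Local Notation fam := (monomial_family R G (vweight G M) (eweight G M)).
Local Notation W := (monomial_weight conG M).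

Lemma eweight_gt0 : (0 < M ^ size (colors G))%N.
Proof. by rewrite expn_gt0 (ltnW M_gt1). Qed.

Lemma eweight_range i j : G i j ->
  (M ^ size (colors G) <= eweight G M (ecol G [set i; j]) < (M ^ size (colors G)).*2)%N.
Proof.
move=> _; rewrite /eweight leq_addr /= -addnn ltn_add2l ltn_exp2l //.
by rewrite index_mem ecol_colors.
Qed.

Lemma fam_monomial m : mono (W m)
  (\prod_t ent fam (val (enum_val t)).1 (val (enum_val t)).2 ^+ m t).
Proof.
rewrite /monomial_weight sum_monomial_skeleton; apply: mono_prod => t _; apply: mono_exp.
rewrite /var_skeleton; set u := _.1; set v := _.2.
have [geo lv] := geodesicP conG u v; rewrite -[in ent _ u v]lv.
have := monomial_family_path R cutG (vweight G M) eweight_gt0 eweight_range geo.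
congr mono; rewrite /skeleton big_cat !big_cons big_nil big_map /= addn0 /weight !is_vcolP.
congr (_ + _)%N; apply: eq_big_seq => s /(path_edges_is_edge (lgeo_path geo))[x [y [xy ->]]].
by rewrite (negPf (ecol_not_vcol disjG xy)).
Qed.

(* The monomials of least weight have coefficient sum zero and are congruent. *)
Lemma bounded_ideal_binomials (s : seq 'X_{1..#|spair V|}) (c : 'X_{1..#|spair V|} -> R) :
  (forall m, m \in s -> (size (monomial_skeleton conG m) < M)%N) ->
  I (\sum_(m <- s) c m *: 'X_[m]) -> ideal_gen S (\sum_(m <- s) c m *: 'X_[m]).
Proof.
have [n] := ubnP (size s); elim: n s => // n IHn s; rewrite ltnS => sn sM Is.
case: s sn sM Is => [|m1 s1]; first by rewrite big_nil => *; apply: ideal_gen0.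
set s := m1 :: s1 => sn sM Is.
have [|k /hasP[m0 m0s /eqP m0k] k_min] := @ex_minnP (fun k => has (fun m => W m == k) s).
  by exists (W m1); rewrite /= eqxx.
(* Substituting the family and reading off the coefficient of [e^k]: monomials of larger weight do
   not contribute, those of weight [k] contribute 1 each. *)
have class0 : \sum_(m <- s | W m == k) c m = 0.
  have /(congr1 (fun p : {poly R} => p`_k)) :=
    monomial_family_relation regE (vweight G M) eweight_gt0 eweight_range Is.
  rewrite coef0 coef_sum => E; rewrite -[RHS]E [LHS]big_mkcond; apply: eq_big_seq => m ms.
  have kW : (k <= W m)%N by apply: k_min; apply/hasP; exists m.
  rewrite coefCM (mono_coef (fam_monomial m) kW) eq_sym.
  by case: eqP; rewrite ?mulr1 ?mulr0.
have class_in : ideal_gen S (\sum_(m <- s | W m == k) c m *: 'X_[m]).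
  have -> : \sum_(m <- s | W m == k) c m *: 'X_[m] =
      \sum_(m <- s | W m == k) c m *: ('X_[m] - 'X_[m0]) :> sigma_ring R V.
    under [RHS]eq_bigr do rewrite scalerBr.
    by rewrite sumrB -scaler_suml class0 scale0r subr0.
  rewrite big_seq_cond; apply: ideal_gen_sum => m /andP[ms /eqP mk].
  rewrite -mul_mpolyC; apply: ideal_genMl.
  rewrite -[ideal_gen _ _]/(cong S 'X_[m] 'X_[m0]).
  apply: (@content_cong R V C G conG) => //.
  apply: (perm_content regE disjG); apply: (monomial_weight_inj (sM _ ms) (sM _ m0s)).
  by rewrite mk m0k.
rewrite (bigID (fun m => W m == k)) /=; apply: (ideal_genD class_in).
rewrite -big_filter; apply: IHn.
- apply: leq_trans sn; rewrite size_filter -(count_predC (fun m => W m == k) s).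
  by rewrite -[X in (X < _)%N]add0n ltn_add2r -has_count; apply/hasP; exists m0; rewrite ?m0k.
- by move=> m; rewrite mem_filter => /andP[_ /sM].
move=> A XA; have := Is A XA; rewrite big_filter (bigID (fun m => W m == k)) /= rmorphD /=.
by rewrite (binomials_in_ideal class_in XA) add0r.
Qed.

End Bounded.

Lemma binomials_generate : generates S I.
Proof.
move=> p; split; last exact: binomials_in_ideal.
(* Adding 2 to the maximal size makes the base exceed both every skeleton size of the support and
   1. *)
rewrite [p]mpolyE; apply: (@bounded_ideal_binomials
  (\max_(m <- msupp p) size (monomial_skeleton conG m)).+2) => // m mp.
by rewrite ltnS leqW // (leq_bigmax_seq m).
Qed.

End Generation.

Theorem theorem3p1 (R : realType) (V : finType) (C : eqType) (G : cgraph V C)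
    (G_connected : connected_graph G) (G_disjoint : disjoint_colors G) :
  (binomial_ideal (@graph_ideal R V C G) <->
     triangle_regular G /\ block_graph G) /\
  (triangle_regular G /\ block_graph G ->
     generates (fun p => linear_binomials G p \/ quadratic_binomials G p)
       (@graph_ideal R V C G)).
Proof.
have gen : triangle_regular G /\ block_graph G ->
    generates (fun p => linear_binomials G p \/ quadratic_binomials G p)
      (@graph_ideal R V C G).
  case=> -[regV regE regT] blockG; apply: binomials_generate => //.
    exact: block_geodesic_cut.
  exact/(edge_triangle_regularP regE).
split=> //; split=> [binI|/gen genI]; first exact: binomial_regular_block binI G_connected.
exists (fun p => linear_binomials G p \/ quadratic_binomials G p); split=> // p.
case=> -[i [j [k [l [_ ->]]]]]; first by do 2!eexists; reflexivity.
by rewrite /sigma -!mpolyXD; do 2!eexists.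
Qed.
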